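(* Let $d,k\ge1$ be integers and let $0<\alpha_i,\beta_i<d$, $i=1,\dots,k$, satisfy $$\gamma:=\alpha_1+\dots+\alpha_k-(k-1)d>0,\qquad \beta_1+\dots+\beta_k-(k-1)d>0.$$ Let $\mathcal R_1,\dots,\mathcal R_k$ be independent random subsets of $\mathbb Z^d$ with the following property: there are constants $0<c\le C<\infty$ such that for every $i\in\{1,\dots,k\}$, every finite set $B\subset\mathbb Z^d$ containing the origin and every $x\in\mathbb Z^d\setminus\{0\}$ with $|x|\ge2\,\mathrm{diam}(B)$, $$c\,|x|^{-\beta_i}\,\mathrm{Cap}_{\alpha_i}(B)\le\mathbb P\big(\mathcal R_i\cap(x+B)\neq\emptyset\big)\le C\,|x|^{-\beta_i}\,\mathrm{Cap}_{\alpha_i}(B).$$ Then there are constants $0<c'\le C'<\infty$, depending only on $d,k,(\alpha_i),(\beta_i)$ and the hypothesis constants $c,C$, such that for every finite set $A\subset\mathbb Z^d$ containing the origin and every $x\in\mathbb Z^d\setminus\{0\}$ with $$|x|\ge2\,\mathrm{diam}(A)+\max_{1\le i\le k}\mathbf 1_{\{\alpha_i\le\beta_i\}}\,\mathrm{diam}(A)^{\frac{d-\alpha_i}{d-\beta_i}}\,\big(\log(\mathrm{diam}(A)+1)\big)^{\frac1{d-\beta_i}},$$ one has $$c'\,|x|^{(k-1)d-\beta_1-\dots-\beta_k}\,\mathrm{Cap}_\gamma(A)\le\mathbb P\big((\mathcal R_1+\dots+\mathcal R_k)\cap(x+A)\neq\emptyset\big)\le C'\,|x|^{(k-1)d-\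beta_1-\dots-\beta_k}\,\mathrm{Cap}_\gamma(A).$$
   Context: $|\cdot|$ is the Euclidean norm and $\mathrm{diam}$ the Euclidean diameter. For a nonempty finite set $A\subset\mathbb Z^d$ and $0<\beta<d$, $$\mathrm{Cap}_\beta(A):=\Big(\inf_\mu\sum_{x,y\in A}\mu(x)\mu(y)\,(|x-y|\vee1)^{-\beta}\Big)^{-1},$$ the infimum being over all probability measures $\mu$ on $A$. The Minkowski sum is $A+B:=\{a+b:a\in A,\ b\in B\}$, and $x+A=\{x+a:a\in A\}$. *)

(* Defs.v *)
From HB Require Import structures.
From mathcomp Require Import all_boot all_order all_algebra finmap.
From mathcomp Require Import all_classical all_reals all_analysis.

Set Implicit Arguments.
Unset Strict Implicit.
Unset Printing Implicit Defensive.

Import Order.TTheory GRing.Theory Num.Theory.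
Local Open Scope classical_set_scope.
Local Open Scope ring_scope.

Section Lattice.
Context (R : realType) (d : nat).
Implicit Types (x y : 'rV[int]_d) (A : {fset 'rV[int]_d}).

Definition enorm x : R := Num.sqrt (\sum_(j < d) (x 0 j)%:~R ^+ 2).

Definition diam A : R := sup [set enorm (x - y) | x in [set` A] & y in [set` A]].

(* Probability measures on the finite set A are given by their weights; the
   values of mu outside A play no role. *)
Definition prob_on A (mu : 'rV[int]_d -> R) : Prop :=
  (forall x, x \in A -> 0 <= mu x) /\ \sum_(x <- A) mu x = 1.

Definition energy (beta : R) A (mu : 'rV[int]_d -> R) : R :=
  \sum_(x <- A) \sum_(y <- A)
    mu x * mu y * Num.max (enorm (x - y)) 1 `^ (- beta).

Definition capacity (beta : R) A : R :=
  (inf [set energy beta A mu | mu in [set mu | prob_on A mu]])^-1.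

End Lattice.

Definition minkowski_sum (V : nmodType) (A B : set V) : set V :=
  [set a + b | a in A & b in B].

Definition translate (V : nmodType) (x : V) (A : set V) : set V :=
  [set x + a | a in A].

Section RandomSets.
Context (disp : measure_display) (T : measurableType disp).

(* Measurability with respect to the product sigma-algebra on the power set of
   V, which is generated by the coordinates "v belongs to the set". *)
Definition random_subset (V : Type) (X : T -> set V) : Prop :=
  forall v, measurable [set w | X w v].

Definition sigma_random_subset (V : Type) (X : T -> set V) : set (set T) :=
  <<s range (fun v => [set w | X w v]) >>.

Definition mutually_independent (R : realType) (P : probability T R)
    (V : Type) (I : finType) (X : I -> T -> set V) : Prop :=
  forall (J : {set I}) (E : I -> set T),
    (forall i, i \in J -> sigma_random_subset (X i) (E i)) ->
    P (\bigcap_(i in [set` J]) E i) = (\prod_(i in J) P (E i))%E.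

(* The event that the random set X meets the deterministic set B. *)
Definition hits (V : Type) (X : T -> set V) (B : set V) : set T :=
  [set w | (X w `&` B) !=set0].

End RandomSets.

(* Main.v *)
Require Import Defs.
From mathcomp Require Import all_boot all_order all_algebra finmap.
From mathcomp Require Import all_classical all_reals all_analysis.
From mathcomp Require Import ring lra zify.

(** Throughout, [ker s] is the Riesz kernel [max(|v|, 1) ^ - s] on the lattice
    and [pot s] the potential of a weight for it, so that [capacity s] is the
    inverse of the least energy of a probability weight.

    The theorem rests on one comparison. Let [S] be a random finite set living
    at a scale [s], whose hitting probabilities are of the order of
    [K * capacity al B]. Then the expected capacity of order [a] of the
    difference set [A - S] is of the order of
    [K * s ^ d * capacity (a + al - d) A] as long as the diameter of [A] is at
    most of the order of [s]; the order drops by [d - al]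
    (lemmas [Ex_capacity_le] and [Ex_capacity_ge]).
    Now [S1 + ... + Sk] meets [A] if and only if [S1] meets
    [A - (S2 + ... + Sk)]. Conditioning on the other sets turns the hitting
    probability of the sum into an expected capacity of order [alpha_1], and
    the comparison removes the remaining summands one after the other; what is
    left at the end is the capacity of [A] of order
    [alpha_1 + (alpha_2 - d) + ... + (alpha_k - d)], that is of order gamma.

    Upper half of the comparison. A capacity is bounded above by the squared
    norm of any function [g] whose potential of order [(d + a) / 2] is at least
    one on the set. Start from the equilibrium measure [nu] of [A] of order
    [a + al - d], put [f = pot ((a + al) / 2) nu] and
    [U = pot ((d + al) / 2) f]. Since kernels of orders [s] and [t] compose to
    one of order [s + t - d], every translate of [U] by a point [r] of [S] has
    a potential of order [(d + a) / 2] bounded below at the points of [A - r];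
    so the maximum of these translates over [S] is a test function for [A - S].
    The expectation of its squared norm is computed from the level sets of [U]:
    the hypothesis on [S] bounds the probability that a translate of [S] meets
    a level set by a capacity, these capacities are averaged over the translates
    ([capacity_average]), and Maz'ya's strong-type inequality
    ([capacity_strong_type]) sums them over the levels.

    Lower half of the comparison. Percolation on dyadic cubes provides an
    independent random set [S'] with two-point function of order [ker a] and
    hitting probabilities of order [capacity a] ([percolation_law]). Hence the
    expected capacity of [A - S] dominates the probability that [S'] meets
    [A - S], which is the probability that [S] meets [A - S'], which dominates
    the expected capacity of order [al] of [A - S']; the latter is bounded below
    by testing with a random measure carried by [A - S'] and computing its two
    first moments.

    It remains to cut the given sets into pieces to which their hypothesis
    applies, that is pieces far from the origin relative to their size. For the
    upper bound each set is cut along the dyadic shells. A choice of one shell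
    for each set contributes only if the largest radius is at least of the order
    of [|x|]; the condition relating [|x|] and the diameter of [A] is what makes
    the sum over the smaller shells comparable with its last term
    ([sum_scales_le]), and the total decays geometrically in the largest radius
    because the exponent of [|x|] is negative. For the lower bound it suffices
    to keep, for each set, one cube of side a small multiple of [|x|] around
    a point [c_i] with [|c_i|] of the order of [|x|] and [c_1 + ... + c_k] close
    to [x], and to keep one block of [A] of that size which carries a fixed
    fraction of its capacity ([capacity_block]). *)

Set Implicit Arguments.
Unset Strict Implicit.
Unset Printing Implicit Defensive.

Import Order.TTheory GRing.Theory Num.Theory.
Local Open Scope classical_set_scope.
Local Open Scope ring_scope.

(** * Euclidean norm and Riesz kernels on the lattice *)

Lemma eq_ler {R : numDomainType} (x y : R) : x = y -> x <= y.
Proof. by move=> ->. Qed.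

Section Norm.
Context {R : realType} {d : nat}.
Local Notation V := 'rV[int]_d.
Local Notation enorm := (enorm R).
Implicit Types u v w : V.

Lemma cauchy_schwarz_sum (I : finType) (x y : I -> R) :
  \sum_i x i * y i <= Num.sqrt (\sum_i x i ^+ 2) * Num.sqrt (\sum_i y i ^+ 2).
Proof.
set a := Num.sqrt (\sum_i x i ^+ 2); set b := Num.sqrt _.
have sx0 : 0 <= \sum_i x i ^+ 2 by apply: sumr_ge0 => i _; exact: sqr_ge0.
have sy0 : 0 <= \sum_i y i ^+ 2 by apply: sumr_ge0 => i _; exact: sqr_ge0.
have a2 : a ^+ 2 = \sum_i x i ^+ 2 by rewrite sqr_sqrtr.
have b2 : b ^+ 2 = \sum_i y i ^+ 2 by rewrite sqr_sqrtr.
have a0 : 0 <= a by exact: sqrtr_ge0.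
have b0 : 0 <= b by exact: sqrtr_ge0.
have zero (z : I -> R) : \sum_i z i ^+ 2 = 0 -> forall i, z i = 0.
  move=> /psumr_eq0P h i; apply/eqP; rewrite -sqrf_eq0; apply/eqP; apply: h => // j _.
  exact: sqr_ge0.
have [aP|] := boolP (0 < a); last first.
  rewrite lt_def a0 andbT negbK => /eqP az.
  rewrite big1 ?mulr_ge0 // => i _; rewrite (zero x) ?mul0r //.
  by rewrite -a2 az expr0n.
have [bP|] := boolP (0 < b); last first.
  rewrite lt_def b0 andbT negbK => /eqP bz.
  rewrite big1 ?mulr_ge0 // => i _; rewrite (zero y) ?mulr0 //.
  by rewrite -b2 bz expr0n.
have : 0 <= \sum_i (b * x i - a * y i) ^+ 2 by apply: sumr_ge0 => i _; exact: sqr_ge0.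
have -> : \sum_i (b * x i - a * y i) ^+ 2 =
    b ^+ 2 * (\sum_i x i ^+ 2) + a ^+ 2 * (\sum_i y i ^+ 2)
    - (2 * a * b) * \sum_i x i * y i.
  rewrite !mulr_sumr -big_split -sumrB; apply: eq_bigr => i _ /=; ring.
rewrite -a2 -b2.
have -> : b ^+ 2 * a ^+ 2 + a ^+ 2 * b ^+ 2 - (2 * a * b) * \sum_i x i * y i =
  (2 * a * b) * (a * b - \sum_i x i * y i) by ring.
by rewrite pmulr_rge0 ?mulr_gt0// subr_ge0.
Qed.

Lemma enorm_ge0 v : 0 <= enorm v. Proof. exact: sqrtr_ge0. Qed.

Lemma enorm_sqr v : enorm v ^+ 2 = \sum_(j < d) (v 0 j)%:~R ^+ 2.
Proof. by rewrite sqr_sqrtr// sumr_ge0// => i _; exact: sqr_ge0. Qed.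

Lemma enorm0 : enorm (0 : V) = 0.
Proof. by rewrite /Defs.enorm big1 ?sqrtr0// => i _; rewrite mxE expr0n. Qed.

Lemma enormN v : enorm (- v) = enorm v.
Proof.
by congr Num.sqrt; apply: eq_bigr => i _; rewrite mxE rmorphN sqrrN.
Qed.

Lemma enormB v w : enorm (v - w) = enorm (w - v).
Proof. by rewrite -enormN opprB. Qed.

Lemma ler_enormD v w : enorm (v + w) <= enorm v + enorm w.
Proof.
rewrite -ler_sqr ?nnegrE ?addr_ge0 ?enorm_ge0// sqrrD !enorm_sqr.
have -> : \sum_(j < d) ((v + w) 0 j)%:~R ^+ 2 =
   \sum_(j < d) ((v 0 j)%:~R : R) ^+ 2 +
   (\sum_(j < d) ((v 0 j)%:~R : R) * (w 0 j)%:~R) *+ 2 + \sum_(j < d) ((w 0 j)%:~R : R) ^+ 2.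
  rewrite -sumrMnl -!big_split; apply: eq_bigr => i _ /=.
  by rewrite mxE rmorphD sqrrD.
rewrite lerD2r lerD2l lerMn2r /=.
exact: cauchy_schwarz_sum.
Qed.

Lemma ler_enormB u v w : enorm (u - w) <= enorm (u - v) + enorm (v - w).
Proof. by apply: le_trans (ler_enormD _ _); rewrite addrA subrK. Qed.

Lemma enorm_coord v j : `|(v 0 j)%:~R| <= enorm v.
Proof.
rewrite -ler_sqr ?nnegrE ?enorm_ge0// enorm_sqr real_normK ?num_real//.
rewrite (bigD1 j)//= lerDl sumr_ge0// => i _; exact: sqr_ge0.
Qed.

Lemma enorm_le_coord v (m : R) :
  (forall j, `|(v 0 j)%:~R| <= m) -> enorm v <= d%:R * m.
Proof.
case: (posnP d) => [d0 _|dpos h].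
  rewrite /Defs.enorm big1 ?sqrtr0 ?d0 ?mul0r// => j.
  by move: (ltn_ord j); rewrite {2}d0.
have m0 : 0 <= m by apply: le_trans (normr_ge0 _) (h (Ordinal dpos)).
rewrite -ler_sqr ?nnegrE ?enorm_ge0 ?mulr_ge0// enorm_sqr.
apply: (@le_trans _ _ (\sum_(j < d) m ^+ 2)).
  by apply: ler_sum => j _; rewrite -real_normK ?num_real// ler_sqr// nnegrE.
rewrite sumr_const card_ord exprMn -[leLHS]mulr_natl ler_wpM2r ?sqr_ge0//.
by rewrite -natrX ler_nat expnS expn1 leq_pmulr.
Qed.

Lemma enorm_lt1 v : enorm v < 1 -> v = 0.
Proof.
move=> h; apply/rowP => j; rewrite mxE; apply/eqP; rewrite -absz_eq0.
have := le_lt_trans (enorm_coord v j) h.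
rewrite -intr_norm -[1]/(1%:~R) ltr_int => {}h; lia.
Qed.

Lemma enorm_ge1 v : v != 0 -> 1 <= enorm v.
Proof. by rewrite leNgt; apply: contra => /enorm_lt1 ->. Qed.

Definition nrm := locked (fun v : V => Num.max (enorm v) 1).

Lemma nrmE v : nrm v = Num.max (enorm v) 1. Proof. by rewrite /nrm -lock. Qed.

Lemma nrm_ge1 v : 1 <= nrm v. Proof. by rewrite nrmE le_max lexx orbT. Qed.
Lemma nrm_gt0 v : 0 < nrm v. Proof. exact: lt_le_trans ltr01 (nrm_ge1 v). Qed.
Lemma nrm_ge0 v : 0 <= nrm v. Proof. exact: ltW (nrm_gt0 v). Qed.
Lemma enorm_nrm v : enorm v <= nrm v. Proof. by rewrite nrmE le_max lexx. Qed.
Lemma nrm0 : nrm (0 : V) = 1. Proof. by rewrite !nrmE enorm0 max_r. Qed.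
Lemma nrmN v : nrm (- v) = nrm v. Proof. by rewrite !nrmE enormN. Qed.
Lemma nrmB v w : nrm (v - w) = nrm (w - v). Proof. by rewrite !nrmE enormB. Qed.
Lemma nrm_neq0 v : v != 0 -> nrm v = enorm v.
Proof. by move=> v0; rewrite !nrmE max_l// enorm_ge1. Qed.
Lemma nrm_le v (r : R) : (nrm v <= r) = (enorm v <= r) && (1 <= r).
Proof. by rewrite nrmE ge_max. Qed.
Lemma ler_nrmD v w : nrm (v + w) <= nrm v + nrm w.
Proof.
rewrite nrm_le (le_trans (ler_enormD _ _)) ?lerD ?enorm_nrm//=.
by have := nrm_ge1 v; have := nrm_ge0 w; lra.
Qed.
Lemma ler_nrmB u v w : nrm (u - w) <= nrm (u - v) + nrm (v - w).
Proof. by apply: le_trans (ler_nrmD _ _); rewrite addrA subrK. Qed.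

Definition ker := locked (fun (s : R) (v : V) => nrm v `^ (- s)).

Lemma kerE s v : ker s v = nrm v `^ (- s). Proof. by rewrite /ker -lock. Qed.

Lemma ker_gt0 s v : 0 < ker s v. Proof. by rewrite kerE; exact: powR_gt0 (nrm_gt0 v). Qed.
Lemma ker_ge0 s v : 0 <= ker s v. Proof. by rewrite kerE powR_ge0. Qed.
Lemma ker0 s : ker s (0 : V) = 1. Proof. by rewrite !kerE nrm0 powR1. Qed.
Lemma kerB s v w : ker s (v - w) = ker s (w - v). Proof. by rewrite !kerE nrmB. Qed.

Lemma ler_powRN (s x y : R) : 0 <= s -> 0 < x -> x <= y -> y `^ (- s) <= x `^ (- s).
Proof.
move=> s0 x0 xy; rewrite !powRN lef_pV2 ?posrE ?powR_gt0//.
- by apply: ge0_ler_powR => //; rewrite nnegrE ltW// (lt_le_trans x0 xy).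
- exact: lt_le_trans x0 xy.
Qed.

Lemma ker_le1 s v : 0 <= s -> ker s v <= 1.
Proof.
by move=> s0; rewrite kerE; apply: le_trans (ler_powRN s0 ltr01 (nrm_ge1 v)) _; rewrite powR1.
Qed.

Lemma ker_ge s v (r : R) : 0 <= s -> nrm v <= r -> r `^ (- s) <= ker s v.
Proof. by move=> s0 h; rewrite kerE; apply: ler_powRN => //; exact: nrm_gt0. Qed.

Lemma ker_le s v (r : R) : 0 <= s -> 0 < r -> r <= nrm v -> ker s v <= r `^ (- s).
Proof. by move=> s0 r0 h; rewrite kerE; apply: ler_powRN. Qed.

Lemma ker_anti s v w : 0 <= s -> nrm w <= nrm v -> ker s v <= ker s w.
Proof. by move=> s0 h; rewrite !kerE; apply: ler_powRN => //; exact: nrm_gt0. Qed.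

Lemma ker_comp s v w (m : R) : 0 <= s -> 0 < m -> nrm w <= m * nrm v ->
  ker s v <= m `^ s * ker s w.
Proof.
move=> s0 m0 h.
have -> : m `^ s = m^-1 `^ (- s).
  by rewrite -[in RHS]powR_inv1 ?(ltW m0)// -powRrM mulN1r opprK.
rewrite !kerE -powRM ?nrm_ge0 ?invr_ge0//; last exact: ltW.
apply: ler_powRN => //; first by rewrite mulr_gt0 ?invr_gt0 ?nrm_gt0.
by rewrite mulrC ler_pdivrMr// mulrC.
Qed.

Lemma ker_split s t v : ker (s + t) v = ker s v * ker t v.
Proof. by rewrite !kerE opprD powRD// (gt_eqF (nrm_gt0 v)) implybT. Qed.
End Norm.

(** * Lattice sums of the kernels *)

Section FsetSums.
Context {R : realType} {K : choiceType}.

Lemma ler_sum_fsetS (A B : {fset K}) (F : K -> R) :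
  {subset A <= B} -> (forall x, x \in B -> 0 <= F x) ->
  \sum_(x <- A) F x <= \sum_(x <- B) F x.
Proof.
move=> AB F0; rewrite [leRHS](big_fsetID _ (mem A))/=.
have -> : [fset x in B | (mem A) x]%fset = A.
  apply/fsetP => x; rewrite !inE /=; apply/andP/idP => [[]//|xA]; split => //.
  exact: AB.
rewrite lerDl big_seq; apply: sumr_ge0 => x; rewrite !inE => /andP[/F0].
by [].
Qed.

Lemma ler_sum_seqP (s : seq K) (P : pred K) (F G : K -> R) :
  (forall x, x \in s -> P x -> F x <= G x) ->
  \sum_(x <- s | P x) F x <= \sum_(x <- s | P x) G x.
Proof.
move=> h; rewrite big_seq_cond [leRHS]big_seq_cond; apply: ler_sum => x /andP[].
exact: h.
Qed.

Lemma ler_sum_seq (s : seq K) (F G : K -> R) :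
  (forall x, x \in s -> F x <= G x) -> \sum_(x <- s) F x <= \sum_(x <- s) G x.
Proof. by move=> h; apply: ler_sum_seqP => x xs _; exact: h. Qed.

Lemma sumr_seq_ge0 (s : seq K) (P : pred K) (F : K -> R) :
  (forall x, x \in s -> 0 <= F x) -> 0 <= \sum_(x <- s | P x) F x.
Proof. by move=> h; rewrite big_seq_cond; apply: sumr_ge0 => x /andP[/h]. Qed.

Lemma ler_sum_pred (s : seq K) (P Q : pred K) (F : K -> R) :
  (forall x, x \in s -> P x -> Q x) -> (forall x, x \in s -> 0 <= F x) ->
  \sum_(x <- s | P x) F x <= \sum_(x <- s | Q x) F x.
Proof.
move=> PQ F0; rewrite big_mkcond [leRHS]big_mkcond; apply: ler_sum_seq => x xs.
by case: ifPn => [/(PQ _ xs)->//|_]; case: ifPn => // _; exact: F0.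
Qed.
End FsetSums.

Lemma expr_powR {R : realType} (x r : R) n : 0 <= x -> (x ^+ n) `^ r = (x `^ r) ^+ n.
Proof.
move=> x0; rewrite -(powR_mulrn n x0) powRAC powR_mulrn//; exact: powR_ge0.
Qed.

Lemma powR_gt1 {R : realType} (x r : R) : 1 < x -> 0 < r -> 1 < x `^ r.
Proof.
move=> x1 r0; have := @gt0_ltr_powR _ _ r0 1 x; rewrite powR1; apply; rewrite ?nnegrE//.
exact: ltW (lt_trans ltr01 x1).
Qed.

Lemma powR_lt1 {R : realType} (x r : R) : 1 < x -> r < 0 -> x `^ r < 1.
Proof.
move=> x1 r0; rewrite -[r]opprK powRN invf_lt1 ?powR_gt1 ?oppr_gt0//.
by rewrite powR_gt0// (lt_trans ltr01).
Qed.

Lemma pow2_floor {R : realType} (r : R) : 1 <= r -> exists n : nat, 2 ^+ n <= r < 2 ^+ n.+1.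
Proof.
move=> r1; have ex : exists n : nat, r < 2 ^+ n.
  exists (Num.truncn r).+1; have r0 : 0 <= r by lra.
  have /andP[_ h] := truncn_itv r0; apply: lt_trans h _.
  by rewrite -natrX ltr_nat ltn_expl.
have [n rn nmin] := ex_minnP ex.
case: n rn nmin => [|n] rn nmin; first by move: rn; rewrite expr0; lra.
exists n; rewrite rn andbT leNgt; apply/negP => /nmin; lia.
Qed.

Lemma inord_shift_inj (m : nat) (t u : int) : `|t| <= m%:Z -> `|u| <= m%:Z ->
  inord (absz (t + m%:Z)) = inord (absz (u + m%:Z)) :> 'I_(m + m).+1 -> t = u.
Proof. by move=> tm um /(congr1 val) /=; rewrite !inordK; lia. Qed.

Lemma ord_shift_norm (m : nat) (i : 'I_(m + m).+1) : `|(i : nat)%:Z - m%:Z| <= m%:Z.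
Proof. by have := ltn_ord i; lia. Qed.

Lemma inord_shiftK (m : nat) (t : int) : `|t| <= m%:Z ->
  ((inord (absz (t + m%:Z)) : 'I_(m + m).+1) : nat)%:Z - m%:Z = t.
Proof. by move=> tm; rewrite inordK; lia. Qed.

Section Lattice.
Context {R : realType} {d : nat}.
Local Notation V := 'rV[int]_d.
Local Notation enorm := (enorm R).
Local Notation nrm := (@nrm R d).
Local Notation ker := (@ker R d).
Implicit Types (u v w z c : V) (Z : {fset V}).

Lemma card_ball Z c (r : R) : 1 <= r ->
  \sum_(z <- Z | nrm (z - c) <= r) 1 <= (3 * r) ^+ d :> R.
Proof.
move=> r1; set m := Num.truncn r; have r0 : 0 <= r by lra.
have mr : m%:R <= r by rewrite truncn_le.
have rm : r < m.+1%:R by case/andP: (truncn_itv r0).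
rewrite -big_filter big_const_seq count_predT iter_addr_0.
set s := [seq z <- Z | _].
have ltz_nat_succ (t : int) (a : nat) : (t < a.+1%:Z) = (t <= a%:Z) by lia.
pose phi (z : V) : {ffun 'I_d -> 'I_(m + m).+1} :=
  [ffun j => inord (absz ((z - c) 0 j + m%:Z))].
have coord z j : z \in s -> (`|(z - c) 0 j| <= m%:Z).
  rewrite mem_filter nrm_le -andbA => /andP[zr _].
  have := le_lt_trans (le_trans (enorm_coord (z - c) j) zr) rm.
  rewrite -intr_norm -[m.+1%:R]/(m.+1%:Z%:~R) ltr_int ltz_nat_succ; exact.
have phi_inj : {in s &, injective phi}.
  move=> z w zs ws /ffunP e; apply: (addIr (- c)); apply/rowP => j.
  by have := e j; rewrite !ffunE; apply: inord_shift_inj; exact: coord.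
have us : uniq s by rewrite filter_uniq// fset_uniq.
have : (size s <= #|{ffun 'I_d -> 'I_(m + m).+1}|)%N.
  rewrite -(size_map phi) -(card_uniqP _) ?max_card//.
  by rewrite map_inj_in_uniq.
rewrite card_ffun !card_ord -(ler_nat R) => /le_trans; apply.
rewrite natrX lerXn2r ?nnegrE ?mulr_ge0//.
rewrite -addn1 !natrD; lra.
Qed.

(** Finite sets of lattice points are locked so that rewriting with [inE] stops
    at them. *)
Definition cube c (m : nat) : {fset V} :=
  locked [fset z in codom (fun f : {ffun 'I_d -> 'I_(m + m).+1} =>
     (c + \row_j ((f j : nat)%:Z - m%:Z))%R)]%fset.

Lemma in_cube c m z : (z \in cube c m) = [forall j, `|(z - c) 0 j| <= m%:Z].
Proof.
rewrite /cube -lock !inE; apply/codomP/forallP => [[f ->] j|h].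
  by rewrite addrC addKr mxE; exact: ord_shift_norm.
exists [ffun j => inord (absz ((z - c) 0 j + m%:Z))].
apply: (addIr (- c)); rewrite [in RHS]addrC addKr.
by apply/rowP => j; rewrite [RHS]mxE ffunE inord_shiftK.
Qed.

Lemma card_cube c m : #|` cube c m| = ((m + m).+1 ^ d)%N.
Proof.
rewrite /cube -lock card_fseq undup_id; first by rewrite size_codom card_ffun !card_ord.
apply/injectiveP => f g /addrI /rowP e; apply/ffunP => j.
have := e j; rewrite !mxE => /addIr [] h; exact: val_inj.
Qed.

Definition ball c (r : R) : {fset V} :=
  locked [fset z in cube c (Num.truncn r) | (nrm (z - c) <= r)%R]%fset.

Lemma in_ball c (r : R) z : (z \in ball c r) = (nrm (z - c) <= r).
Proof.
rewrite /ball -lock !inE in_cube; apply: andb_idl => h.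
have r0 : 0 <= r := le_trans (nrm_ge0 _) h.
apply/forallP => j; have /andP[_ rm] := truncn_itv r0.
have := le_lt_trans (le_trans (le_trans (enorm_coord (z - c) j) (enorm_nrm _)) h) rm.
rewrite -intr_norm -[(Num.truncn r).+1%:R]/((Num.truncn r).+1%:Z%:~R) ltr_int.
by move: (`|_|) (Num.truncn r) => x y; lia.
Qed.

(** The ball is summed over dyadic shells; the geometric series is dominated by
    its last term because [s < d]. *)
Lemma sum_ker_ball (s : R) : 0 <= s -> s < d%:R -> exists2 C : R, 0 < C &
  forall Z c (r : R), 1 <= r ->
    \sum_(z <- Z | nrm (z - c) <= r) ker s (z - c) <= C * r `^ (d%:R - s).
Proof.
move=> s0 sd; set q := 2 `^ (d%:R - s) : R.
have q1 : 1 < q by rewrite powR_gt1 ?subr_gt0 ?ltr1n.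
have q10 : 0 < q - 1 by rewrite subr_gt0.
pose C := 3 ^+ d + 6 ^+ d / (q - 1).
have C0 : 0 < C by rewrite addr_gt0 ?divr_gt0 ?exprn_gt0.
have dyadic Z c n : \sum_(z <- Z | nrm (z - c) <= 2 ^+ n) ker s (z - c) <= C * q ^+ n.
  elim: n => [|n IH].
    rewrite !expr0 mulr1.
    apply: (@le_trans _ _ (\sum_(z <- Z | nrm (z - c) <= 1) 1)).
      by apply: ler_sum => z _; exact: ker_le1.
    apply: le_trans (card_ball _ _ _) _ => //; rewrite mulr1 lerDl.
    by rewrite divr_ge0 ?exprn_ge0 ?ltW.
  rewrite (bigID (fun z => nrm (z - c) <= 2 ^+ n))/=.
  apply: (@le_trans _ _ (C * q ^+ n + 6 ^+ d * q ^+ n)); last first.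
    rewrite exprS mulrA -mulrDl ler_wpM2r ?exprn_ge0 ?(ltW (lt_trans ltr01 q1))//.
    have -> : C * q = C + C * (q - 1) by ring.
    rewrite lerD2l [leRHS]mulrDl divfK ?gt_eqF// lerDr mulr_ge0 ?exprn_ge0//.
    exact: ltW.
  apply: lerD.
    apply: le_trans IH; apply: ler_sum_pred => [z _ /andP[]//|z _]; exact: ker_ge0.
  apply: (@le_trans _ _ (\sum_(z <- Z | nrm (z - c) <= 2 ^+ n.+1) (2 ^+ n) `^ (- s))).
    apply: (@le_trans _ _ (\sum_(z <- Z | (nrm (z - c) <= 2 ^+ n.+1) &&
       ~~ (nrm (z - c) <= 2 ^+ n)) (2 ^+ n) `^ (- s))).
      apply: ler_sum => z /andP[_]; rewrite -ltNge => /ltW h.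
      by apply: ker_le => //; rewrite exprn_gt0.
    by apply: ler_sum_pred => [z _ /andP[]//|z _]; exact: powR_ge0.
  rewrite -[X in \sum_(_ <- _ | _) X]mul1r -mulr_suml.
  apply: (@le_trans _ _ ((3 * 2 ^+ n.+1) ^+ d * (2 ^+ n) `^ (- s))).
    rewrite ler_wpM2r ?powR_ge0// card_ball// exprn_ege1// ler1n.
    by [].
  rewrite exprS mulrA exprMn -mulrA -[X in _ * (X * _)]powR_mulrn ?exprn_ge0//.
  rewrite -powRD; last by rewrite (@gt_eqF _ _ (2 ^+ n)) ?exprn_gt0// implybT.
  rewrite expr_powR// /q -natrM.
  by [].
exists (C * q); first by rewrite mulr_gt0// (lt_trans ltr01).
move=> Z c r r1; have [n /andP[n1 n2]] := pow2_floor r1.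
apply: (@le_trans _ _ (C * q ^+ n.+1)).
  apply: le_trans (dyadic Z c n.+1); apply: ler_sum_pred => [z _ h|z _].
    exact: le_trans h (ltW n2).
  exact: ker_ge0.
rewrite exprS mulrA ler_wpM2l ?mulr_ge0 ?(ltW C0) ?powR_ge0//.
rewrite -expr_powR// ge0_ler_powR ?nnegrE ?exprn_ge0 ?subr_ge0 ?(ltW sd)//.
lra.
Qed.

(** Dyadic shells again, now dominated by the first term because [d < s]. *)
Lemma sum_ker_tail (s : R) : d%:R < s -> exists2 C : R, 0 < C &
  forall Z c (r : R), 1 <= r ->
    \sum_(z <- Z | r <= nrm (z - c)) ker s (z - c) <= C * r `^ (d%:R - s).
Proof.
move=> sd; set q := 2 `^ (d%:R - s) : R.
have s0 : 0 <= s by apply: le_trans (ltW sd).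
have q1 : q < 1 by rewrite powR_lt1 ?subr_lt0 ?ltr1n.
have q0 : 0 < q by exact: powR_gt0.
have q10 : 0 < 1 - q by rewrite subr_gt0.
pose C := 6 ^+ d / (1 - q).
have C0 : 0 < C by rewrite divr_gt0 ?exprn_gt0.
have dyadic Z c m n : \sum_(z <- Z | 2 ^+ n <= nrm (z - c) < 2 ^+ (n + m)) ker s (z - c)
    <= C * q ^+ n.
  elim: m n => [|m IH] n.
    rewrite addn0 big_pred0 => [|z]; first by rewrite mulr_ge0 ?exprn_ge0 ?ltW.
    by apply/negP => /andP[h1 h2]; lra.
  rewrite (bigID (fun z => nrm (z - c) < 2 ^+ n.+1))/=.
  apply: (@le_trans _ _ (6 ^+ d * q ^+ n + C * q ^+ n.+1)); last first.
    rewrite exprS mulrA -mulrDl ler_wpM2r ?exprn_ge0 ?(ltW q0)//.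
    have -> : C * q = C - C * (1 - q) by ring.
    by rewrite /C divfK ?gt_eqF// addrC subrK.
  apply: lerD; last first.
    apply: le_trans (IH n.+1); apply: ler_sum_pred => [z _|z _]; last exact: ker_ge0.
    by rewrite addSnnS -leNgt => /andP[/andP[_ ->] ->].
  apply: (@le_trans _ _ (\sum_(z <- Z | nrm (z - c) <= 2 ^+ n.+1) (2 ^+ n) `^ (- s))).
    apply: (@le_trans _ _ (\sum_(z <- Z | (2 ^+ n <= nrm (z - c) < 2 ^+ (n + m.+1)) &&
       (nrm (z - c) < 2 ^+ n.+1)) (2 ^+ n) `^ (- s))).
      apply: ler_sum => z /andP[/andP[h _] _].
      by apply: ker_le => //; rewrite exprn_gt0.
    by apply: ler_sum_pred => [z _ /andP[_ /ltW]//|z _]; exact: powR_ge0.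
  rewrite -[X in \sum_(_ <- _ | _) X]mul1r -mulr_suml.
  apply: (@le_trans _ _ ((3 * 2 ^+ n.+1) ^+ d * (2 ^+ n) `^ (- s))).
    rewrite ler_wpM2r ?powR_ge0// card_ball// exprn_ege1// ler1n.
    by [].
  rewrite exprS mulrA exprMn -mulrA -[X in _ * (X * _)]powR_mulrn ?exprn_ge0//.
  rewrite -powRD; last by rewrite (@gt_eqF _ _ (2 ^+ n)) ?exprn_gt0// implybT.
  rewrite expr_powR// /q -natrM.
  by [].
exists (C * 2 `^ (s - d%:R)); first by rewrite mulr_gt0// powR_gt0.
move=> Z c r r1; have [n /andP[n1 n2]] := pow2_floor r1.
have [m mZ] : exists m : nat, forall z, z \in Z -> nrm (z - c) < 2 ^+ (n + m).
  exists (Num.truncn (\sum_(z <- Z) nrm (z - c))).+1 => z zZ.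
  have sum0 : 0 <= \sum_(z <- Z) nrm (z - c) by apply: sumr_ge0 => *; exact: nrm_ge0.
  have : nrm (z - c) <= \sum_(z <- Z) nrm (z - c).
    rewrite (big_fsetD1 z)//= lerDl; apply: sumr_ge0 => *; exact: nrm_ge0.
  move=> /le_lt_trans; apply; have /andP[_ h] := truncn_itv sum0; apply: lt_trans h _.
  rewrite -natrX ltr_nat; apply: leq_ltn_trans (ltn_expl _ (ltnSn 1)).
  by rewrite leq_addl.
apply: (@le_trans _ _ (C * q ^+ n)).
  apply: le_trans (dyadic Z c m n); apply: ler_sum_pred => [z zZ h|z _].
    by rewrite mZ// (le_trans n1 h).
  exact: ker_ge0.
rewrite -[leRHS]mulrA ler_wpM2l ?(ltW C0)// -expr_powR//.
have -> : r `^ (d%:R - s) = r `^ (- (s - d%:R)) by rewrite opprB.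
have -> : (2 ^+ n) `^ (d%:R - s) = (2 ^+ n : R) `^ (- (s - d%:R)) by rewrite opprB.
have -> : 2 `^ (s - d%:R) = (2^-1 : R) `^ (- (s - d%:R)).
  by rewrite -[in RHS]powR_inv1// -powRrM mulN1r opprK.
rewrite -powRM ?invr_ge0//; last by lra.
apply: ler_powRN; rewrite ?subr_ge0 ?(ltW sd)//; first by lra.
by move: n2; rewrite exprS; lra.
Qed.
End Lattice.

(** * Composition of kernels *)

Section Convolution.
Context {R : realType} {d : nat}.
Local Notation V := 'rV[int]_d.
Local Notation enorm := (enorm R).
Local Notation nrm := (@nrm R d).
Local Notation ker := (@ker R d).
Implicit Types (u v w z c a b : V) (Z : {fset V}).

(** Compare [z] with the nearer of [a] and [b]: within the distance of [a] and
    [b] the other kernel is comparable with its value at that distance, beyond it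
    both kernels decay together at rate [s + t > d]. *)
Lemma conv_upper (s t : R) : 0 <= s < d%:R -> 0 <= t < d%:R -> d%:R < s + t ->
  exists2 C : R, 0 < C & forall Z a b,
    \sum_(z <- Z) ker s (a - z) * ker t (z - b) <= C * ker (s + t - d%:R) (a - b).
Proof.
move=> /andP[s0 sd] /andP[t0 td] std.
have [C1 C10 h1] := @sum_ker_ball R d s s0 sd.
have [C2 C20 h2] := @sum_ker_ball R d t t0 td.
have [C3 C30 h3] := @sum_ker_tail R d (s + t) std.
exists (C1 * 2 `^ t + C2 * 2 `^ s + C3 + C3).
  by rewrite !addr_gt0// mulr_gt0// powR_gt0.
move=> Z a b; set r := nrm (a - b).
have r1 : 1 <= r by exact: nrm_ge1.
have r0 : 0 < r by exact: nrm_gt0.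
have rD x y : r `^ (x + y) = r `^ x * r `^ y.
  by rewrite powRD// (gt_eqF r0) implybT.
have pw z : ker s (a - z) * ker t (z - b) <=
   (if nrm (z - a) <= r then ker s (z - a) else 0) * (2 `^ t * r `^ (- t)) +
   (if nrm (z - b) <= r then ker t (z - b) else 0) * (2 `^ s * r `^ (- s)) +
   (if r <= nrm (z - a) then ker (s + t) (z - a) else 0) +
   (if r <= nrm (z - b) then ker (s + t) (z - b) else 0).
  have tri : r <= nrm (z - a) + nrm (z - b).
    by rewrite (nrmB z a); exact: ler_nrmB.
  rewrite (kerB s a z).
  have T1 : 0 <= (if nrm (z - a) <= r then ker s (z - a) else 0) * (2 `^ t * r `^ (- t)).
    by rewrite mulr_ge0 ?mulr_ge0 ?powR_ge0//; case: ifP => // _; exact: ker_ge0.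
  have T2 : 0 <= (if nrm (z - b) <= r then ker t (z - b) else 0) * (2 `^ s * r `^ (- s)).
    by rewrite mulr_ge0 ?mulr_ge0 ?powR_ge0//; case: ifP => // _; exact: ker_ge0.
  have T3 : 0 <= if r <= nrm (z - a) then ker (s + t) (z - a) else 0.
    by case: ifP => // _; exact: ker_ge0.
  have T4 : 0 <= if r <= nrm (z - b) then ker (s + t) (z - b) else 0.
    by case: ifP => // _; exact: ker_ge0.
  have pick (x t1 t2 t3 t4 : R) : 0 <= t1 -> 0 <= t2 -> 0 <= t3 -> 0 <= t4 ->
    [\/ x <= t1, x <= t2, x <= t3 | x <= t4] -> x <= t1 + t2 + t3 + t4.
    by move=> ? ? ? ? []; lra.
  apply: pick T1 T2 T3 T4 _.
  have half (x : R) v : 0 <= x -> r <= 2 * nrm v -> ker x v <= 2 `^ x * r `^ (- x).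
    by move=> x0 h; have := ker_comp x0 (ltr0n _ 2) h; rewrite [ker x (a - b)]kerE.
  have [ab|ba] := leP (nrm (z - a)) (nrm (z - b)).
    have [za|za] := leP (nrm (z - a)) r.
      apply: Or41; rewrite ler_wpM2l ?ker_ge0// half//.
      by move: tri ab; move: (nrm _) (nrm _) => *; lra.
    apply: Or43; rewrite (ltW za) ker_split ler_wpM2l ?ker_ge0// ker_anti//.
  have [zb|zb] := leP (nrm (z - b)) r.
    apply: Or42; rewrite mulrC ler_wpM2l ?ker_ge0// half//.
    by move: tri ba; move: (nrm _) (nrm _) => *; lra.
  by apply: Or44; rewrite (ltW zb) ker_split ler_wpM2r ?ker_ge0// ker_anti// ltW.
apply: le_trans (ler_sum _ (fun z _ => pw z)) _.
rewrite !big_split/= -!mulr_suml -!big_mkcond/= [ker (s + t - d%:R) _]kerE -/r.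
have -> : - (s + t - d%:R) = (d%:R - s) + (- t) by ring.
have e1 : r `^ (d%:R - s + - t) = r `^ (d%:R - s) * r `^ (- t) by rewrite rD.
have e2 : r `^ (d%:R - s + - t) = r `^ (d%:R - t) * r `^ (- s).
  by rewrite -rD; congr (_ `^ _); ring.
have e3 : r `^ (d%:R - s + - t) = r `^ (d%:R - (s + t)) by congr (_ `^ _); ring.
rewrite !mulrDl; apply: lerD; last by rewrite e3; exact: h3.
apply: lerD; last by rewrite e3; exact: h3.
apply: lerD.
  rewrite e1 mulrACA ler_wpM2r ?mulr_ge0 ?powR_ge0//.
  exact: h1.
rewrite e2 mulrACA ler_wpM2r ?mulr_ge0 ?powR_ge0//.
exact: h2.
Qed.

(** The points whose distance to [a] is of the order of that of [a] and [b] already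
    give the whole order of magnitude. *)
Lemma conv_lower (s t : R) : 0 <= s -> 0 <= t ->
  exists2 C : R, 0 < C & forall Z a b,
    (forall z, nrm (z - a) <= d.+1%:R * nrm (a - b) -> z \in Z) ->
    C * ker (s + t - d%:R) (a - b) <= \sum_(z <- Z) ker s (a - z) * ker t (z - b).
Proof.
move=> s0 t0.
exists (d.+1%:R `^ (- s) * d.+2%:R `^ (- t)); first by rewrite mulr_gt0// powR_gt0.
move=> Z a b hZ; set r := nrm (a - b).
have r1 : 1 <= r by exact: nrm_ge1.
have r0 : 0 < r by exact: nrm_gt0.
set m := Num.truncn r.
have mr : m%:R <= r by rewrite truncn_le ltW.
have rm : r < m.+1%:R by case/andP: (truncn_itv (ltW r0)).
have near z : z \in cube a m -> nrm (z - a) <= d.+1%:R * r.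
  rewrite in_cube => /forallP h; rewrite nrm_le; apply/andP; split; last first.
    by rewrite mulr_ege1// ler1n.
  apply: (@le_trans _ _ (d%:R * r)); last by rewrite ler_wpM2r ?(ltW r0)// ler_nat.
  apply: enorm_le_coord => j; apply: le_trans mr.
  by rewrite -intr_norm -[m%:R]/(m%:Z%:~R) ler_int.
apply: le_trans (_ : \sum_(z <- cube a m) ker s (a - z) * ker t (z - b) <= _); last first.
  apply: ler_sum_fsetS => [z /near /hZ//|z _]; by rewrite mulr_ge0 ?ker_ge0.
apply: (@le_trans _ _ (\sum_(z <- cube a m) (d.+1%:R * r) `^ (- s) * (d.+2%:R * r) `^ (- t))).
  rewrite big_const_seq count_predT iter_addr_0 card_cube -[leRHS]mulr_natr.
  rewrite (powRM _ (ler0n _ _) (ltW r0)) (powRM (- t) (ler0n _ _) (ltW r0)).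
  have -> : d.+1%:R `^ (- s) * r `^ (- s) * (d.+2%:R `^ (- t) * r `^ (- t)) *
     ((m + m).+1 ^ d)%:R = d.+1%:R `^ (- s) * d.+2%:R `^ (- t) *
     (r `^ (- s) * r `^ (- t) * ((m + m).+1 ^ d)%:R) by ring.
  rewrite ler_wpM2l ?mulr_ge0 ?powR_ge0// kerE -/r.
  have -> : - (s + t - d%:R) = (- s + - t) + d%:R by ring.
  rewrite !powRD ?(gt_eqF r0) ?implybT// powR_mulrn ?(ltW r0)//.
  rewrite ler_wpM2l ?mulr_ge0 ?powR_ge0// natrX lerXn2r ?nnegrE ?(ltW r0)//.
  apply: le_trans (ltW rm) _; rewrite ler_nat; lia.
apply: ler_sum_seq => z /near h.
have h2 : nrm (z - b) <= d.+2%:R * r.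
  apply: le_trans (ler_nrmB _ a _) _; rewrite -/r [d.+2%:R]mulrS mulrDl mul1r addrC.
  by rewrite lerD2l.
apply: ler_pM; rewrite ?powR_ge0//; last exact: ker_ge.
by rewrite kerB; exact: ker_ge.
Qed.
End Convolution.

(** * Capacities and equilibrium measures *)

Section Capacity.
Context {R : realType} {d : nat}.
Local Notation V := 'rV[int]_d.
Local Notation nrm := (@nrm R d).
Local Notation ker := (@ker R d).
Implicit Types (x y z : V) (A B : {fset V}) (mu : V -> R).

Definition pot (s : R) A mu x : R := \sum_(y <- A) mu y * ker s (x - y).

Lemma energyE s A mu : energy s A mu = \sum_(x <- A) mu x * pot s A mu x.
Proof.
apply: eq_bigr => x _; rewrite /pot mulr_sumr; apply: eq_bigr => y _.
by rewrite kerE nrmE mulrA.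
Qed.

Lemma pot_ge0 s A mu x : (forall y, y \in A -> 0 <= mu y) -> 0 <= pot s A mu x.
Proof. by move=> h; apply: sumr_seq_ge0 => y /h m0; rewrite mulr_ge0 ?ker_ge0. Qed.

Lemma energy_ge0 s A mu : (forall y, y \in A -> 0 <= mu y) -> 0 <= energy s A mu.
Proof.
move=> h; rewrite energyE; apply: sumr_seq_ge0 => x xA.
by rewrite mulr_ge0 ?h ?pot_ge0.
Qed.

Lemma energyZ s A mu (k : R) : energy s A (fun x => k * mu x) = k ^+ 2 * energy s A mu.
Proof.
rewrite /energy mulr_sumr; apply: eq_bigr => x _; rewrite mulr_sumr.
by apply: eq_bigr => y _; ring.
Qed.

Lemma prob_energy_ge s A mu (r : R) : 0 <= s -> prob_on A mu ->
  (forall x y, x \in A -> y \in A -> nrm (x - y) <= r) -> r `^ (- s) <= energy s A mu.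
Proof.
move=> s0 [mu0 mu1] hr.
have -> : r `^ (- s) = \sum_(x <- A) mu x * (\sum_(y <- A) mu y * r `^ (- s)).
  by rewrite -mulr_suml -mulr_suml mu1 !mul1r.
rewrite energyE; apply: ler_sum_seq => x xA; rewrite ler_wpM2l ?mu0//.
by apply: ler_sum_seq => y yA; rewrite ler_wpM2l ?mu0// ker_ge// hr.
Qed.

Lemma radius_exists A : exists2 r : R, 1 <= r &
  forall x y, x \in A -> y \in A -> nrm (x - y) <= r.
Proof.
exists (1 + \sum_(x <- A) nrm x *+ 2).
  by rewrite lerDl sumr_ge0// => x _; rewrite mulrn_wge0// nrm_ge0.
have le1 x : x \in A -> nrm x *+ 2 <= \sum_(x <- A) nrm x *+ 2.
  move=> xA; rewrite (big_fsetD1 x)//= lerDl sumr_ge0// => y _.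
  by rewrite mulrn_wge0// nrm_ge0.
move=> x y /le1 hx /le1 hy; have := @ler_nrmD R _ x (- y); rewrite nrmN.
by move: hx hy; move: (nrm _) (nrm _) (nrm _) (\sum_(_ <- _) _) => *; lra.
Qed.

Definition min_energy (s : R) A := inf [set energy s A mu | mu in [set mu | prob_on A mu]].

Lemma prob_on_dirac A x : x \in A -> prob_on A (fun y => (y == x)%:R : R).
Proof.
move=> xA; split => [y _|]; first exact: ler0n.
by rewrite (big_fsetD1 x)//= eqxx big1_seq ?addr0// => y; rewrite !inE => /andP[_ /andP[/negPf->]].
Qed.

Lemma min_energy_le s A mu : prob_on A mu -> min_energy s A <= energy s A mu.
Proof.
move=> mup; apply: ge_inf; last by exists mu.
by exists 0 => _ [nu [nu0 _] <-]; exact: energy_ge0.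
Qed.

Lemma min_energy_ge s A (e : R) : A != fset0 ->
  (forall mu, prob_on A mu -> e <= energy s A mu) -> e <= min_energy s A.
Proof.
move=> /fset0Pn[x xA] h; apply: lb_le_inf.
  by exists (energy s A (fun y => (y == x)%:R)), (fun y => (y == x)%:R) => //; exact: prob_on_dirac.
by move=> _ [mu mup <-]; exact: h.
Qed.

Lemma min_energy_gt0 s A : 0 <= s -> A != fset0 -> 0 < min_energy s A.
Proof.
move=> s0 A0; have [r r1 hr] := radius_exists A.
apply: (@lt_le_trans _ _ (r `^ (- s))); first by rewrite powR_gt0// (lt_le_trans ltr01).
by apply: min_energy_ge => // mu mup; exact: prob_energy_ge.
Qed.

Lemma min_energy_le1 s A : A != fset0 -> min_energy s A <= 1.
Proof.
move=> /fset0Pn[x xA]; apply: le_trans (min_energy_le s (prob_on_dirac xA)) _.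
rewrite energyE (big_fsetD1 x)//= eqxx mul1r big1_seq ?addr0 => [|y]; last first.
  by rewrite !inE => /andP[_ /andP[/negPf-> _]]; rewrite mul0r.
rewrite /pot (big_fsetD1 x)//= eqxx mul1r big1_seq ?addr0 => [|y]; last first.
  by rewrite !inE => /andP[_ /andP[/negPf-> _]]; rewrite mul0r.
by rewrite subrr ker0.
Qed.

Lemma capacityE s A : capacity s A = (min_energy s A)^-1. Proof. by []. Qed.

Lemma capacity_fset0 s : capacity s (fset0 : {fset V}) = 0 :> R.
Proof.
rewrite capacityE /min_energy.
suff -> : [set energy s fset0 mu | mu in [set mu | prob_on (fset0 : {fset V}) mu]] = set0 :> set R.
  by rewrite inf0 invr0.
by apply/seteqP; split => // e [mu [_ m1] _]; move: m1; rewrite big_seq_fset0 => /esym/eqP;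
  rewrite oner_eq0.
Qed.

Lemma capacity_gt0 (s : R) A : 0 <= s -> A != fset0 -> 0 < capacity s A.
Proof. by move=> s0 A0; rewrite capacityE invr_gt0 min_energy_gt0. Qed.

Lemma capacity_ge0 (s : R) A : 0 <= s -> 0 <= capacity s A.
Proof.
move=> s0; have [->|A0] := eqVneq A fset0; first by rewrite capacity_fset0.
exact: ltW (capacity_gt0 s0 A0).
Qed.

Lemma capacity_ge1 (s : R) A : 0 <= s -> A != fset0 -> 1 <= capacity s A.
Proof. by move=> s0 A0; rewrite capacityE invf_ge1 ?min_energy_le1// min_energy_gt0. Qed.

Lemma prob_on_neq0 A mu : prob_on A mu -> A != fset0.
Proof.
move=> [_ m1]; apply/eqP => A0; move: m1; rewrite A0 big_seq_fset0 => /eqP.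
by rewrite eq_sym oner_eq0.
Qed.

Lemma capacity_ge s A mu : 0 <= s -> prob_on A mu -> (energy s A mu)^-1 <= capacity s A.
Proof.
move=> s0 mup; have A0 := prob_on_neq0 mup; have m0 := min_energy_gt0 s0 A0.
rewrite capacityE lef_pV2 ?posrE ?min_energy_le//.
exact: lt_le_trans m0 (min_energy_le s mup).
Qed.

Lemma capacity_le s A (e : R) : 0 < e ->
  (forall mu, prob_on A mu -> e^-1 <= energy s A mu) -> capacity s A <= e.
Proof.
move=> e0 h; have [->|A0] := eqVneq A fset0; first by rewrite capacity_fset0 ltW.
have m : e^-1 <= min_energy s A by exact: min_energy_ge.
rewrite capacityE -[e]invrK lef_pV2 ?posrE ?invr_gt0//.
by apply: lt_le_trans m; rewrite invr_gt0.
Qed.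

Lemma capacity_approx s A (k : R) : 0 <= s -> A != fset0 -> 1 < k ->
  exists2 mu, prob_on A mu & energy s A mu <= k * min_energy s A.
Proof.
move=> s0 A0 k1; have m0 := min_energy_gt0 s0 A0.
have e0 : 0 < (k - 1) * min_energy s A by rewrite mulr_gt0// subr_gt0.
have [|_ [mu mup <-] h] := @inf_adherent _ [set energy s A mu | mu in [set mu | prob_on A mu]] _ e0.
  split.
    by have /fset0Pn[x xA] := A0; exists (energy s A (fun y => (y == x)%:R)), (fun y => (y == x)%:R) => //; exact: prob_on_dirac.
  by exists 0 => _ [nu [nu0 _] <-]; exact: energy_ge0.
exists mu => //; apply: ltW; apply: lt_le_trans h _; rewrite -/(min_energy s A); lra.
Qed.

(** Any nonnegative weight, normalized or not, gives a lower bound that is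
    a polynomial in its mass and energy; unlike the quotient of these, it can be
    averaged when the weight is random. The quadratic in [k] is at most
    [mass ^ 2 / energy]. *)
Lemma capacity_ge_quadratic s A mu (k : R) : 0 <= s -> (forall x, x \in A -> 0 <= mu x) ->
  0 <= k -> 2 * k * (\sum_(x <- A) mu x) - k ^+ 2 * energy s A mu <= capacity s A.
Proof.
move=> s0 mu0 k0; set M := \sum_(x <- A) mu x.
have M0 : 0 <= M by exact: sumr_seq_ge0.
have E0 := energy_ge0 s mu0.
have c0 := capacity_ge0 A s0.
have [M00|Mn0] := eqVneq M 0.
  apply: le_trans c0; rewrite M00 mulr0 sub0r oppr_le0 mulr_ge0// exprn_ge0//.
have Mp : 0 < M by rewrite lt_def Mn0.
have mup : prob_on A (fun x => M^-1 * mu x).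
  split; first by move=> x xA; rewrite mulr_ge0 ?invr_ge0 ?mu0.
  by rewrite -mulr_sumr mulVf.
have := capacity_ge s0 mup; rewrite energyZ => h.
have Ep : 0 < energy s A mu.
  have := min_energy_le s mup; rewrite energyZ.
  move=> /(lt_le_trans (min_energy_gt0 s0 (prob_on_neq0 mup))).
  by rewrite pmulr_rgt0// exprn_gt0// invr_gt0.
apply: le_trans h; rewrite invfM exprVn invrK ler_pdivlMr//.
have : 0 <= (M - k * energy s A mu) ^+ 2 by exact: sqr_ge0.
nra.
Qed.

Lemma sum_restrict A B (F : V -> R) : {subset A <= B} ->
  \sum_(x <- B) (if x \in A then F x else 0) = \sum_(x <- A) F x.
Proof.
move=> AB; rewrite (big_fsetID _ (mem A))/= [X in _ + X]big1_seq ?addr0; last first.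
  by move=> x; rewrite !inE /= => /andP[_ /negPf->].
have -> : [fset x in B | (mem A) x]%fset = A.
  apply/fsetP => x; rewrite !inE /=; apply/andP/idP => [[]//|xA]; split => //.
  exact: AB.
by apply: eq_big_seq => x ->.
Qed.

Lemma energy_restrict s A B mu : {subset A <= B} ->
  energy s B (fun x => if x \in A then mu x else 0) = energy s A mu.
Proof.
move=> AB; rewrite !energyE -(sum_restrict _ AB); apply: eq_bigr => x _.
case: ifP => xA; last by rewrite mul0r.
congr (_ * _); rewrite /pot -(sum_restrict _ AB).
by apply: eq_bigr => y _; case: ifP => //; rewrite mul0r.
Qed.

Lemma capacity_mono (s : R) A B : 0 <= s -> {subset A <= B} -> capacity s A <= capacity s B.
Proof.
move=> s0 AB; have [->|A0] := eqVneq A fset0.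
  by rewrite capacity_fset0 capacity_ge0.
have B0 : B != fset0 by have /fset0Pn[x xA] := A0; apply/fset0Pn; exists x; exact: AB.
apply: capacity_le => [|mu [mu0 mu1]]; first exact: capacity_gt0.
rewrite capacityE invrK -(energy_restrict _ _ AB); apply: min_energy_le; split.
  by move=> x _; case: ifP => // /mu0.
by rewrite sum_restrict.
Qed.

Lemma capacity_isom_le (s : R) A (f : V -> V) : injective f -> 0 <= s ->
  (forall x y, nrm (f x - f y) = nrm (x - y)) -> capacity s [fset f x | x in A]%fset <= capacity s A.
Proof.
move=> fi s0 fn; have [->|A0] := eqVneq A fset0.
  by rewrite imfset0 capacity_fset0.
apply: capacity_le => [|mu [mu0 mu1]]; first exact: capacity_gt0.
have mup : prob_on A (fun x => mu (f x)).
  split; first by move=> x xA; apply: mu0; apply: in_imfset.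
  by rewrite -mu1 big_imfset//= => x y _ _ /fi.
rewrite capacityE invrK; apply: le_trans (min_energy_le s mup) _.
apply: eq_ler.
rewrite !energyE big_imfset/=; last by move=> x y _ _ /fi.
apply: eq_bigr => x _; congr (_ * _); rewrite /pot big_imfset/=; last by move=> ? ? _ _ /fi.
by apply: eq_bigr => y _; rewrite !kerE fn.
Qed.

Lemma capacity_isom (s : R) A (f g : V -> V) : cancel f g -> cancel g f -> 0 <= s ->
  (forall x y, nrm (f x - f y) = nrm (x - y)) -> capacity s [fset f x | x in A]%fset = capacity s A.
Proof.
move=> fK gK s0 fn; apply/le_anti/andP; split.
  by apply: capacity_isom_le => //; exact: can_inj fK.
have {1}-> : A = [fset g x | x in [fset f x | x in A]]%fset.
  rewrite -imfset_comp; apply/fsetP => x; apply/idP/imfsetP => /=.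
    by move=> xA; exists x => //; rewrite fK.
  by move=> [y yA ->]; rewrite fK.
apply: capacity_isom_le => //; first exact: can_inj gK.
by move=> x y; rewrite -fn !gK.
Qed.

(** At the point of [A] nearest to [x] all the distances to points of [A] are at
    most twice those from [x]. *)
Lemma pot_max_principle s A mu (t : R) : 0 <= s -> 0 <= t ->
  (forall x, x \in A -> 0 <= mu x) -> (forall x, x \in A -> pot s A mu x <= t) ->
  forall x, pot s A mu x <= 2 `^ s * t.
Proof.
move=> s0 t0 mu0 h x; have [->|/fset0Pn[b0 b0A]] := eqVneq A fset0.
  by rewrite /pot big_seq_fset0 mulr_ge0 ?powR_ge0.
have [b bA bmin] : exists2 b, b \in A & forall z, z \in A -> nrm (x - b) <= nrm (x - z).
  case: (@arg_minP _ _ A [` b0A]%fset xpredT (fun i => nrm (x - val i)) isT) => b _ bm.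
  exists (val b); first exact: valP.
  by move=> z zA; exact: (bm [` zA]%fset isT).
apply: (@le_trans _ _ (2 `^ s * pot s A mu b)); last by rewrite ler_wpM2l ?powR_ge0 ?h.
rewrite /pot mulr_sumr; apply: ler_sum_seq => z zA.
rewrite mulrCA ler_wpM2l ?mu0//; apply: ker_comp => //.
have := @ler_nrmB R _ b x z; have := bmin z zA; rewrite (nrmB b x).
by move: (nrm _) (nrm _) (nrm _) => *; lra.
Qed.

(** A weight with bounded potential everywhere and mass of the order of the
    capacity: restrict an almost minimal weight to the points where its potential
    is at most twice its mean, and apply the maximum principle. *)
Lemma equilibrium_upper s A : 0 <= s ->
  exists mu, [/\ forall x, 0 <= mu x, forall x, x \notin A -> mu x = 0,
    capacity s A / 8 <= \sum_(x <- A) mu x & forall x, pot s A mu x <= 2 `^ s].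
Proof.
move=> s0; have [->|A0] := eqVneq A fset0.
  exists (fun=> 0); split => // [|x]; first by rewrite capacity_fset0 mul0r big_seq_fset0.
  by rewrite /pot big_seq_fset0 powR_ge0.
have [mu [mu0 mu1] muE] := capacity_approx s0 A0 (ltr1n _ 2 : 1 < 2).
have m0 := min_energy_gt0 s0 A0.
set E := energy s A mu in muE.
have E0 : 0 < E by apply: lt_le_trans m0 _; exact: min_energy_le.
(* By Markov's inequality at least half of the mass is on A'. *)
pose A' := [fset x in A | pot s A mu x <= 2 * E]%fset.
have AA' : {subset A' <= A} by move=> x; rewrite !inE => /andP[].
exists (fun x => if x \in A' then (2 * E)^-1 * mu x else 0); split.
- by move=> x; case: ifP => // /AA' xA; rewrite mulr_ge0 ?mu0// invr_ge0 mulr_ge0// ltW.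
- by move=> x; apply: contraNeq; case: ifP => [/AA'//|]; rewrite eqxx.
- rewrite sum_restrict// -mulr_sumr.
  have : 1 / 2 <= \sum_(x <- A') mu x.
    have : \sum_(x <- A) mu x = \sum_(x <- A') mu x + \sum_(x <- [fset x in A | ~~ (pot s A mu x <= 2 * E)]%fset) mu x.
      by rewrite (big_fsetID _ (fun x => pot s A mu x <= 2 * E)).
    rewrite mu1; set S2 := \sum_(x <- [fset x in A | ~~ _]%fset) _ => e.
    suff : S2 * (2 * E) <= E.
      by rewrite mulrA -ler_pdivlMr// divff ?gt_eqF//; lra.
    rewrite {2}/E energyE /S2 mulr_suml.
    apply: le_trans (_ : \sum_(x <- [fset x in A | ~~ (pot s A mu x <= 2 * E)]%fset) mu x * pot s A mu x <= _).
      apply: ler_sum_seq => x; rewrite !inE -ltNge => /andP[xA /ltW h].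
      by rewrite ler_wpM2l ?mu0.
    apply: ler_sum_fsetS => x; first by rewrite !inE => /andP[].
    by move=> xA; rewrite mulr_ge0 ?pot_ge0 ?mu0.
  move=> h; apply: (@le_trans _ _ ((2 * E)^-1 * (1 / 2))); last first.
    by rewrite ler_wpM2l// invr_ge0 mulr_ge0// ltW.
  rewrite capacityE invfM -subr_ge0.
  have : 2^-1 * (min_energy s A)^-1 <= E^-1 by rewrite -invfM lef_pV2// posrE// mulr_gt0.
  lra.
- move=> x; set nu := fun _ => _.
  have potE y : pot s A nu y = pot s A' (fun x => (2 * E)^-1 * mu x) y.
    rewrite /pot /nu -(sum_restrict _ AA'); apply: eq_bigr => z _.
    by case: ifP => // _; rewrite mul0r.
  rewrite potE -[leRHS]mulr1; apply: pot_max_principle => //.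
    by move=> y /AA' yA; rewrite mulr_ge0 ?mu0// invr_ge0 mulr_ge0// ltW.
  move=> y yA'; have := yA'; rewrite !inE => /andP[yA].
  have E20 : 0 < 2 * E by rewrite mulr_gt0.
  move=> h; apply: (@le_trans _ _ ((2 * E)^-1 * pot s A mu y)); last first.
    by rewrite mulrC ler_pdivrMr// mul1r.
  rewrite /pot; under eq_bigr do rewrite -mulrA.
  rewrite -mulr_sumr ler_wpM2l ?invr_ge0 ?(ltW E20)//.
  by apply: ler_sum_fsetS => // z zA; rewrite mulr_ge0 ?ker_ge0 ?mu0.
Qed.

(** First variation: moving mass towards a point where the potential of an almost
    minimal weight is small would lower its energy too much. *)
Lemma equilibrium_lower s A : 0 <= s -> A != fset0 ->
  exists mu, [/\ prob_on A mu, energy s A mu <= 2 * min_energy s A &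
    forall x, x \in A -> min_energy s A / 2 <= pot s A mu x].
Proof.
move=> s0 A0; have m0 := min_energy_gt0 s0 A0; have m1 := min_energy_le1 s A0.
set I := min_energy s A in m0 m1 *.
(* The mass moved to x is t; the ratio 1 + t / 4 of the approximate minimizer is
   close enough to one for its defect to be absorbed at the end. *)
set t := I / 4; have t0 : 0 < t by rewrite divr_gt0.
have k1 : 1 < 1 + t / 4 by rewrite ltrDl divr_gt0.
have [mu [mu0 mu1] muE] := capacity_approx s0 A0 k1.
have t1 : t <= 1 / 4 by rewrite /t; lra.
exists mu; split => //.
  apply: le_trans muE _; rewrite -/I ler_wpM2r ?(ltW m0)//; lra.
move=> x xA; set U := pot s A mu x.
pose nu y := (1 - t) * mu y + t * (y == x)%:R.
have nup : prob_on A nu.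
  split => [y yA|]; first by rewrite addr_ge0 ?mulr_ge0 ?mu0 ?ler0n ?(ltW t0)//; lra.
  rewrite big_split/= -!mulr_sumr mu1.
  have -> : \sum_(y <- A) ((y == x)%:R : R) = 1 by case: (prob_on_dirac xA).
  by rewrite !mulr1 subrK.
have potd (y : V) (F : V -> R) : \sum_(z <- A) (z == x)%:R * F z = F x.
  rewrite (big_fsetD1 x)//= eqxx mul1r big1_seq ?addr0// => z.
  by rewrite !inE => /andP[_ /andP[/negPf-> _]]; rewrite mul0r.
have potn y : pot s A nu y = (1 - t) * pot s A mu y + t * ker s (y - x).
  rewrite /pot -(potd y (fun z => t * ker s (y - z))) mulr_sumr -big_split/=.
  by apply: eq_bigr => z _; rewrite /nu; ring.
have := min_energy_le s nup; rewrite -/I.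
have -> : energy s A nu = (1 - t) ^+ 2 * energy s A mu + 2 * t * (1 - t) * U + t ^+ 2.
  rewrite energyE; under eq_bigr do rewrite potn /nu.
  have -> : \sum_(y <- A) ((1 - t) * mu y + t * (y == x)%:R) *
      ((1 - t) * pot s A mu y + t * ker s (y - x)) =
    \sum_(y <- A) ((1 - t) ^+ 2 * (mu y * pot s A mu y)
      + (1 - t) * t * (mu y * ker s (x - y))
      + (y == x)%:R * (t * ((1 - t) * pot s A mu y + t * ker s (y - x)))).
    by apply: eq_bigr => y _; rewrite (kerB s x y); ring.
  rewrite !big_split/= -!mulr_sumr -energyE potd// -/(pot s A mu x) -/U subrr ker0.
  ring.
move: muE; rewrite -/I => muE h.
have IE : I = 4 * t by rewrite /t; field.
have : (1 - t) ^+ 2 * energy s A mu <= (1 - t) ^+ 2 * ((1 + t / 4) * I).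
  by rewrite ler_wpM2l ?sqr_ge0.
rewrite IE in h * => h2.
have U0 : 0 <= U by exact: pot_ge0.
have {h2} : 4 * t <= (1 - t) ^+ 2 * ((1 + t / 4) * (4 * t)) + 2 * t * (1 - t) * U + t ^+ 2 by lra.
have -> : (1 - t) ^+ 2 * ((1 + t / 4) * (4 * t)) + 2 * t * (1 - t) * U + t ^+ 2 =
  t * ((1 - t) ^+ 2 * (4 + t) + 2 * (1 - t) * U + t) by field.
rewrite mulrC ler_pM2l// => h3.
have h4 : 2 * (1 - t) * U <= 2 * U by nra.
have h5 : (1 - t) ^+ 2 * (4 + t) <= 4 - 5 * t.
  rewrite -subr_ge0.
  have -> : 4 - 5 * t - (1 - t) ^+ 2 * (4 + t) = t * (2 * (1 - t) - t ^+ 2) by ring.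
  by rewrite mulr_ge0 ?(ltW t0)//; nra.
lra.
Qed.

(** Some piece has mass at least [1 / #|I|] for an almost minimal weight, and
    renormalizing its restriction multiplies the energy by at most
    [#|I| ^ 2]. *)
Lemma capacity_pieces (I : finType) (s : R) A (phi : V -> I) : 0 <= s -> A != fset0 ->
  exists i, [fset x in A | phi x == i]%fset != fset0 /\
    capacity s A <= 2 * #|I|%:R ^+ 2 * capacity s [fset x in A | phi x == i]%fset.
Proof.
move=> s0 A0; have [mu [mu0 mu1] muE] := capacity_approx s0 A0 (ltr1n _ 2 : 1 < 2).
pose P i := [fset x in A | phi x == i]%fset.
have PA i : {subset P i <= A} by move=> x; rewrite !inE => /andP[].
have sumP : \sum_i \sum_(x <- P i) mu x = 1.
  rewrite -mu1 (eq_bigr (fun i => \sum_(x <- A | phi x == i) mu x)).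
    rewrite (exchange_big_dep xpredT)//=; apply: eq_bigr => x _.
    by rewrite (eq_bigl (pred1 (phi x))) ?big_pred1_eq// => i; rewrite eq_sym.
  by move=> i _; rewrite big_fset.
have I0 : 0 < #|I|%:R :> R.
  by have /fset0Pn[x _] := A0; rewrite ltr0n; apply/card_gt0P; exists (phi x).
have [i hi] : exists i, (#|I|%:R)^-1 <= \sum_(x <- P i) mu x.
  apply: contrapT => /forallNP h.
  have : \sum_i \sum_(x <- P i) mu x < \sum_(i : I) (#|I|%:R)^-1.
    have /fset0Pn[x0 _] := A0; apply: ltr_sum; first by apply/hasP; exists (phi x0).
    by move=> i _; rewrite ltNge; apply/negP.
  by rewrite sumP sumr_const -[ltRHS]mulr_natl divff ?gt_eqF// ltxx.
set M := \sum_(x <- P i) mu x in hi.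
have M0 : 0 < M by apply: lt_le_trans hi; rewrite invr_gt0.
have mup : prob_on (P i) (fun x => M^-1 * mu x).
  split; first by move=> x /PA xA; rewrite mulr_ge0 ?mu0// invr_ge0 ltW.
  by rewrite -mulr_sumr mulVf ?gt_eqF.
exists i; split; first exact: prob_on_neq0 mup.
have cg := capacity_ge s0 mup; rewrite energyZ in cg.
have EP : energy s (P i) mu <= energy s A mu.
  rewrite -(energy_restrict _ _ (PA i)) !energyE; apply: ler_sum_seq => x xA.
  have p0 : forall y, y \in A -> 0 <= (if y \in P i then mu y else 0).
    by move=> y yA; case: ifP => // _; exact: mu0.
  apply: ler_pM; rewrite ?pot_ge0 ?p0//; first by case: ifP => //; rewrite mu0.
  apply: ler_sum_seq => y yA; rewrite ler_wpM2r ?ker_ge0//.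
  by case: ifP => //; rewrite mu0.
have E0 : 0 < energy s (P i) mu.
  have := min_energy_le s mup; rewrite energyZ.
  move=> /(lt_le_trans (min_energy_gt0 s0 (prob_on_neq0 mup))).
  by rewrite pmulr_rgt0// exprn_gt0// invr_gt0.
have m0 := min_energy_gt0 s0 A0.
apply: le_trans (_ : 2 * #|I|%:R ^+ 2 * (M^-1 ^+ 2 * energy s (P i) mu)^-1 <= _); last first.
  by rewrite ler_wpM2l// mulr_ge0// exprn_ge0.
rewrite invfM exprVn invrK capacityE -[leLHS]mul1r.
have h1 : 1 <= #|I|%:R ^+ 2 * M ^+ 2 :> R.
  rewrite -exprMn exprn_ege1//; rewrite mulrC -ler_pdivrMr// mul1r//.
have h2 : (min_energy s A)^-1 <= 2 * (energy s (P i) mu)^-1.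
  rewrite -[2]invrK -invfM lef_pV2 ?posrE//; last first.
    by rewrite mulr_gt0// invr_gt0.
  by rewrite mulrC ler_pdivrMr// mulrC (le_trans EP).
have -> : 2 * #|I|%:R ^+ 2 * (M ^+ 2 / energy s (P i) mu) =
  (#|I|%:R ^+ 2 * M ^+ 2) * (2 * (energy s (P i) mu)^-1) :> R by ring.
by apply: ler_pM => //; rewrite invr_ge0 ltW.
Qed.
End Capacity.

(** * Dual and strong-type capacitary inequalities *)

Section Potential.
Context {R : realType} {d : nat}.
Local Notation V := 'rV[int]_d.
Local Notation nrm := (@nrm R d).
Local Notation ker := (@ker R d).
Implicit Types (x y z w : V) (A B E W Y Z S : {fset V}) (mu f g : V -> R).

Lemma capacity_le_mul (s : R) A (e : R) : 0 <= e ->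
  (forall mu, prob_on A mu -> 1 <= e * energy s A mu) -> capacity s A <= e.
Proof.
move=> e0 h; have [->|/fset0Pn[x xA]] := eqVneq A fset0; first by rewrite capacity_fset0.
have ep : 0 < e.
  rewrite lt_def e0 andbT; apply/eqP => e00.
  by have := h _ (prob_on_dirac xA); rewrite e00 mul0r ler10.
by apply: capacity_le => // mu /h; rewrite mulrC -ler_pdivrMr// div1r.
Qed.

(** Expanding the square, the sum over [y] composes two kernels of order [s] into
    one of order [2s - d]. *)
Lemma sum_pot_sqr_le (s : R) : d%:R / 2 < s -> s < d%:R ->
  exists2 C : R, 0 < C & forall Y B mu, (forall x, x \in B -> 0 <= mu x) ->
    \sum_(y <- Y) pot s B mu y ^+ 2 <= C * energy (s + s - d%:R) B mu.
Proof.
move=> s1 s2; have s0 : 0 <= s < d%:R by rewrite s2 andbT; have := ler0n R d; lra.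
have [|C C0 hC] := conv_upper s0 s0; first by lra.
exists C => // Y B mu mu0.
have -> : \sum_(y <- Y) pot s B mu y ^+ 2 =
   \sum_(x <- B) \sum_(z <- B) mu x * mu z * \sum_(y <- Y) ker s (x - y) * ker s (y - z).
  under eq_bigr => y _.
    rewrite expr2 {1}/pot mulr_suml.
    under eq_bigr => x _ do rewrite /pot mulr_sumr.
    over.
  rewrite exchange_big/=; apply: eq_bigr => x _.
  rewrite exchange_big/=; apply: eq_bigr => z _.
  rewrite mulr_sumr; apply: eq_bigr => y _.
  by rewrite (kerB s x y); ring.
rewrite energyE mulr_sumr; apply: ler_sum_seq => x xB.
rewrite /pot mulrCA mulr_sumr mulr_sumr; apply: ler_sum_seq => z zB.
apply: le_trans (_ : mu x * mu z * (C * ker (s + s - d%:R) (x - z)) <= _).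
  by rewrite ler_wpM2l ?hC ?mulr_ge0 ?mu0.
by apply: eq_ler; ring.
Qed.

Lemma pot_pairing (s : R) A B mu f :
  \sum_(x <- A) mu x * pot s B f x = \sum_(y <- B) f y * pot s A mu y.
Proof.
under eq_bigr do rewrite /pot mulr_sumr.
rewrite exchange_big/=; apply: eq_bigr => y _; rewrite /pot mulr_sumr.
by apply: eq_bigr => x _; rewrite (kerB s x y); ring.
Qed.

Lemma sum_mul_le (K : choiceType) (s : seq K) (f g : K -> R) (k : R) : 0 < k ->
  \sum_(x <- s) f x * g x <= k / 2 * (\sum_(x <- s) f x ^+ 2) + (2 * k)^-1 * \sum_(x <- s) g x ^+ 2.
Proof.
move=> k0; rewrite !mulr_sumr -big_split/=; apply: ler_sum => x _.
have -> : k / 2 * f x ^+ 2 + (2 * k)^-1 * g x ^+ 2 =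
   f x * g x + (2 * k)^-1 * (k * f x - g x) ^+ 2 by field; rewrite gt_eqF.
by rewrite lerDl mulr_ge0 ?sqr_ge0// invr_ge0 mulr_ge0// ltW.
Qed.

(** Pair the lower bound on the potential of [g] with a probability weight on [B],
    exchange the two, and use Cauchy-Schwarz: the squared norm of the potential
    of order [(d + a) / 2] of the weight is at most its energy of order [a]. *)
Lemma capacity_le_dual (a : R) : 0 < a < d%:R ->
  exists2 C : R, 0 < C & forall B Y g (c : R), 0 < c ->
    (forall b, b \in B -> c <= pot ((d%:R + a) / 2) Y g b) ->
    capacity a B <= C / c ^+ 2 * \sum_(y <- Y) g y ^+ 2.
Proof.
move=> /andP[a0 ad]; set s := (d%:R + a) / 2.
have [||C C0 hC] := @sum_pot_sqr_le s; rewrite /s; [lra|lra|].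
exists C => // B Y g c c0 hB.
have e0 : (d%:R + a) / 2 + (d%:R + a) / 2 - d%:R = a by field.
apply: capacity_le_mul => [|mu mup]; have G0 : 0 <= \sum_(y <- Y) g y ^+ 2.
- by apply: sumr_ge0 => y _; exact: sqr_ge0.
- by rewrite mulr_ge0// divr_ge0 ?ltW// exprn_gt0.
- by apply: sumr_ge0 => y _; exact: sqr_ge0.
case: (mup) => mu0 mu1.
have En0 : 0 < energy a B mu.
  by apply: lt_le_trans (min_energy_le a mup); rewrite min_energy_gt0 ?(ltW a0)// (prob_on_neq0 mup).
have h1 : c <= \sum_(y <- Y) g y * pot s B mu y.
  rewrite -pot_pairing -[c]mul1r -mu1 mulr_suml.
  by apply: ler_sum_seq => x xB; rewrite ler_wpM2l ?mu0// hB.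
have k0 : 0 < C * energy a B mu / c by rewrite divr_gt0// mulr_gt0.
have := le_trans h1 (sum_mul_le _ _ _ k0).
have := hC Y B mu mu0; rewrite e0 -/s.
move: (\sum_(y <- Y) pot s B mu y ^+ 2) (\sum_(y <- Y) g y ^+ 2) (energy a B mu) En0 k0 G0.
move=> X G En En0 k0 G0 h3 h4.
have h5 : (2 * (C * En / c))^-1 * X <= c / 2.
  apply: (@le_trans _ _ ((2 * (C * En / c))^-1 * (C * En))).
    by rewrite ler_wpM2l// invr_ge0 mulr_ge0// ltW.
  by apply: eq_ler; field; rewrite !gt_eqF.
have h6 : c <= C * En / c * G by lra.
have -> : C / c ^+ 2 * G * En = (C * En / c * G) / c by field; rewrite gt_eqF.
by rewrite ler_pdivlMr// mul1r.
Qed.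

Lemma sum_pow2_le (n m : nat) : (\sum_(j < n | (j <= m)%N) 2 ^+ j <= 2 ^+ m.+1 :> R).
Proof.
have h k : \sum_(j < k) 2 ^+ j <= 2 ^+ k - 1 :> R.
  elim: k => [|k IH]; first by rewrite big_ord0 expr0 subrr.
  by rewrite big_ord_recr/= exprS; lra.
apply: le_trans (_ : \sum_(j < m.+1) 2 ^+ j <= _); last first.
  by apply: le_trans (h m.+1) _; lra.
rewrite -(big_mkord (fun j => (j <= m)%N) (fun j => 2 ^+ j)) -(big_mkord xpredT (fun j => 2 ^+ j)).
have [nm|mn] := leqP n m.+1.
  rewrite [leRHS](big_cat_nat (n := n))//= -[leLHS]addr0 lerD//.
    by rewrite [leRHS]big_mkcond [leLHS]big_mkcond ler_sum// => j _; case: ifP.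
  by apply: sumr_ge0 => j _; exact: exprn_ge0.
rewrite (big_cat_nat (n := m.+1))//=; last by exact: ltnW.
rewrite [X in _ + X]big_nat_cond [X in _ + X]big_pred0 ?addr0.
  by rewrite [leLHS]big_mkcond ler_sum// => j _; case: ifP => // _; exact: exprn_ge0.
by move=> j; apply/negP => /andP[/andP[]]; lia.
Qed.

(** Maz'ya's strong-type inequality, by Hansson's argument: the equilibrium
    measures of the level sets are combined into a single weight, whose energy is
    linear and not quadratic in their masses because their potentials are
    bounded and the levels grow geometrically. *)
Lemma capacity_strong_type (a : R) : 0 < a < d%:R ->
  exists2 C : R, 0 < C & forall W f Z (n : nat) (tau : R), 0 < tau ->
    \sum_(j < n) (tau * 2 ^+ j) ^+ 2 *
      capacity a [fset z in Z | tau * 2 ^+ j <= pot ((d%:R + a) / 2) W f z]%fset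
    <= C * \sum_(w <- W) f w ^+ 2.
Proof.
move=> /andP[a0 ad]; set s := (d%:R + a) / 2.
have [||C1 C10 hC1] := @sum_pot_sqr_le s; rewrite /s; [lra|lra|].
have e0 : (d%:R + a) / 2 + (d%:R + a) / 2 - d%:R = a by field.
rewrite e0 -/s in hC1; rewrite -/s.
pose C2 := C1 * (4 * 2 `^ a).
have C20 : 0 < C2 by rewrite !mulr_gt0// powR_gt0.
exists (8 * C2); first by rewrite mulr_gt0.
move=> W f Z n tau tau0.
pose E (j : nat) := [fset z in Z | (tau * 2 ^+ j <= pot s W f z)%R]%fset.
have EZ j : {subset E j <= Z} by move=> z; rewrite !inE => /andP[].
pose t (j : nat) := tau * 2 ^+ j.
have t0 j : 0 < t j by rewrite mulr_gt0// exprn_gt0.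
have /choice[mu hmu] := fun j => equilibrium_upper (E j) (ltW a0).
have mu0 j x : 0 <= mu j x by case: (hmu j).
have muE j x : x \notin E j -> mu j x = 0 by case: (hmu j) => _ h _ _; exact: h.
pose c j := \sum_(x <- Z) mu j x.
have restr j (F : V -> R) : \sum_(x <- Z) mu j x * F x = \sum_(x <- E j) mu j x * F x.
  rewrite -(sum_restrict _ (EZ j)); apply: eq_bigr => x _.
  by case: ifPn => // /muE ->; rewrite mul0r.
have cE j : c j = \sum_(x <- E j) mu j x.
  have := restr j (fun=> 1); rewrite /c; under eq_bigr do rewrite mulr1.
  by move=> ->; apply: eq_bigr => x _; rewrite mulr1.
have c0 j : 0 <= c j by apply: sumr_ge0.
have capc j : capacity a (E j) <= 8 * c j.
  by case: (hmu j) => _ _ + _; rewrite cE; lra.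
have potE j x : pot a Z (mu j) x <= 2 `^ a.
  by case: (hmu j) => _ _ _ /(_ x); rewrite /pot restr.
pose T := \sum_(j < n) t j ^+ 2 * c j.
have T0 : 0 <= T by apply: sumr_ge0 => j _; rewrite mulr_ge0 ?sqr_ge0.
suff TF : T <= C2 * \sum_(w <- W) f w ^+ 2.
  apply: (@le_trans _ _ (8 * T)); last by rewrite -mulrA ler_wpM2l.
  rewrite /T mulr_sumr; apply: ler_sum => j _; rewrite mulrCA ler_wpM2l ?sqr_ge0//.
  exact: capc.
(* Each level t j is at most U on its level set, so the pairing of f with the
   potential of m dominates T. *)
pose m x := \sum_(j < n) t j * mu j x.
have m0 x : 0 <= m x by apply: sumr_ge0 => j _; rewrite mulr_ge0// ltW.
have T1 : T <= \sum_(w <- W) f w * pot s Z m w.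
  rewrite -pot_pairing /m; under eq_bigr do rewrite mulr_suml.
  rewrite exchange_big/= /T; apply: ler_sum => j _.
  under eq_bigr do rewrite -mulrA.
  rewrite -mulr_sumr expr2 -mulrA ler_wpM2l ?(ltW (t0 _))// cE restr mulr_sumr.
  apply: ler_sum_seq => x; rewrite !inE => /andP[_ h].
  by rewrite mulrC ler_wpM2l.
have T2 : energy a Z m <= 4 * 2 `^ a * T.
  pose e i j := \sum_(x <- Z) mu i x * pot a Z (mu j) x.
  have eE : energy a Z m = \sum_(i < n) \sum_(j < n) t i * t j * e i j.
    rewrite energyE /m; under eq_bigr do rewrite mulr_suml.
    rewrite exchange_big/=; apply: eq_bigr => i _; rewrite /e.
    under [RHS]eq_bigr do rewrite mulr_sumr.
    rewrite exchange_big/=; apply: eq_bigr => x _.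
    have -> : pot a Z (fun x0 => \sum_(j < n) t j * mu j x0) x =
        \sum_(j < n) t j * pot a Z (mu j) x.
      rewrite /pot; under eq_bigr do rewrite mulr_suml.
      rewrite exchange_big/=; apply: eq_bigr => j _; rewrite mulr_sumr.
      by apply: eq_bigr => z _; rewrite mulrA.
    by rewrite mulr_sumr; apply: eq_bigr => j _; ring.
  have e_le i j : e i j <= 2 `^ a * c i.
    rewrite /e /c mulr_sumr; apply: ler_sum => x _.
    by rewrite mulrC ler_wpM2r.
  have e_sym i j : e i j = e j i by rewrite /e pot_pairing.
  (* The mutual energy of two levels is at most the mass of either one; the mass
     of the higher level is kept, and the lower levels are summed. *)
  have pw i j : t i * t j * e i j <=
     2 `^ a * ((if (j <= i)%N then t i * t j * c i else 0) +
               (if (i <= j)%N then t i * t j * c j else 0)).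
    have tt : 0 <= t i * t j by rewrite mulr_ge0// ltW.
    have A1 : 0 <= if (j <= i)%N then t i * t j * c i else 0 by case: ifP => // _; rewrite mulr_ge0.
    have A2 : 0 <= if (i <= j)%N then t i * t j * c j else 0 by case: ifP => // _; rewrite mulr_ge0.
    have [ji|/ltnW ij] := leqP j i.
      rewrite ji in A1; apply: (@le_trans _ _ (2 `^ a * (t i * t j * c i))).
        by rewrite [leRHS]mulrCA ler_wpM2l.
      by rewrite ler_wpM2l ?powR_ge0// lerDl.
    rewrite ij in A2 *; apply: (@le_trans _ _ (2 `^ a * (t i * t j * c j))).
      by rewrite [leRHS]mulrCA ler_wpM2l// e_sym.
    by rewrite ler_wpM2l ?powR_ge0// lerDr.
  have half : \sum_(i < n) \sum_(j < n) (if (j <= i)%N then t i * t j * c i else 0) <= 2 * T.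
    rewrite /T mulr_sumr; apply: ler_sum => i _.
    rewrite -big_mkcond/=.
    have -> : \sum_(j < n | (j <= i)%N) t i * t j * c i =
       t i * c i * tau * \sum_(j < n | (j <= i)%N) 2 ^+ j.
      by rewrite mulr_sumr; apply: eq_bigr => j _; rewrite /t; ring.
    apply: (@le_trans _ _ (t i * c i * tau * 2 ^+ i.+1)).
      by rewrite ler_wpM2l ?sum_pow2_le// !mulr_ge0// ltW.
    by apply: eq_ler; rewrite /t exprS; ring.
  rewrite eE; apply: (@le_trans _ _ (\sum_(i < n) \sum_(j < n) 2 `^ a * ((if (j <= i)%N then t i * t j * c i else 0) +
               (if (i <= j)%N then t i * t j * c j else 0)))).
    by apply: ler_sum => i _; apply: ler_sum => j _; exact: pw.
  under eq_bigr do rewrite -mulr_sumr big_split/=.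
  rewrite -mulr_sumr big_split/= [X in _ * (_ + X)]exchange_big/=.
  under [X in _ * (_ + X)]eq_bigr => j _ do under eq_bigr => i _ do rewrite [t i * t j]mulrC.
  have -> : 4 * 2 `^ a * T = 2 `^ a * (2 * T + 2 * T) by ring.
  by rewrite ler_wpM2l ?powR_ge0// lerD.
have T3 : \sum_(w <- W) pot s Z m w ^+ 2 <= C2 * T.
  apply: le_trans (hC1 W Z m _) _; first by move=> x _; exact: m0.
  by rewrite /C2 -mulrA ler_wpM2l// ltW.
have := le_trans T1 (sum_mul_le _ _ _ C20).
have : (2 * C2)^-1 * (\sum_(w <- W) pot s Z m w ^+ 2) <= (2 * C2)^-1 * (C2 * T).
  by rewrite ler_wpM2l// invr_ge0 mulr_ge0// ltW.
have -> : (2 * C2)^-1 * (C2 * T) = T / 2 by field; rewrite gt_eqF.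
move: (\sum_(w <- W) f w ^+ 2) ((2 * C2)^-1 * _) => F X h1 h2; lra.
Qed.

(** The equilibrium measures of the pieces of [E] in the balls of radius [s] are
    summed over the centres. The potential of the sum is bounded on [E] by the
    number of balls near the given point plus the contribution of the distant
    ones, both of order [s ^ a * L ^ (d - a)]. *)
Lemma capacity_average (a : R) : 0 < a < d%:R ->
  exists2 C : R, 0 < C & forall E Y (s L : R), 1 <= s -> s <= L ->
    (forall b y, b \in E -> y \in Y -> nrm (b - y) <= L) ->
    \sum_(y <- Y) capacity a [fset b in E | nrm (b - y) <= s]%fset
      <= C * (s `^ a * L `^ (d%:R - a)) * capacity a E.
Proof.
move=> /andP[a0 ad]; have a0' := ltW a0.
have [C1 C10 hC1] := @sum_ker_ball R d a a0' ad.
pose K := 2 `^ a * 12 ^+ d + (2 `^ a * 2 `^ a * 2 `^ a) * C1.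
have K0 : 0 < K by rewrite addr_gt0 ?mulr_gt0 ?powR_gt0 ?exprn_gt0.
exists (8 * K); first by rewrite mulr_gt0.
move=> E Y s L s1 sL hL.
have s0 : 0 < s by lra.
have L0 : 0 < L by lra.
have L1 : 1 <= L by lra.
pose P y := [fset b in E | (nrm (b - y) <= s)%R]%fset.
have PE y : {subset P y <= E} by move=> z; rewrite !inE => /andP[].
have /choice[mu hmu] := fun y => equilibrium_upper (P y) a0'.
have mu0 y x : 0 <= mu y x by case: (hmu y).
have muP y x : x \notin P y -> mu y x = 0 by case: (hmu y) => _ h _ _; exact: h.
have restr y (F : V -> R) : \sum_(x <- E) mu y x * F x = \sum_(x <- P y) mu y x * F x.
  rewrite -(sum_restrict _ (PE y)); apply: eq_bigr => x _.
  by case: ifPn => // /muP ->; rewrite mul0r.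
pose c y := \sum_(x <- E) mu y x.
have cE y : c y = \sum_(x <- P y) mu y x.
  have := restr y (fun=> 1); rewrite /c; under eq_bigr do rewrite mulr1.
  by move=> ->; apply: eq_bigr => x _; rewrite mulr1.
have capc y : capacity a (P y) <= 8 * c y.
  by case: (hmu y) => _ _ + _; rewrite cE; lra.
have potP y x : pot a (P y) (mu y) x <= 2 `^ a by case: (hmu y).
have potE y x : pot a E (mu y) x = pot a (P y) (mu y) x by rewrite /pot restr.
have c_le y : c y <= 2 `^ a * 2 `^ a * s `^ a.
  have [P0|/fset0Pn[x xP]] := eqVneq (P y) fset0.
    by rewrite cE P0 big_seq_fset0 !mulr_ge0 ?powR_ge0.
  have h : c y * (2 * s) `^ (- a) <= 2 `^ a.
    apply: le_trans (potP y x); rewrite cE mulr_suml /pot; apply: ler_sum_seq => z zP.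
    rewrite ler_wpM2l// ker_ge//.
    move: xP zP; rewrite !inE => /andP[_ xs] /andP[_ zs].
    have := @ler_nrmB R _ x y z; rewrite (nrmB y z).
    by move: xs zs; move: (nrm _) (nrm _) (nrm _) => *; lra.
  move: h; rewrite powRN ler_pdivrMr ?powR_gt0 ?mulr_gt0//.
  by rewrite powRM ?(ltW s0)// mulrA.
pose m x := \sum_(y <- Y) mu y x.
have m0 x : 0 <= m x by apply: sumr_ge0.
pose Lam := K * (s `^ a * L `^ (d%:R - a)).
have Lam0 : 0 < Lam by rewrite !mulr_gt0 ?powR_gt0.
have pot_m x : x \in E -> pot a E m x <= Lam.
  move=> xE.
  have -> : pot a E m x = \sum_(y <- Y) pot a (P y) (mu y) x.
    rewrite /pot /m; under eq_bigr do rewrite mulr_suml.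
    by rewrite exchange_big/=; apply: eq_bigr => y _; rewrite restr.
  have pw y : y \in Y -> pot a (P y) (mu y) x <=
     2 `^ a * (if nrm (y - x) <= 4 * s then 1 else 0) +
     (2 `^ a * 2 `^ a * 2 `^ a * s `^ a) * (if nrm (y - x) <= L then ker a (y - x) else 0).
    move=> yY; have -> : nrm (y - x) <= L by rewrite nrmB hL.
    have [h|h] := leP (nrm (y - x)) (4 * s).
      rewrite mulr1; apply: le_trans (potP y x) _; rewrite lerDl.
      by rewrite !mulr_ge0 ?powR_ge0 ?ker_ge0.
    rewrite mulr0 add0r.
    apply: (@le_trans _ _ (c y * (2 `^ a * ker a (y - x)))); last first.
      have -> : 2 `^ a * 2 `^ a * 2 `^ a * s `^ a * ker a (y - x) =
        (2 `^ a * 2 `^ a * s `^ a) * (2 `^ a * ker a (y - x)) by ring.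
      by rewrite ler_wpM2r ?mulr_ge0 ?powR_ge0 ?ker_ge0.
    rewrite cE mulr_suml /pot; apply: ler_sum_seq => z; rewrite !inE => /andP[_ zs].
    rewrite ler_wpM2l// ker_comp//.
    have := @ler_nrmB R _ y z x; rewrite (nrmB y z) (nrmB z x).
    by move: h zs; move: (nrm _) (nrm _) (nrm _) => *; lra.
  apply: le_trans (ler_sum_seq pw) _.
  rewrite big_split/= -!mulr_sumr -!big_mkcond/=.
  have h1 : \sum_(y <- Y | nrm (y - x) <= 4 * s) 1 <= 12 ^+ d * s `^ a * L `^ (d%:R - a).
    have h41 : 1 <= 4 * s by lra.
    apply: le_trans (card_ball Y x h41) _.
    rewrite mulrA -natrM exprMn -mulrA ler_wpM2l ?exprn_ge0//.
    rewrite -powR_mulrn ?(ltW s0)//.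
    have -> : d%:R = a + (d%:R - a) by rewrite addrC subrK.
    rewrite powRD ?(gt_eqF s0) ?implybT// ler_wpM2l ?powR_ge0//.
    have -> : a + (d%:R - a) - a = d%:R - a by ring.
    by rewrite ge0_ler_powR ?nnegrE ?subr_ge0 ?(ltW s0) ?(ltW L0) ?(ltW ad).
  have h2 := hC1 Y x L L1.
  have -> : Lam = 2 `^ a * (12 ^+ d * s `^ a * L `^ (d%:R - a)) +
      2 `^ a * 2 `^ a * 2 `^ a * s `^ a * (C1 * L `^ (d%:R - a)) by rewrite /Lam /K; ring.
  by apply: lerD; rewrite ler_wpM2l ?mulr_ge0 ?powR_ge0.
pose M := \sum_(x <- E) m x.
have ME : M = \sum_(y <- Y) c y by rewrite /M /m exchange_big.
have En : energy a E m <= Lam * M.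
  rewrite energyE /M mulr_sumr; apply: ler_sum_seq => x xE.
  by rewrite mulrC ler_wpM2r// pot_m.
have := @capacity_ge_quadratic _ _ a E m (Lam^-1) a0' (fun x _ => m0 x).
rewrite invr_ge0 (ltW Lam0) -/M => /(_ isT) h.
have h3 : Lam^-1 ^+ 2 * energy a E m <= Lam^-1 * M.
  apply: (@le_trans _ _ (Lam^-1 ^+ 2 * (Lam * M))); first by rewrite ler_wpM2l ?sqr_ge0.
  by apply: eq_ler; field; rewrite gt_eqF.
have h4 : Lam^-1 * M <= capacity a E by apply: le_trans h; lra.
have h5 : M <= Lam * capacity a E by rewrite mulrC -ler_pdivrMr// mulrC.
apply: (@le_trans _ _ (8 * M)).
  by rewrite ME mulr_sumr; apply: ler_sum => y _; exact: capc.
by rewrite -!mulrA ler_wpM2l// !mulrA -[K * _ * _]mulrA -/Lam.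
Qed.
End Potential.

(** * Random finite sets and the upper comparison *)

Section Law.
Context {R : realType} {d : nat}.
Local Notation V := 'rV[int]_d.
Local Notation nrm := (@nrm R d).
Local Notation ker := (@ker R d).
Implicit Types (x y z w : V) (A B E W Y Z S : {fset V}).

(** Only finitely many points of a random set are ever involved, so the law of a
    random finite set is a list of weighted values, and expectations are finite
    sums. *)
Definition law := seq (R * {fset V}).

Definition Ex (l : law) (f : {fset V} -> R) : R := \sum_(q <- l) q.1 * f q.2.

Definition meets A B : bool := (A `&` B)%fset != fset0.

Definition hit (l : law) B : R := Ex l (fun S => (meets S B)%:R).

Definition nonneg_law (l : law) := forall q, q \in l -> 0 <= q.1.

Definition diffset A S : {fset V} := [fset a - r | a in A, r in S]%fset.

Lemma meetsP A B : reflect (exists2 x, x \in A & x \in B) (meets A B).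
Proof.
apply: (iffP (fset0Pn _)) => [[x]|[x xA xB]]; rewrite ?inE.
  by move=> /andP[xA xB]; exists x.
by exists x; rewrite inE xA.
Qed.

Lemma diffsetP A S x : reflect (exists a r, [/\ a \in A, r \in S & x = a - r]) (x \in diffset A S).
Proof.
apply: (iffP (imfset2P _ _ _ _ _)) => /=.
  by move=> [a aA [r rS ->]]; exists a, r.
by move=> [a [r [aA rS ->]]]; exists a => //; exists r.
Qed.

Lemma eq_Ex (l : law) f g : (forall q, q \in l -> f q.2 = g q.2) -> Ex l f = Ex l g.
Proof. by move=> fg; apply: eq_big_seq => q /fg ->. Qed.

Lemma ler_Ex (l : law) f g : nonneg_law l ->
  (forall q, q \in l -> f q.2 <= g q.2) -> Ex l f <= Ex l g.
Proof.
move=> l0 fg; rewrite /Ex big_seq [leRHS]big_seq; apply: ler_sum => q ql.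
by rewrite ler_wpM2l ?l0 ?fg.
Qed.

Lemma Ex_ge0 (l : law) f : nonneg_law l -> (forall q, q \in l -> 0 <= f q.2) -> 0 <= Ex l f.
Proof. by move=> l0 f0; rewrite /Ex big_seq; apply: sumr_ge0 => q ql; rewrite mulr_ge0 ?l0 ?f0. Qed.

Lemma ExZ (l : law) (k : R) f : Ex l (fun S => k * f S) = k * Ex l f.
Proof. by rewrite /Ex mulr_sumr; apply: eq_bigr => q _; rewrite mulrCA. Qed.

Lemma Ex_sum (K : Type) (s : seq K) (P : pred K) (l : law) (f : K -> {fset V} -> R) :
  Ex l (fun S => \sum_(i <- s | P i) f i S) = \sum_(i <- s | P i) Ex l (f i).
Proof.
by rewrite /Ex; under eq_bigr do rewrite mulr_sumr; rewrite exchange_big.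
Qed.

Lemma hit_ge0 (l : law) B : nonneg_law l -> 0 <= hit l B.
Proof. by move=> l0; apply: Ex_ge0. Qed.

Lemma exists_lb (s : seq V) (F : V -> R) : (forall z, z \in s -> 0 < F z) ->
  exists2 t : R, 0 < t & forall z, z \in s -> t <= F z.
Proof.
elim: s => [|x s IH] h; first by exists 1.
have [z zs|t t0 ht] := IH; first by apply: h; rewrite inE zs orbT.
exists (Num.min t (F x)); first by rewrite lt_min t0 h ?mem_head.
move=> z; rewrite inE => /orP[/eqP->|/ht]; first by rewrite ge_min lexx orbT.
by move=> h'; rewrite ge_min h'.
Qed.

(** A point of [y + S] in [E] is a point of [S] in [E - y], and only the part of
    [E] within distance [s] of [y] can contain it. *)
Lemma hit_sub_capacity (a : R) (l : law) (K s : R) y E : 0 <= a ->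
  nonneg_law l -> 0 <= K ->
  (forall q r, q \in l -> r \in q.2 -> nrm r <= s) ->
  (forall B, (forall b, b \in B -> nrm b <= s) -> hit l B <= K * capacity a B) ->
  Ex l (fun S => (has (fun r => y + r \in E) S)%:R)
    <= K * capacity a [fset z in E | nrm (z - y) <= s]%fset.
Proof.
move=> a0 l0 K0 ls lK.
set D := [fset z in E | _]%fset.
have <- : capacity a [fset z - y | z in D]%fset = capacity a D.
  apply: (@capacity_isom _ _ a D _ (fun z => z + y)) => // [z|z|u v].
  - by rewrite subrK.
  - by rewrite addrK.
  - by rewrite opprB addrA subrK.
apply: le_trans (lK _ _).
  apply: ler_Ex => // q ql; rewrite ler_nat.
  case: hasP => //= -[r rS yr]; rewrite lt0b; apply/meetsP; exists r => //.
  apply/imfsetP; exists (y + r) => /=; last by rewrite addrC addKr.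
  by rewrite !inE yr /= addrC addKr (ls q).
move=> b /imfsetP[z /= + ->]; by rewrite !inE => /andP[_].
Qed.

(** With [nu] an equilibrium measure of [A] of order [a + al - d], iterated
    potentials of [nu] provide a function [U] such that the maximum of its
    translates by the points of [S] is a dual test function for the capacity of
    [A - S]. Its squared norm is integrated over the level sets of [U]. *)
Lemma Ex_capacity_le (a al : R) : 0 < a < d%:R -> 0 < al < d%:R -> d%:R < a + al ->
  exists2 C : R, 0 < C & forall A (l : law) (K s L : R),
    0 <= K -> 1 <= s -> s <= L ->
    (forall x y, x \in A -> y \in A -> nrm (x - y) <= L) ->
    nonneg_law l -> (forall q r, q \in l -> r \in q.2 -> nrm r <= s) ->
    (forall B, (forall b, b \in B -> nrm b <= s) -> hit l B <= K * capacity al B) ->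
    Ex l (fun S => capacity a (diffset A S))
      <= C * (K * (s `^ al * L `^ (d%:R - al)) * capacity (a + al - d%:R) A).
Proof.
move=> ha hal; have /andP[a0 ad] := ha; have /andP[al0 ald] := hal => aal.
set gam := a + al - d%:R; set s1 := (d%:R + a) / 2; set s2 := (d%:R + al) / 2.
set t := (d%:R + gam) / 2.
have gam0 : 0 < gam by rewrite /gam; lra.
have s10 : 0 <= s1 by rewrite /s1; have := ler0n R d; lra.
have s20 : 0 <= s2 by rewrite /s2; have := ler0n R d; lra.
have t0 : 0 <= t by rewrite /t; have := ler0n R d; lra.
have s12 : s1 + s2 - d%:R = t by rewrite /s1 /s2 /t /gam; field.
have tt : t + t - d%:R = gam by rewrite /t; field.
have [c1 c10 hc1] := @conv_lower R d s1 s2 s10 s20; rewrite s12 in hc1.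
have [c2 c20 hc2] := @conv_lower R d t t t0 t0; rewrite tt in hc2.
have [||C1 C10 hC1] := @sum_pot_sqr_le R d t; rewrite /t ?/gam; [lra|lra|].
rewrite -/gam -/t tt in hC1.
have [C3 C30 hC3] := @capacity_le_dual R d a ha; rewrite -/s1 in hC3.
have [C4 C40 hC4] := @capacity_average R d al hal.
have [C5 C50 hC5] := @capacity_strong_type R d al hal; rewrite -/s2 in hC5.
set D : R := d.+1%:R.
have D1 : 1 <= D by rewrite ler1n.
pose cY := D * (D + 2) + 2.
have cY1 : 1 <= cY by rewrite /cY; nra.
pose cL := cY + cY + 1.
have cL1 : 1 <= cL by rewrite /cL; lra.
pose CC := C3 / (c1 * c2 / 2) ^+ 2 * (4 * (C4 * cL `^ (d%:R - al)) * (C5 * (C1 * 2))).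
have CC0 : 0 < CC.
  rewrite /CC; do !(rewrite ?mulr_gt0 ?invr_gt0 ?exprn_gt0 ?powR_gt0//); lra.
exists CC => // A l K s L K0 s1' sL hL l0 ls lK.
have [A0|A0] := eqVneq A fset0.
  rewrite (eq_Ex (g := fun=> 0)).
    rewrite /Ex big1 => [|q _]; last by rewrite mulr0.
    have L0 : 0 <= L by lra.
    apply: mulr_ge0; first exact: ltW CC0.
    by rewrite mulr_ge0 ?capacity_ge0 ?(ltW gam0)// mulr_ge0// mulr_ge0 ?powR_ge0.
  move=> q _; rewrite -(capacity_fset0 _ : capacity a (fset0 : {fset V}) = 0); congr capacity.
  apply/eqP/fset0Pn => -[x /diffsetP[u [r [+ _ _]]]].
  by rewrite A0 inE.
have [nu [nup nuE nuP]] := equilibrium_lower (ltW gam0) A0.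
have I0 := min_energy_gt0 (ltW gam0) A0.
set I := min_energy gam A in nuE nuP I0.
case: (nup) => nu0 nu1.
have /fset0Pn[a0' a0A] := A0.
have L0 : 0 < L by lra.
(* The three balls are large enough for [conv_lower] to apply in turn to the
   two compositions that lead from nu to U. *)
pose W := ball a0' ((D + 1) * L).
pose f w := pot t A nu w.
have f0 w : 0 <= f w by exact: pot_ge0.
pose U z := pot s2 W f z.
pose Y := ball a0' (cY * L).
pose Z := ball a0' ((cY + 1) * L).
have lower x r : x \in A -> nrm r <= s -> c1 * c2 / 2 * I <= \sum_(y <- Y) ker s1 (x - r - y) * U (y + r).
  move=> xA rs.
  have st1 : c1 * \sum_(w <- W) ker t (x - w) * f w <= \sum_(y <- Y) ker s1 (x - r - y) * U (y + r).
    rewrite /U /pot; under [leRHS]eq_bigr do rewrite mulr_sumr.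
    rewrite exchange_big/= mulr_sumr; apply: ler_sum_seq => w wW.
    have -> : \sum_(y <- Y) ker s1 (x - r - y) * (f w * ker s2 (y + r - w)) =
      f w * \sum_(z <- [fset (y + r)%R | y in Y]%fset) ker s1 (x - z) * ker s2 (z - w).
      have inj : {in Y &, injective (fun y => y + r)} by move=> u v _ _ /= e; exact: (addIr r e).
      rewrite [X in _ = _ * X]big_imfset/=; last exact: inj.
      rewrite mulr_sumr; apply: eq_bigr => y _.
      by rewrite mulrCA opprD addrA addrAC.
    rewrite mulrA [leRHS]mulrC ler_wpM2r//.
    apply: hc1 => z hz; apply/imfsetP; exists (z - r); last by rewrite subrK.
    rewrite /= in_ball; move: wW hz; rewrite in_ball => wW hz.
    have h1 := @ler_nrmB R _ (z - r) z a0'; have h2 := @ler_nrmB R _ z x a0'.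
    have h3 := hL _ _ xA a0A; have h4 := @ler_nrmB R _ x a0' w.
    have h5 : nrm (z - r - z) = nrm r by rewrite addrAC subrr sub0r nrmN.
    rewrite (nrmB a0' w) in h4; rewrite h5 in h1.
    have h6 : D * nrm (x - w) <= D * (L + (D + 1) * L).
      by rewrite ler_wpM2l ?(le_trans _ D1)//; move: h3 h4 wW; move: (nrm _) (nrm _) (nrm _) => *; lra.
    move: h1 h2 h3 h6 hz rs; rewrite /cY -/D.
    move: (nrm _) (nrm _) (nrm _) (nrm _) (nrm _) (D * nrm _) => *; lra.
  apply: le_trans st1; rewrite -!mulrA ler_wpM2l ?(ltW c10)//.
  have st2 : c2 * pot gam A nu x <= \sum_(w <- W) ker t (x - w) * f w.
    rewrite /f /pot; under [leRHS]eq_bigr do rewrite mulr_sumr.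
    rewrite exchange_big/= mulr_sumr; apply: ler_sum_seq => y yA.
    have -> : \sum_(w <- W) ker t (x - w) * (nu y * ker t (w - y)) =
       nu y * \sum_(w <- W) ker t (x - w) * ker t (w - y).
      by rewrite mulr_sumr; apply: eq_bigr => w _; ring.
    rewrite mulrCA ler_wpM2l ?nu0//; apply: hc2 => z hz; rewrite in_ball.
    have h2 := @ler_nrmB R _ z x a0'; have h3 := hL _ _ xA a0A; have h4 := hL _ _ xA yA.
    have h5 : D * nrm (x - y) <= D * L by rewrite ler_wpM2l ?(le_trans _ D1).
    move: h2 h3 h5 hz; rewrite -/D.
    move: (nrm _) (nrm _) (nrm _) (D * nrm _) => *; lra.
  apply: le_trans st2; rewrite ler_wpM2l ?(ltW c20)//.
  by rewrite mulrC; exact: nuP.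
have U0 z : z \in Z -> 0 < U z.
  move=> _.
  have a0W : a0' \in W by rewrite in_ball subrr nrm0; nra.
  rewrite /U /pot (big_fsetD1 a0')//= ltr_pwDl//.
    rewrite mulr_gt0 ?ker_gt0// /f.
    apply: (@lt_le_trans _ _ (\sum_(y <- A) nu y * L `^ (- t))).
      by rewrite -mulr_suml nu1 mul1r powR_gt0.
    by apply: ler_sum_seq => y yA; rewrite ler_wpM2l ?nu0// ker_ge// hL.
  by apply: sumr_ge0 => y _; rewrite mulr_ge0 ?ker_ge0.
have [tau tau0 htau] := exists_lb U0.
have [n hn] : exists n : nat, forall z, z \in Z -> U z < tau * 2 ^+ n.
  have sum0 : 0 <= \sum_(z <- Z) U z / tau.
    by rewrite big_seq; apply: sumr_ge0 => z zZ; rewrite divr_ge0 ?(ltW tau0)// ltW// U0.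
  exists (Num.truncn (\sum_(z <- Z) U z / tau)).+1 => z zZ.
  rewrite mulrC -ltr_pdivrMr//.
  have : U z / tau <= \sum_(z <- Z) U z / tau.
    rewrite (big_fsetD1 z)//= lerDl big_seq; apply: sumr_ge0 => y; rewrite !inE => /andP[_ yZ].
    rewrite divr_ge0 ?(ltW tau0)// ltW// U0//.
  move=> /le_lt_trans; apply; have /andP[_ h] := truncn_itv sum0; apply: lt_trans h _.
  by rewrite -natrX ltr_nat ltn_expl.
pose T j : R := tau * 2 ^+ j.
have T0 j : 0 <= T j by rewrite mulr_ge0 ?exprn_ge0// ltW.
have T4 j : 0 <= 4 * T j ^+ 2 by apply: mulr_ge0 => //; exact: exprn_ge0.
pose E j := [fset z in Z | (tau * 2 ^+ j <= U z)%R]%fset.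
(* The dual test function for A - S. *)
pose g S y := \big[Num.max/0]_(r <- S) U (y + r).
have YZ y r : y \in Y -> nrm r <= s -> y + r \in Z.
  rewrite !in_ball => yY rs.
  have := @ler_nrmD R _ (y - a0') r; rewrite addrAC => h.
  move: h yY rs; move: (nrm _) (nrm _) (nrm _) => *; lra.
have g0 S y : 0 <= g S y by apply: bigmax_ge_id.
have g_ge S y r : r \in S -> U (y + r) <= g S y 
  by move=> rS; exact: (@le_bigmax_seq _ R _ S 0 r xpredT (fun r => U (y + r)) rS isT).
(* A value of g lies between two consecutive levels, and the lower one is reached
   by some translate. *)
have g_sqr S y : (forall r, r \in S -> nrm r <= s) -> y \in Y -> g S y ^+ 2 <=
    \sum_(j < n) 4 * T j ^+ 2 * (has (fun r => y + r \in E j) S)%:R.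
  move=> Ss yY; set X := \sum_(j < n) _.
  have X0 : 0 <= X by apply: sumr_ge0 => j _; apply: mulr_ge0 (T4 j) (ler0n _ _).
  rewrite -[X]sqr_sqrtr// ler_sqr ?nnegrE ?sqrtr_ge0//.
  rewrite /g big_seq; apply: bigmax_le => [|r rS]; first exact: sqrtr_ge0.
  have yrZ := YZ y r yY (Ss r rS).
  rewrite -[leLHS]ger0_norm ?(ltW (U0 _ yrZ))// -sqrtr_sqr ler_wsqrtr//.
  have [|j /andP[j1 j2]] := @pow2_floor R (U (y + r) / tau).
    by rewrite ler_pdivlMr// mul1r htau.
  rewrite ler_pdivlMr// mulrC in j1; rewrite ltr_pdivrMr// mulrC in j2.
  have jn : (j < n)%N.
    have := le_lt_trans j1 (hn _ yrZ); rewrite ltr_pM2l//.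
    by rewrite ltr_eXn2l ?ltr1n.
  rewrite /X (bigD1 (Ordinal jn))//=.
  have -> : has (fun r0 : V => y + r0 \in E j) S.
    by apply/hasP; exists r => //; rewrite !inE yrZ.
  rewrite mulr1; apply: (@le_trans _ _ (4 * T j ^+ 2)); last first.
    rewrite lerDl; apply: sumr_ge0 => i _; exact: mulr_ge0 (T4 i) (ler0n _ _).
  have -> : 4 * T j ^+ 2 = (tau * 2 ^+ j.+1) ^+ 2 by rewrite /T [2 ^+ j.+1]exprS; ring.
  by rewrite lerXn2r ?nnegrE ?(ltW (U0 _ yrZ)) ?(ltW j2)// ltW// (lt_trans (U0 _ yrZ)).
pose kap := c1 * c2 / 2 * I.
have kap0 : 0 < kap by rewrite /kap !mulr_gt0.
have cap_g q : q \in l -> capacity a (diffset A q.2) <= C3 / kap ^+ 2 * \sum_(y <- Y) g q.2 y ^+ 2.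
  move=> ql; apply: hC3 => // b /diffsetP[x [r [xA rS ->]]].
  apply: le_trans (lower x r xA (ls _ _ ql rS)) _.
  by apply: ler_sum_seq => y _; rewrite mulrC ler_wpM2r ?ker_ge0// g_ge.
apply: le_trans (ler_Ex (g := fun S => C3 / kap ^+ 2 * \sum_(y <- Y) g S y ^+ 2) l0 cap_g) _.
rewrite ExZ.
have sumg : Ex l (fun S => \sum_(y <- Y) g S y ^+ 2) <=
   4 * (C4 * cL `^ (d%:R - al)) * (C5 * (C1 * 2)) * (K * (s `^ al * L `^ (d%:R - al)) * I).
  apply: (@le_trans _ _ (Ex l (fun S => \sum_(y <- Y) \sum_(j < n) 4 * T j ^+ 2 * (has (fun r => y + r \in E j) S)%:R))).
    apply: ler_Ex => // q ql; apply: ler_sum_seq => y yY; apply: g_sqr => // r rq.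
    exact: ls ql rq.
  rewrite Ex_sum; under eq_bigr => y _ do rewrite Ex_sum.
  rewrite exchange_big/=.
  apply: (@le_trans _ _ (\sum_(j < n) 4 * T j ^+ 2 * (K * (C4 * (s `^ al * (cL * L) `^ (d%:R - al)) * capacity al (E j))))).
    apply: ler_sum => j _; under eq_bigr => y _ do rewrite ExZ.
    rewrite -mulr_sumr; apply: ler_wpM2l; first exact: T4.
    apply: (@le_trans _ _ (\sum_(y <- Y) K * capacity al [fset z in E j | nrm (z - y) <= s]%fset)).
      by apply: ler_sum => y _; apply: hit_sub_capacity => //; exact: ltW.
    rewrite -mulr_sumr ler_wpM2l//; apply: hC4 => //.
      by apply: le_trans sL _; rewrite -[leLHS]mul1r ler_wpM2r// ltW.
    move=> b y; rewrite !inE !in_ball => /andP[bZ _] yY.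
    have := @ler_nrmB R _ b a0' y; rewrite (nrmB a0' y) /cL.
    move: bZ yY; move: (nrm _) (nrm _) (nrm _) => *; lra.
  have -> : \sum_(j < n) 4 * T j ^+ 2 * (K * (C4 * (s `^ al * (cL * L) `^ (d%:R - al)) * capacity al (E j))) =
     4 * K * C4 * s `^ al * (cL * L) `^ (d%:R - al) * \sum_(j < n) T j ^+ 2 * capacity al (E j).
    by rewrite mulr_sumr; apply: eq_bigr => j _; ring.
  have h1 := hC5 W f Z n tau tau0.
  have h2 : \sum_(w <- W) f w ^+ 2 <= C1 * (2 * I).
    apply: le_trans (hC1 W A nu nu0) _; by rewrite ler_wpM2l// ltW.
  rewrite powRM ?(le_trans _ cL1) ?(ltW L0)//.
  apply: (@le_trans _ _ (4 * K * C4 * s `^ al * (cL `^ (d%:R - al) * L `^ (d%:R - al)) * (C5 * (C1 * (2 * I))))).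
    rewrite ler_wpM2l//; last by apply: le_trans h1 _; rewrite ler_wpM2l// ltW.
    by rewrite !mulr_ge0 ?powR_ge0// ltW.
  by apply: eq_ler; ring.
apply: (@le_trans _ _ (C3 / kap ^+ 2 * (4 * (C4 * cL `^ (d%:R - al)) * (C5 * (C1 * 2)) * (K * (s `^ al * L `^ (d%:R - al)) * I)))).
  by rewrite ler_wpM2l// divr_ge0 ?exprn_ge0 ?(ltW C30)// ltW.
rewrite capacityE -/I /CC /kap; apply: eq_ler; field.
by rewrite !gt_eqF.
Qed.
End Law.

(** * Percolation on dyadic cubes *)

Section Percolation.
Context {R : realType} {d : nat}.
Local Notation V := 'rV[int]_d.
Local Notation nrm := (@nrm R d).
Local Notation ker := (@ker R d).
Local Notation law := (@law R d).
Implicit Types (x y z w : V) (A B E W Q Y Z S : {fset V}) (l : law).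

Definition lunion l1 l2 : law := [seq (u.1 * v.1, (u.2 `|` v.2)%fset) | u <- l1, v <- l2].

(** Law of a random set which is erased with probability [1 - p]. *)
Definition thin (p : R) l : law := (1 - p, fset0) :: [seq (p * u.1, u.2) | u <- l].

Lemma Ex_lunion l1 l2 f :
  Ex (lunion l1 l2) f = Ex l1 (fun S => Ex l2 (fun S' => f (S `|` S')%fset)).
Proof.
rewrite /Ex /lunion big_allpairs_dep; apply: eq_bigr => u _; rewrite mulr_sumr.
by apply: eq_bigr => v _ /=; rewrite mulrA.
Qed.

Lemma Ex_thin p l f : Ex (thin p l) f = (1 - p) * f fset0 + p * Ex l f.
Proof.
rewrite /Ex big_cons big_map mulr_sumr; congr (_ + _).
by apply: eq_bigr => u _; rewrite mulrA.
Qed.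

Definition prob2 l y z : R := Ex l (fun S => ((y \in S) && (z \in S))%:R).

(** Invariants of dyadic percolation. The last one, hitting probability times
    energy, compares hitting probabilities with the capacity for the kernel which
    is the two-point function of the random set itself; in this form it survives
    both thinning and independent unions with the same constant 2. *)
Record percolating l Q (k : R) : Prop := Percolating {
  percolating_nonneg : nonneg_law l;
  percolating_mass : Ex l (fun=> 1) = 1;
  percolating_sub : forall q y, q \in l -> y \in q.2 -> y \in Q;
  percolating_one : forall y, y \in Q -> prob2 l y y = k;
  percolating_two : forall y z, y \in Q -> z \in Q -> k ^+ 2 <= prob2 l y z;
  percolating_hit : forall B, B != fset0 -> {subset B <= Q} ->
    exists2 mu, prob_on B mu &
    hit l B * (\sum_(y <- B) \sum_(z <- B) mu y * mu z * prob2 l y z) <= 2 * k ^+ 2 }.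

Lemma Ex_cst l (k : R) : Ex l (fun=> 1) = 1 -> Ex l (fun=> k) = k.
Proof. by move=> h; have := ExZ l k (fun=> 1); rewrite mulr1 h mulr1. Qed.

Lemma prob2_ge0 l y z : nonneg_law l -> 0 <= prob2 l y z.
Proof. by move=> l0; apply: Ex_ge0. Qed.

Lemma hit_le1 l B : nonneg_law l -> Ex l (fun=> 1) = 1 -> hit l B <= 1.
Proof. by move=> l0 <-; apply: ler_Ex => // q _; rewrite lern1 leq_b1. Qed.

Lemma percolating_full Q : percolating [:: (1, Q)] Q 1.
Proof.
have ExE f : Ex [:: (1, Q)] f = f Q by rewrite /Ex big_seq1 mul1r.
have P2E y z : y \in Q -> z \in Q -> prob2 [:: (1, Q)] y z = 1.
  by move=> yQ zQ; rewrite /prob2 ExE yQ zQ.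
split; rewrite ?ExE//.
- by move=> q; rewrite inE => /eqP ->.
- by move=> q y; rewrite inE => /eqP ->.
- by move=> y yQ; rewrite P2E.
- by move=> y z yQ zQ; rewrite P2E// expr1n.
move=> B /fset0Pn[x xB] BQ; exists (fun y => (y == x)%:R); first exact: prob_on_dirac.
have [_ m1] : prob_on B (fun y => (y == x)%:R : R) by exact: prob_on_dirac.
rewrite (eq_big_seq (fun y => (y == x)%:R)) => [|y yB].
  rewrite m1 mulr1 expr1n mulr1; apply: le_trans (hit_le1 _ _ _) _; rewrite ?ExE//.
    by move=> q; rewrite inE => /eqP ->.
  by rewrite ler1n.
transitivity (\sum_(z <- B) (y == x)%:R * ((z == x)%:R : R)).
  by apply: eq_big_seq => z zB; rewrite P2E ?mulr1//; exact: BQ.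
by rewrite -mulr_sumr m1 mulr1.
Qed.

Lemma percolating_thin p l Q k : 0 <= p <= 1 -> percolating l Q k -> percolating (thin p l) Q (p * k).
Proof.
move=> /andP[p0 p1] [l0 l1 ls lo lt lh].
have P2E y z : prob2 (thin p l) y z = p * prob2 l y z.
  by rewrite /prob2 Ex_thin inE mulr0 add0r.
split.
- move=> q; rewrite inE => /orP[/eqP->|/mapP[u ul ->]] /=; first by rewrite subr_ge0.
  exact: mulr_ge0 p0 (l0 _ ul).
- by rewrite Ex_thin l1 !mulr1 subrK.
- move=> q y; rewrite inE => /orP[/eqP->|/mapP[u ul ->]] /=; first by rewrite inE.
  exact: ls.
- by move=> y yQ; rewrite P2E lo.
- move=> y z yQ zQ; rewrite P2E exprMn ler_pM ?sqr_ge0//; last exact: lt.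
  by rewrite expr2 ler_piMr.
move=> B B0 BQ; have [mu mup h] := lh B B0 BQ; exists mu => //.
have -> : hit (thin p l) B = p * hit l B.
  by rewrite /hit Ex_thin /meets fset0I eqxx mulr0 add0r.
under eq_bigr => y _ do under eq_bigr => z _ do rewrite P2E mulrCA.
under eq_bigr => y _ do rewrite -mulr_sumr.
rewrite -mulr_sumr exprMn.
have -> : 2 * (p ^+ 2 * k ^+ 2) = p ^+ 2 * (2 * k ^+ 2) by ring.
set E := \sum_(y <- B) _ in h *.
have -> : p * hit l B * (p * E) = p ^+ 2 * (hit l B * E) by ring.
by rewrite ler_wpM2l ?sqr_ge0.
Qed.

(** Conductances in parallel: [t] minimizes [t ^ 2 * r + (1 - t) ^ 2 * s], with
    minimum [r * s / (r + s)], and the bound [2 / (1 + resistance)] on the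
    probabilities of two independent events passes to their union. *)
Lemma parallel_bound (u v r s : R) : 0 <= u <= 1 -> 0 <= v <= 1 -> 0 <= r -> 0 <= s ->
  u * (1 + r) <= 2 -> v * (1 + s) <= 2 ->
  exists2 t : R, 0 <= t <= 1 &
    (u + v - u * v) * (1 + t ^+ 2 * r + (1 - t) ^+ 2 * s) <= 2.
Proof.
move=> /andP[u0 u1] /andP[v0 v1] r0 s0 hu hv.
have [rs|rs] := eqVneq (r + s) 0.
  have -> : r = 0 by lra.
  have -> : s = 0 by lra.
  exists 0; rewrite ?lexx ?ler01// !mulr0 !addr0 mulr1; nra.
have rsp : 0 < r + s by rewrite lt_def rs addr_ge0.
have h1 : u + v - u * v <= 1 by nra.
have h0 : 0 <= u + v - u * v by nra.
exists (s / (r + s)).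
  by rewrite divr_ge0 ?(ltW rsp)//= ler_pdivrMr// mul1r lerDr.
have -> : 1 + (s / (r + s)) ^+ 2 * r + (1 - s / (r + s)) ^+ 2 * s = 1 + r * s / (r + s).
  by field.
have [small|big] := leP (r * s) (r + s).
  have : r * s / (r + s) <= 1 by rewrite ler_pdivrMr// mul1r.
  have : 0 <= r * s / (r + s) by rewrite divr_ge0 ?mulr_ge0// ltW.
  move: (r * s / _) => X X0 X1; nra.
have r1 : 1 < r by nra.
have s1 : 1 < s by nra.
rewrite -{1}[1](@divff _ (r + s)) ?gt_eqF// -mulrDl mulrA ler_pdivrMr//.
have hu' : r - 1 <= (1 - u) * (r + 1) by lra.
have hv' : s - 1 <= (1 - v) * (s + 1) by lra.
have huv : (r - 1) * (s - 1) <= ((1 - u) * (r + 1)) * ((1 - v) * (s + 1)).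
  by rewrite ler_pM// subr_ge0 ltW.
set w := (1 - u) * (1 - v).
have wE : u + v - u * v = 1 - w by rewrite /w; ring.
have hw : (r - 1) * (s - 1) <= w * ((r + 1) * (s + 1)).
  by apply: le_trans huv _; rewrite /w; apply: eq_ler; ring.
have w0 : 0 <= w by rewrite /w mulr_ge0 ?subr_ge0.
have w1 : w <= 1 by rewrite -subr_ge0 -wE.
rewrite wE; nra.
Qed.

Lemma prob2C l y z : prob2 l y z = prob2 l z y.
Proof. by apply: eq_Ex => q _; rewrite andbC. Qed.

(** The hitting probability of the union is [u + v - u * v], and a convex
    combination of the two measures is tested, with the weight of
    [parallel_bound]; the cross terms contribute [k ^ 2] because the two sets are
    independent. *)
Lemma percolating_union l1 l2 Q1 Q2 k : 0 < k -> percolating l1 Q1 k -> percolating l2 Q2 k ->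
  (forall y, y \in Q1 -> y \in Q2 -> False) ->
  [/\ percolating (lunion l1 l2) (Q1 `|` Q2)%fset k,
    forall y z, y \in Q1 -> z \in Q1 -> prob2 (lunion l1 l2) y z = prob2 l1 y z,
    forall y z, y \in Q2 -> z \in Q2 -> prob2 (lunion l1 l2) y z = prob2 l2 y z &
    forall y z, y \in Q1 -> z \in Q2 -> prob2 (lunion l1 l2) y z = k ^+ 2].
Proof.
move=> k0 g1 g2 dis.
case: (g1) => l10 l11 ls1 lo1 lt1 lh1; case: (g2) => l20 l21 ls2 lo2 lt2 lh2.
have n1 q y : q \in l1 -> y \in Q2 -> y \notin q.2.
  by move=> ql yQ; apply/negP => /(ls1 _ _ ql) y1; exact: dis yQ.
have n2 q y : q \in l2 -> y \in Q1 -> y \notin q.2.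
  by move=> ql yQ; apply/negP => /(ls2 _ _ ql) y1; exact: dis y1.
have P11 y z : y \in Q1 -> z \in Q1 -> prob2 (lunion l1 l2) y z = prob2 l1 y z.
  move=> yQ zQ; rewrite /prob2 Ex_lunion; apply: eq_Ex => q ql.
  rewrite -[RHS](Ex_cst _ l21); apply: eq_Ex => r rl.
  by rewrite !inE (negPf (n2 _ _ rl yQ)) (negPf (n2 _ _ rl zQ)) !orbF.
have P22 y z : y \in Q2 -> z \in Q2 -> prob2 (lunion l1 l2) y z = prob2 l2 y z.
  move=> yQ zQ; rewrite /prob2 Ex_lunion.
  rewrite -[RHS](Ex_cst _ l11); apply: eq_Ex => q ql.
  apply: eq_Ex => r rl.
  by rewrite !inE (negPf (n1 _ _ ql yQ)) (negPf (n1 _ _ ql zQ)).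
have P12 y z : y \in Q1 -> z \in Q2 -> prob2 (lunion l1 l2) y z = k ^+ 2.
  move=> yQ zQ; rewrite /prob2 Ex_lunion.
  rewrite (eq_Ex (g := fun S => k * ((y \in S) && (y \in S))%:R)).
    by rewrite ExZ -/(prob2 l1 y y) lo1// expr2.
  move=> q ql; rewrite andbb -(lo2 z zQ) mulrC -ExZ; apply: eq_Ex => r rl.
  rewrite !inE (negPf (n2 _ _ rl yQ)) (negPf (n1 _ _ ql zQ)) orbF/= andbb.
  by rewrite -natrM mulnb.
split => //; split.
- move=> q /allpairsP[[u v] /= [ul vl ->]] /=; exact: mulr_ge0 (l10 _ ul) (l20 _ vl).
- by rewrite Ex_lunion (eq_Ex (g := fun=> 1))// => q _; rewrite l21.
- move=> q y /allpairsP[[u v] /= [ul vl ->]] /=; rewrite !inE => /orP[/(ls1 _ _ ul)->//|/(ls2 _ _ vl)->].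
  by rewrite orbT.
- by move=> y; rewrite inE => /orP[yQ|yQ]; [rewrite P11// lo1|rewrite P22// lo2].
- move=> y z; rewrite !inE => /orP[yQ|yQ] /orP[zQ|zQ].
  + by rewrite P11// lt1.
  + by rewrite P12.
  + by rewrite prob2C P12.
  + by rewrite P22// lt2.
move=> B B0 BQ.
pose B1 := [fset y in B | y \in Q1]%fset; pose B2 := [fset y in B | ~~ (y \in Q1)]%fset.
have B1B y : y \in B1 -> (y \in B) /\ (y \in Q1) by rewrite !inE => /andP[].
have B2B y : y \in B2 -> (y \in B) /\ (y \in Q2).
  rewrite !inE => /andP[yB yQ]; split => //; have := BQ y yB; rewrite inE (negPf yQ).
  by [].
have sumB (F : V -> R) : \sum_(y <- B) F y = \sum_(y <- B1) F y + \sum_(y <- B2) F y.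
  by rewrite (big_fsetID _ (fun y => y \in Q1)).
have hitE : hit (lunion l1 l2) B = hit l1 B1 + hit l2 B2 - hit l1 B1 * hit l2 B2.
  rewrite /hit Ex_lunion.
  have m1 q : q \in l1 -> meets q.2 B = meets q.2 B1.
    move=> ql; apply/meetsP/meetsP => -[x xq xB]; exists x => //; last by case: (B1B _ xB).
    by rewrite !inE xB (ls1 _ _ ql xq).
  have m2 q : q \in l2 -> meets q.2 B = meets q.2 B2.
    move=> ql; apply/meetsP/meetsP => -[x xq xB]; exists x => //; last by case: (B2B _ xB).
    rewrite !inE xB /=; apply/negP => xQ1; exact: dis xQ1 (ls2 _ _ ql xq).
  have mU S S' : meets (S `|` S')%fset B = meets S B || meets S' B.
    apply/meetsP/orP => [[x]|[/meetsP|/meetsP]].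
    - by rewrite inE => /orP[xS|xS] xB; [left|right]; apply/meetsP; exists x.
    - by move=> [x xS xB]; exists x; rewrite ?inE ?xS.
    - by move=> [x xS xB]; exists x; rewrite ?inE ?xS ?orbT.
  have inner q : q \in l1 -> Ex l2 (fun S' => (meets (q.2 `|` S')%fset B)%:R) =
      hit l2 B2 + (1 - hit l2 B2) * (meets q.2 B1)%:R :> R.
    move=> ql; rewrite (eq_Ex (g := fun S' => (meets q.2 B1 || meets S' B2)%:R)); last first.
      by move=> r rl; rewrite mU m1// m2.
    case: (meets q.2 B1) => /=; first by rewrite mulr1 addrC subrK.
    by rewrite mulr0 addr0.
  rewrite (@eq_Ex _ _ l1 (fun S => Ex l2 (fun S' => (meets (S `|` S')%fset B)%:R))
    (fun S => hit l2 B2 + (1 - hit l2 B2) * (meets S B1)%:R) inner).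
  rewrite [LHS]/Ex; under eq_bigr do rewrite mulrDr mulrCA.
  rewrite big_split/= -mulr_sumr -mulr_suml.
  have -> : \sum_(q <- l1) q.1 = 1 by rewrite -l11; apply: eq_bigr => q _; rewrite mulr1.
  rewrite -/(Ex l1 (fun S => (meets S B1)%:R)) -/(hit l1 B1) -/(hit l2 B2); ring.
have hit0 l : hit l fset0 = 0.
  rewrite /hit (eq_Ex (g := fun=> 0 * 1)) ?ExZ ?mul0r// => q _.
  by rewrite /meets fsetI0 eqxx ?mul0r.
have ext C (F G : V -> V -> R) : (forall y z, y \in C -> z \in C -> F y z = G y z) ->
   \sum_(y <- C) \sum_(z <- C) F y z = \sum_(y <- C) \sum_(z <- C) G y z.
  by move=> h; apply: eq_big_seq => y yC; apply: eq_big_seq => z zC; exact: h.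
have [B10|B10] := eqVneq B1 fset0.
  have BB2 : B = B2.
    apply/fsetP => y; apply/idP/idP => [yB|/B2B[]//].
    rewrite !inE yB /=; apply/negP => yQ; have : y \in B1 by rewrite !inE yB.
    by rewrite B10 inE.
  have [|mu mup h] := lh2 B B0; first by rewrite BB2 => y /B2B[].
  exists mu => //; rewrite hitE B10 hit0 add0r mul0r subr0 -BB2.
  by rewrite (ext _ _ (fun y z => mu y * mu z * prob2 l2 y z))// => y z; rewrite BB2 => /B2B[_ yQ] /B2B[_ zQ]; rewrite P22.
have [B20|B20] := eqVneq B2 fset0.
  have BB1 : B = B1.
    apply/fsetP => y; apply/idP/idP => [yB|/B1B[]//].
    rewrite !inE yB /=; apply/negPn/negP => yQ; have : y \in B2 by rewrite !inE yB.
    by rewrite B20 inE.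
  have [|mu mup h] := lh1 B B0; first by rewrite BB1 => y /B1B[].
  exists mu => //; rewrite hitE B20 hit0 addr0 mulr0 subr0 -BB1.
  by rewrite (ext _ _ (fun y z => mu y * mu z * prob2 l1 y z))// => y z; rewrite BB1 => /B1B[_ yQ] /B1B[_ zQ]; rewrite P11.
have [|mu [mu0 mu1] h1] := lh1 B1 B10; first by move=> y /B1B[].
have [|nu [nu0 nu1] h2] := lh2 B2 B20; first by move=> y /B2B[].
set E1 := \sum_(y <- B1) _ in h1; set E2 := \sum_(y <- B2) _ in h2.
have k20 : 0 < k ^+ 2 by rewrite exprn_gt0.
have massge (C : {fset V}) (m : V -> R) (l : law) : (forall x, x \in C -> 0 <= m x) -> \sum_(x <- C) m x = 1 ->
    (forall y z, y \in C -> z \in C -> k ^+ 2 <= prob2 l y z) ->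
    k ^+ 2 <= \sum_(y <- C) \sum_(z <- C) m y * m z * prob2 l y z.
  move=> m0 m1 hk; rewrite -[k ^+ 2]mul1r -m1 mulr_suml.
  apply: ler_sum_seq => y yC; rewrite -[m y * _]mul1r -{1}m1 mulr_suml.
  apply: ler_sum_seq => z zC.
  have -> : m z * (m y * k ^+ 2) = m y * m z * k ^+ 2 by ring.
  by rewrite ler_wpM2l ?mulr_ge0 ?m0 ?hk.
have E1k : k ^+ 2 <= E1.
  by apply: massge => // y z /B1B[_ yQ] /B1B[_ zQ]; exact: lt1.
have E2k : k ^+ 2 <= E2.
  by apply: massge => // y z /B2B[_ yQ] /B2B[_ zQ]; exact: lt2.
(* Dividing the two-point functions by [k ^ 2] and subtracting one gives the
   resistances of [parallel_bound]. *)
have [|||||| t /andP[t0 t1] ht] := @parallel_bound (hit l1 B1) (hit l2 B2) (E1 / k ^+ 2 - 1) (E2 / k ^+ 2 - 1).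
- by rewrite hit_ge0// hit_le1.
- by rewrite hit_ge0// hit_le1.
- by rewrite subr_ge0 ler_pdivlMr// mul1r.
- by rewrite subr_ge0 ler_pdivlMr// mul1r.
- by rewrite addrC subrK mulrA ler_pdivrMr.
- by rewrite addrC subrK mulrA ler_pdivrMr.
pose m y := if y \in Q1 then t * mu y else (1 - t) * nu y.
have mB1 y : y \in B1 -> m y = t * mu y by move=> /B1B[_ yQ]; rewrite /m yQ.
have mB2 y : y \in B2 -> m y = (1 - t) * nu y.
  by rewrite /m !inE => /andP[_ /negPf->].
exists m.
  split; last first.
    by rewrite sumB (eq_big_seq _ mB1) (eq_big_seq _ mB2) -!mulr_sumr mu1 nu1 !mulr1 addrC subrK.
  move=> y yB; rewrite /m; case: ifP => yQ.
    by rewrite mulr_ge0// mu0// !inE yB.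
  by rewrite mulr_ge0 ?subr_ge0// nu0// !inE yB yQ.
have dbl (D D' : {fset V}) (f g : V -> R) (c : R) : \sum_(y <- D) f y = 1 -> \sum_(z <- D') g z = 1 ->
    \sum_(y <- D) \sum_(z <- D') f y * g z * c = c.
  move=> f1 gg1; under eq_bigr do rewrite -mulr_suml -mulr_sumr gg1 mulr1.
  by rewrite -mulr_suml f1 mul1r.
have -> : \sum_(y <- B) \sum_(z <- B) m y * m z * prob2 (lunion l1 l2) y z =
   t ^+ 2 * E1 + (1 - t) ^+ 2 * E2 + 2 * t * (1 - t) * k ^+ 2.
  rewrite sumB; under eq_bigr do rewrite sumB.
  under [X in _ + X]eq_bigr do rewrite sumB.
  rewrite !big_split/=.
  have -> : \sum_(y <- B1) \sum_(z <- B1) m y * m z * prob2 (lunion l1 l2) y z = t ^+ 2 * E1.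
    rewrite /E1 mulr_sumr; apply: eq_big_seq => y yB; rewrite mulr_sumr; apply: eq_big_seq => z zB.
    rewrite !mB1//; case: (B1B _ yB) (B1B _ zB) => _ yQ [_ zQ]; rewrite P11//; ring.
  have -> : \sum_(y <- B2) \sum_(z <- B2) m y * m z * prob2 (lunion l1 l2) y z = (1 - t) ^+ 2 * E2.
    rewrite /E2 mulr_sumr; apply: eq_big_seq => y yB; rewrite mulr_sumr; apply: eq_big_seq => z zB.
    rewrite !mB2//; case: (B2B _ yB) (B2B _ zB) => _ yQ [_ zQ]; rewrite P22//; ring.
  have -> : \sum_(y <- B1) \sum_(z <- B2) m y * m z * prob2 (lunion l1 l2) y z = t * (1 - t) * k ^+ 2.
    rewrite -[RHS](dbl B1 B2 mu nu _ mu1 nu1); apply: eq_big_seq => y yB; apply: eq_big_seq => z zB.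
    rewrite mB1// mB2//; case: (B1B _ yB) (B2B _ zB) => _ yQ [_ zQ]; rewrite P12//; ring.
  have -> : \sum_(y <- B2) \sum_(z <- B1) m y * m z * prob2 (lunion l1 l2) y z = t * (1 - t) * k ^+ 2.
    rewrite -[RHS](dbl B2 B1 nu mu _ nu1 mu1); apply: eq_big_seq => y yB; apply: eq_big_seq => z zB.
    rewrite mB2// mB1//; case: (B2B _ yB) (B1B _ zB) => _ yQ [_ zQ]; rewrite prob2C P12//; ring.
  ring.
rewrite hitE.
have -> : t ^+ 2 * E1 + (1 - t) ^+ 2 * E2 + 2 * t * (1 - t) * k ^+ 2 =
   (1 + t ^+ 2 * (E1 / k ^+ 2 - 1) + (1 - t) ^+ 2 * (E2 / k ^+ 2 - 1)) * k ^+ 2.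
  by field; rewrite gt_eqF.
by rewrite mulrA ler_wpM2r// ltW.
Qed.
End Percolation.

Lemma divz_near (m n N : int) : 0 < N -> `|m - n| <= N -> `|(m %/ N)%Z - (n %/ N)%Z| <= 1.
Proof.
move=> N0; have N1 : N != 0 by rewrite gt_eqF.
have := divz_eq m N; have := divz_eq n N.
have := modz_ge0 m N1; have := modz_ge0 n N1.
have := ltz_mod m N1; have := ltz_mod n N1.
move: (m %/ N)%Z (n %/ N)%Z (m %% N)%Z (n %% N)%Z => q r a b.
nia.
Qed.

Lemma divz_same_near (m n N : int) : 0 < N -> (m %/ N)%Z = (n %/ N)%Z -> `|m - n| < N.
Proof.
move=> N0; have N1 : N != 0 by rewrite gt_eqF.
have := divz_eq m N; have := divz_eq n N.
have := modz_ge0 m N1; have := modz_ge0 n N1.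
have := ltz_mod m N1; have := ltz_mod n N1.
move: (m %/ N)%Z (n %/ N)%Z (m %% N)%Z (n %% N)%Z => q r a b.
move=> ? ? ? ? e1 e2 e; subst; lia.
Qed.

Section Dyadic.
Context {R : realType} {d : nat}.
Local Notation V := 'rV[int]_d.
Local Notation nrm := (@nrm R d).
Local Notation ker := (@ker R d).
Local Notation law := (@law R d).
Implicit Types (x y z w : V) (A B E W Q Y Z S : {fset V}) (l : law).

(** Index of the dyadic cube of side [2 ^ j] containing a point. *)
Definition cell (j : nat) y : V := \row_i divz (y 0 i) (2 ^+ j).

Lemma cell0 y : cell 0 y = y.
Proof. by apply/rowP => i; rewrite mxE expr0 divz1. Qed.

Lemma cell_nested i j y z : (i <= j)%N -> cell i y = cell i z -> cell j y = cell j z.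
Proof.
move=> ij /rowP e; apply/rowP => r; have := e r; rewrite !mxE.
by rewrite -(subnKC ij) exprD !divzMA_ge0 ?exprn_ge0// => ->.
Qed.

Lemma cell_near j y z : (forall r, `|(y - z) 0 r| <= 2 ^+ j) ->
  forall r, `|(cell j y - cell j z) 0 r| <= 1.
Proof.
by move=> h r; have := h r; rewrite !mxE; apply: divz_near; rewrite exprn_gt0.
Qed.

Lemma cell_same_near j y z : cell j y = cell j z -> forall r, `|(y - z) 0 r| <= 2 ^+ j.
Proof.
move=> /rowP e r; have := e r; rewrite !mxE => er; apply: ltW; apply: divz_same_near er.
by rewrite exprn_gt0.
Qed.

(** Union of independent percolating sets over the cells of [Q], added one at
    a time. *)
Lemma percolating_cells (f : V -> V) Q (k : R) (lc : V -> law) : 0 < k ->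
  (forall c, percolating (lc c) [fset y in Q | f y == c]%fset k) ->
  exists2 l, percolating l Q k & forall y z, y \in Q -> z \in Q ->
    prob2 l y z = if f y == f z then prob2 (lc (f y)) y z else k ^+ 2.
Proof.
move=> k0 hlc.
pose QQ (s : seq V) := [fset y in Q | f y \in s]%fset.
have main (s : seq V) : uniq s -> exists2 l, percolating l (QQ s) k &
    forall y z, y \in QQ s -> z \in QQ s ->
    prob2 l y z = if f y == f z then prob2 (lc (f y)) y z else k ^+ 2.
  elim: s => [_|c s IH /= /andP[cs us]].
    have QQ0 y : y \in QQ [::] = false by rewrite !inE andbF.
    have [a1 a2 a3 _ _ _] := @percolating_full R d (QQ [::]).
    exists [:: (1, QQ [::])]; last by move=> y z; rewrite QQ0.
    split=> //.
    - by move=> y; rewrite QQ0.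
    - by move=> y z; rewrite QQ0.
    - by move=> B /fset0Pn[x xB] BQ; have := BQ _ xB; rewrite QQ0.
  have [l gl hl] := IH us.
  have dis y : y \in [fset y in Q | f y == c]%fset -> y \in QQ s -> False.
    by rewrite !inE => /andP[_ /eqP->] /andP[_]; apply/negP.
  have [g1 g2 g3 g4] := percolating_union k0 (hlc c) gl dis.
  have QQE : QQ (c :: s) = ([fset y in Q | f y == c] `|` QQ s)%fset.
    by apply/fsetP => y; rewrite !inE /= -andb_orr.
  exists (lunion (lc c) l); first by rewrite QQE.
  move=> y z; rewrite QQE.
  have inc u : u \in [fset y in Q | f y == c]%fset -> f u = c by rewrite !inE => /andP[_ /eqP].
  have ins u : u \in QQ s -> (f u == c) = false.
    by rewrite !inE => /andP[_ fs]; apply/negP => /eqP e; rewrite e (negPf cs) in fs.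
  move=> /fsetUP[yQ|yQ] /fsetUP[zQ|zQ].
  - by rewrite g2// (inc _ yQ) (inc _ zQ) eqxx.
  - by rewrite g4// (inc _ yQ) eq_sym (ins _ zQ).
  - by rewrite prob2C g4// (inc _ zQ) (ins _ yQ).
  - by rewrite g3// hl.
have [l gl hl] := main _ (undup_uniq [seq f y | y <- Q]).
have QE : QQ (undup [seq f y | y <- Q]) = Q.
  apply/fsetP => y; rewrite !inE /=; apply/andP/idP => [[]//|yQ]; split => //.
  by rewrite mem_undup map_f.
by rewrite QE in gl hl; exists l.
Qed.

(** Independent sets built in the cubes of side [2 ^ j] are each erased with
    probability [1 - p] and united over the cubes. A point has to survive [j]
    erasures, those of the dyadic cubes of sides [2], ..., [2 ^ j] containing it;
    two points whose smallest common cube has side [2 ^ i.+1] share the erasures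
    of the cubes of at least that side, and both survive with probability
    [p ^ (j + i)]. *)
Lemma percolation_levels (p : R) (j : nat) : 0 < p < 1 -> forall Q, exists l,
  [/\ percolating l Q (p ^+ j),
    forall y z i, y \in Q -> z \in Q -> (i <= j)%N -> cell i y = cell i z ->
      p ^+ j * p ^+ i <= prob2 l y z &
    forall y z, y \in Q -> z \in Q -> exists i, [/\ (i <= j)%N,
      prob2 l y z <= p ^+ j * p ^+ i &
      (forall r, `|(y - z) 0 r| <= 2 ^+ i.+1) \/ i = j] ].
Proof.
move=> /andP[p0 p1]; have p01 : 0 <= p <= 1 by rewrite !ltW.
elim: j => [|j IH] Q.
  have P2E y z : y \in Q -> z \in Q -> prob2 [:: (1 : R, Q)] y z = 1.
    by move=> yQ zQ; rewrite /prob2 /Ex big_seq1 yQ zQ mul1r.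
  exists [:: (1, Q)]; split; first exact: percolating_full.
  - by move=> y z i yQ zQ; rewrite leqn0 => /eqP -> _; rewrite P2E// !expr0 mul1r.
  - by move=> y z yQ zQ; exists 0%N; rewrite P2E// !expr0 mul1r; split => //; right.
pose Qc c := [fset y in Q | cell j.+1 y == c]%fset.
have /choice[lj hlj] := fun c => IH (Qc c).
have k0 : 0 < p * p ^+ j by rewrite mulr_gt0 ?exprn_gt0.
have gt c : percolating (thin p (lj c)) (Qc c) (p * p ^+ j).
  by apply: percolating_thin => //; case: (hlj c).
have [l gl hl] := percolating_cells k0 gt.
have thinE c y z : prob2 (thin p (lj c)) y z = p * prob2 (lj c) y z.
  by rewrite /prob2 Ex_thin inE mulr0 add0r.
have inQc y : y \in Q -> y \in Qc (cell j.+1 y) by move=> yQ; rewrite !inE yQ /=.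
exists l; rewrite exprS; split => //.
- move=> y z i yQ zQ ij e; rewrite hl//.
  have e1 := cell_nested ij e; rewrite e1 eqxx thinE -mulrA ler_wpM2l ?(ltW p0)//.
  have yc := inQc y yQ; have zc := inQc z zQ; rewrite e1 in yc.
  case: (hlj (cell j.+1 z)) => g h1 h2.
  have [ij'|] := leqP i j; first exact: h1.
  move=> ji; have -> : i = j.+1 by apply/eqP; rewrite eqn_leq ij ji.
  apply: le_trans (percolating_two g yc zc).
  rewrite expr2 ler_wpM2l ?exprn_ge0 ?(ltW p0)// exprS ler_piMl ?exprn_ge0 ?(ltW p0)//.
  exact: ltW.
- move=> y z yQ zQ; rewrite hl//; case: eqP => e1.
    have yc := inQc y yQ; have zc := inQc z zQ; rewrite e1 in yc.
    case: (hlj (cell j.+1 z)) => g h1 h2; have [i [ij hi hyz]] := h2 y z yc zc.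
    exists i; split; first exact: leqW.
      by rewrite e1 thinE -mulrA ler_wpM2l ?(ltW p0).
    case: hyz => [|ij']; first by left.
    by left => r; rewrite ij'; exact: cell_same_near.
  exists j.+1; split => //; last by right.
  by rewrite expr2 exprS.
Qed.

(** The sum is at most the geometric tail that starts at the first index where [E]
    holds. *)
Lemma geometric_indicator_le (p X : R) (n : nat) (E : pred nat) : 0 < p < 1 -> 0 <= X ->
  (forall i, (i <= n)%N -> E i -> p ^+ i <= X) ->
  \sum_(i < n.+1) p ^+ i * (E i)%:R <= X / (1 - p).
Proof.
move=> /andP[p0 p1] X0; have q0 : 0 < 1 - p by rewrite subr_gt0.
suff main m k : (m + k = n.+1)%N -> (forall i, (i <= n)%N -> E i -> p ^+ i <= X) ->
   \sum_(m <= i < n.+1) p ^+ i * (E i)%:R <= X / (1 - p) /\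
   \sum_(m <= i < n.+1) p ^+ i * (E i)%:R <= p ^+ m / (1 - p).
  by move=> h; have [+ _] := main 0%N n.+1 (add0n _) h; rewrite big_mkord.
elim: k m => [|k IH] m mk h.
  rewrite addn0 in mk; rewrite mk big_geq//; split; rewrite divr_ge0 ?(ltW q0)//.
  by rewrite exprn_ge0// ltW.
have [|h1 h2] := IH m.+1 _ h; first by rewrite addSnnS.
have mn : (m < n.+1)%N by rewrite -mk addnS ltnS leq_addr.
have h3 : p ^+ m + p ^+ m.+1 / (1 - p) = p ^+ m / (1 - p).
  by rewrite exprS; field; rewrite gt_eqF.
have pm : 0 <= p ^+ m by rewrite exprn_ge0// ltW.
have h4 : p ^+ m.+1 / (1 - p) <= p ^+ m / (1 - p).
  by rewrite ler_wpM2r ?invr_ge0 ?(ltW q0)// exprS ler_piMl// ltW.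
rewrite big_ltn//; case Em: (E m); last by rewrite mulr0 add0r; split => //; exact: le_trans h2 h4.
rewrite mulr1; have h5 : p ^+ m + \sum_(m.+1 <= i < n.+1) p ^+ i * (E i)%:R <= p ^+ m / (1 - p).
  by rewrite -h3 lerD2l.
split => //; apply: le_trans h5 _; rewrite ler_wpM2r ?invr_ge0 ?(ltW q0)//.
exact: h.
Qed.

(** With [M c] the mass of the cell [c], the left side is the sum of [M c * M c']
    over neighbouring cells, and [2 * M c * M c' <= M c ^ 2 + M c' ^ 2]. *)
Lemma near_cells_le (f : V -> V) B (mu : V -> R) : (forall y, y \in B -> 0 <= mu y) ->
  \sum_(y <- B) \sum_(z <- B) mu y * mu z * [forall r, `|(f y - f z) 0 r| <= 1]%:R
  <= 3 ^+ d * \sum_(y <- B) \sum_(z <- B) mu y * mu z * (f y == f z)%:R.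
Proof.
move=> mu0.
pose M c := \sum_(y <- B) mu y * (f y == c)%:R.
have M2 (D : {fset V}) : \sum_(c <- D) M c ^+ 2 <= \sum_(y <- B) \sum_(z <- B) mu y * mu z * (f y == f z)%:R.
  have -> : \sum_(c <- D) M c ^+ 2 = \sum_(y <- B) \sum_(z <- B) mu y * mu z * \sum_(c <- D) (f y == c)%:R * (f z == c)%:R.
    rewrite /M; under eq_bigr => c _.
      rewrite expr2 mulr_suml; under eq_bigr => y _ do rewrite mulr_sumr.
      over.
    rewrite exchange_big/=; apply: eq_bigr => y _.
    rewrite exchange_big/=; apply: eq_bigr => z _.
    by rewrite mulr_sumr; apply: eq_bigr => c _; ring.
  apply: ler_sum_seq => y yB; apply: ler_sum_seq => z zB; rewrite ler_wpM2l ?mulr_ge0 ?mu0//.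
  have [yD|yD] := boolP (f y \in D); last first.
    rewrite big1_seq ?ler0n// => c /andP[_ cD]; case: eqP => [e|_]; rewrite ?mul0r//.
    by rewrite e cD in yD.
  rewrite (big_fsetD1 (f y))//= eqxx mul1r eq_sym big1_seq ?addr0// => c.
  by rewrite !inE => /andP[_ /andP[/negPf cy _]]; rewrite eq_sym cy mul0r.
have shift e : \sum_(y <- B) \sum_(z <- B) mu y * mu z * (f z == f y + e)%:R <=
    \sum_(y <- B) \sum_(z <- B) mu y * mu z * (f y == f z)%:R.
  pose D := [fset f y | y in B]%fset.
  have -> : \sum_(y <- B) \sum_(z <- B) mu y * mu z * (f z == f y + e)%:R =
      \sum_(c <- D) M c * M (c + e).
    rewrite /M; under [RHS]eq_bigr => c _.
      rewrite mulr_suml; under eq_bigr => y _ do rewrite mulr_sumr.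
      over.
    rewrite [RHS]exchange_big/=; apply: eq_big_seq => y yB.
    rewrite [RHS]exchange_big/=; apply: eq_bigr => z _.
    rewrite (big_fsetD1 (f y))/=; last by apply/imfsetP; exists y.
    rewrite eqxx mulr1 big1_seq ?addr0 ?mulrA// => c.
    by rewrite !inE => /andP[_ /andP[/negPf cy _]]; rewrite eq_sym cy mulr0 mul0r.
  apply: (@le_trans _ _ (\sum_(c <- D) ((M c ^+ 2) / 2 + (M (c + e) ^+ 2) / 2))).
    apply: ler_sum => c _.
    have : 0 <= (M c - M (c + e)) ^+ 2 by exact: sqr_ge0.
    move: (M c) (M _) => u v; nra.
  rewrite big_split/= -!mulr_suml.
  have := M2 D; have : \sum_(c <- D) M (c + e) ^+ 2 <= \sum_(y <- B) \sum_(z <- B) mu y * mu z * (f y == f z)%:R.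
    apply: le_trans (M2 [fset (c + e)%R | c in D]%fset).
    rewrite [leRHS]big_imfset//= => u v _ _; exact: addIr.
  move: (\sum_(_ <- D) _) (\sum_(_ <- D) _) => u v; lra.
apply: (@le_trans _ _ (\sum_(e <- cube (0 : V) 1) \sum_(y <- B) \sum_(z <- B) mu y * mu z * (f z == f y + e)%:R)).
  rewrite [leRHS]exchange_big/=; apply: ler_sum_seq => y yB.
  rewrite [leRHS]exchange_big/=; apply: ler_sum_seq => z zB.
  rewrite -mulr_sumr ler_wpM2l ?mulr_ge0 ?mu0//.
  case: forallP => /= h; last by apply: sumr_ge0 => e _; exact: ler0n.
  rewrite (big_fsetD1 (f z - f y))/=; last first.
    by rewrite in_cube; apply/forallP => r; rewrite subr0 -opprB mxE normrN.
  rewrite [f y + _]addrC subrK eqxx lerDl; apply: sumr_ge0 => e _; exact: ler0n.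
apply: le_trans (ler_sum _ (fun e _ => shift e)) _.
rewrite big_const_seq count_predT iter_addr_0 card_cube -[leLHS]mulr_natl.
by rewrite natrX.
Qed.

(** With [p = 2 ^ - a], the two-point function of dyadic percolation is
    [p ^ (n + i)] when the smallest common cube has side [2 ^ i.+1], which is at most
    of the order of the kernel. The converse comparison fails for close points
    lying in different large cubes, but holds on average against any weight, by
    [near_cells_le]; that is enough to compare the energies, hence the capacities. *)
Lemma percolation_law (a : R) : 0 < a -> exists2 C : R, 0 < C &
  forall P : {fset V}, exists l : law, exists2 k : R, 0 < k &
  [/\ nonneg_law l,
    forall B, {subset B <= P} -> hit l B <= C * k * capacity a B,
    forall y, y \in P -> prob2 l y y = k &
    forall y z, y \in P -> z \in P -> prob2 l y z <= C * k * ker a (y - z) ].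
Proof.
move=> a0; pose p : R := 2 `^ (- a).
have p0 : 0 < p by rewrite powR_gt0.
have p1 : p < 1 by rewrite powR_lt1 ?ltr1n// oppr_lt0.
have p01 : 0 < p < 1 by rewrite p0.
have q0 : 0 < 1 - p by rewrite subr_gt0.
pose C1 := 2 * (2 `^ a * 3 ^+ d / (1 - p)).
pose C2 := (2 * d.+1%:R) `^ a : R.
have C10 : 0 < C1 by rewrite mulr_gt0// divr_gt0// mulr_gt0 ?powR_gt0 ?exprn_gt0.
have C20 : 0 < C2 by rewrite powR_gt0// mulr_gt0.
exists (C1 + C2); first by rewrite addr_gt0.
move=> P; have [r r1 hr] := @radius_exists R d P.
have [n /andP[_ rn]] := pow2_floor r1.
move: n.+1 rn => {}n rn.
have hP y z : y \in P -> z \in P -> nrm (y - z) <= 2 ^+ n.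
  by move=> yP zP; apply: le_trans (hr _ _ yP zP) (ltW rn).
have [l [gl lowl upl]] := percolation_levels n p01 P.
have pE i : (2 ^+ i : R) `^ (- a) = p ^+ i by rewrite expr_powR.
exists l, (p ^+ n); first by rewrite exprn_gt0.
case: (gl) => l0 l1 ls lo lt lh; split => //; last first.
- move=> y z yP zP; have [i [i_n hi hyz]] := upl y z yP zP; apply: le_trans hi _.
  have -> : (C1 + C2) * p ^+ n * ker a (y - z) = p ^+ n * ((C1 + C2) * ker a (y - z)) by ring.
  rewrite ler_wpM2l ?exprn_ge0 ?(ltW p0)//.
  apply: (@le_trans _ _ (C2 * ker a (y - z))); last first.
    by rewrite ler_wpM2r ?ker_ge0// lerDr ltW.
  have nyz : nrm (y - z) <= 2 * d.+1%:R * 2 ^+ i.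
    have D1 : 1 <= d.+1%:R * 2 ^+ i :> R by rewrite mulr_ege1 ?ler1n// exprn_ege1// ler1n.
    case: hyz => [h|->]; last first.
      apply: le_trans (hP _ _ yP zP) _; rewrite -[leLHS]mul1r ler_wpM2r ?exprn_ge0//.
      by rewrite mulr_ege1// ler1n.
    rewrite nrm_le; apply/andP; split; last first.
      by rewrite -mulrA mulr_ege1// ler1n.
    apply: (@le_trans _ _ (d%:R * 2 ^+ i.+1)).
      apply: enorm_le_coord => s; rewrite -intr_norm.
      have -> : 2 ^+ i.+1 = ((2 ^+ i.+1)%:~R : R) by rewrite rmorphXn.
      by rewrite ler_int.
    rewrite exprS mulrA ler_wpM2r ?exprn_ge0// mulrC ler_wpM2l// ler_nat.
    exact: leqnSn.
  rewrite -pE; have := ker_ge (ltW a0) nyz; rewrite powRM ?exprn_ge0 ?mulr_ge0//.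
  have -> : (2 * d.+1%:R) `^ (- a) = C2^-1 :> R by rewrite powRN.
  move=> h; apply: le_trans (_ : C2 * (C2^-1 * (2 ^+ i) `^ (- a)) <= _).
    by rewrite mulrA divff ?gt_eqF// mul1r.
  by rewrite ler_wpM2l ?(ltW C20).
move=> B BP; have [->|B0] := eqVneq B fset0.
  rewrite capacity_fset0 mulr0 /hit (eq_Ex (g := fun=> 0 * 1)) ?ExZ ?mul0r// => q _.
  by rewrite /meets fsetI0 eqxx ?mul0r.
have [mu mup hmu] := lh B B0 BP; case: (mup) => mu0 mu1.
set G := \sum_(y <- B) _ in hmu.
have kn0 : 0 < p ^+ n by rewrite exprn_gt0.
(* Energy for the kernel against energy for the two-point function: two points at
   distance about [2 ^ j] are in neighbouring cells of side [2 ^ j], and for pairs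
   in a common cell the sum over j is geometric. *)
have En : energy a B mu * p ^+ n <= 2 `^ a * 3 ^+ d / (1 - p) * G.
  have step y z : y \in B -> z \in B -> ker a (y - z) <=
     2 `^ a * \sum_(j < n.+1) p ^+ j * [forall r, `|(cell j y - cell j z) 0 r| <= 1]%:R.
    move=> /BP yP /BP zP.
    have ex : exists j, nrm (y - z) <= 2 ^+ j by exists n; exact: hP.
    have [j jh jmin] := ex_minnP ex.
    have jn : (j <= n)%N by apply: jmin; exact: hP.
    have nearj : [forall r, `|(cell j y - cell j z) 0 r| <= 1].
      apply/forallP => s; apply: cell_near => t.
      have := le_trans (le_trans (enorm_coord _ t) (enorm_nrm _)) jh.
      rewrite -intr_norm; have -> : 2 ^+ j = ((2 ^+ j)%:~R : R) by rewrite rmorphXn.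
      by rewrite ler_int.
    rewrite (bigD1 (Ordinal (jn : (j < n.+1)%N)))//= nearj mulr1 mulrDr.
    apply: ler_wpDr.
      by rewrite mulr_ge0 ?powR_ge0//; apply: sumr_ge0 => i _; rewrite mulr_ge0 ?exprn_ge0 ?(ltW p0)// ler0n.
    case: j jh jmin jn nearj => [|j] jh jmin jn _.
      rewrite expr0 mulr1; apply: le_trans (ker_le1 _ (ltW a0)) _.
      by apply: ltW; rewrite powR_gt1 ?ltr1n.
    have hj : 2 ^+ j <= nrm (y - z).
      by apply: ltW; rewrite ltNge; apply/negP => /jmin; rewrite ltnn.
    apply: le_trans (ker_le (ltW a0) _ hj) _; first by rewrite exprn_gt0.
    rewrite pE exprS mulrA.
    have -> : 2 `^ a * p = 1 :> R by rewrite /p powRN divff// gt_eqF// powR_gt0.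
    by rewrite mul1r.
  have h1 : energy a B mu <= 2 `^ a * \sum_(j < n.+1) p ^+ j *
      (\sum_(y <- B) \sum_(z <- B) mu y * mu z * [forall r, `|(cell j y - cell j z) 0 r| <= 1]%:R).
    have -> : energy a B mu = \sum_(y <- B) \sum_(z <- B) mu y * mu z * ker a (y - z).
      rewrite energyE; apply: eq_bigr => y _; rewrite /pot mulr_sumr.
      by apply: eq_bigr => z _; rewrite mulrA.
    apply: (@le_trans _ _ (\sum_(y <- B) \sum_(z <- B) mu y * mu z * (2 `^ a * \sum_(j < n.+1) p ^+ j * [forall r, `|(cell j y - cell j z) 0 r| <= 1]%:R))).
      apply: ler_sum_seq => y yB; apply: ler_sum_seq => z zB.
      by rewrite ler_wpM2l ?mulr_ge0 ?mu0// step.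
    apply: eq_ler; rewrite mulr_sumr.
    under [RHS]eq_bigr => j _.
      rewrite mulr_sumr mulr_sumr; under eq_bigr => y _ do rewrite mulr_sumr mulr_sumr.
      over.
    rewrite [RHS]exchange_big/=; apply: eq_bigr => y _.
    rewrite [RHS]exchange_big/=; apply: eq_bigr => z _.
    by rewrite !mulr_sumr; apply: eq_bigr => j _; ring.
  have h2 : energy a B mu <= 2 `^ a * (3 ^+ d * \sum_(y <- B) \sum_(z <- B) mu y * mu z *
      \sum_(j < n.+1) p ^+ j * (cell j y == cell j z)%:R).
    apply: le_trans h1 _; rewrite ler_wpM2l ?powR_ge0//.
    apply: (@le_trans _ _ (\sum_(j < n.+1) p ^+ j * (3 ^+ d * \sum_(y <- B) \sum_(z <- B) mu y * mu z * (cell j y == cell j z)%:R))).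
      by apply: ler_sum => j _; rewrite ler_wpM2l ?exprn_ge0 ?(ltW p0)// near_cells_le.
    apply: eq_ler.
    under eq_bigr => j _.
      rewrite mulrCA mulr_sumr; under eq_bigr => y _ do rewrite mulr_sumr.
      over.
    rewrite -mulr_sumr; congr (_ * _).
    rewrite [LHS]exchange_big/=; apply: eq_bigr => y _.
    rewrite [LHS]exchange_big/=; apply: eq_bigr => z _.
    by rewrite !mulr_sumr; apply: eq_bigr => j _; ring.
  apply: (@le_trans _ _ (2 `^ a * (3 ^+ d * \sum_(y <- B) \sum_(z <- B) mu y * mu z *
      \sum_(j < n.+1) p ^+ j * (cell j y == cell j z)%:R) * p ^+ n)).
    by rewrite ler_wpM2r ?(ltW kn0).
  have -> : 2 `^ a * 3 ^+ d / (1 - p) * G = 2 `^ a * (3 ^+ d * ((1 - p)^-1 * G)) by ring.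
  rewrite -!mulrA ler_wpM2l ?powR_ge0// ler_wpM2l ?exprn_ge0// mulr_suml /G mulr_sumr.
  apply: ler_sum_seq => y yB; rewrite mulr_suml mulr_sumr; apply: ler_sum_seq => z zB.
  rewrite -mulrA [leRHS]mulrCA ler_wpM2l ?mulr_ge0 ?mu0//.
  rewrite -ler_pdivlMr//.
  have -> : (1 - p)^-1 * prob2 l y z / p ^+ n = (prob2 l y z / p ^+ n) / (1 - p) by ring.
  apply: (geometric_indicator_le (E := fun j => cell j y == cell j z) p01).
    by rewrite divr_ge0 ?prob2_ge0 ?(ltW kn0).
  move=> i ilen /eqP e; rewrite ler_pdivlMr// mulrC; apply: lowl => //; exact: BP.
have E0 : 0 < energy a B mu.
  by apply: lt_le_trans (min_energy_le a mup); rewrite min_energy_gt0 ?(ltW a0).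
have h3 : hit l B * energy a B mu <= C1 * p ^+ n.
  rewrite -(ler_pM2r kn0) -mulrA.
  apply: (@le_trans _ _ (hit l B * (2 `^ a * 3 ^+ d / (1 - p) * G))).
    by rewrite ler_wpM2l ?hit_ge0.
  have -> : hit l B * (2 `^ a * 3 ^+ d / (1 - p) * G) = 2 `^ a * 3 ^+ d / (1 - p) * (hit l B * G) by ring.
  have -> : C1 * p ^+ n * p ^+ n = 2 `^ a * 3 ^+ d / (1 - p) * (2 * (p ^+ n) ^+ 2) by rewrite /C1; ring.
  by rewrite ler_wpM2l// divr_ge0 ?(ltW q0)// mulr_ge0 ?powR_ge0 ?exprn_ge0.
apply: (@le_trans _ _ (C1 * p ^+ n * (energy a B mu)^-1)).
  by rewrite ler_pdivlMr.
apply: ler_pM.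
- exact: mulr_ge0 (ltW C10) (ltW kn0).
- by rewrite invr_ge0 ltW.
- by apply: ler_wpM2r; [exact: ltW | rewrite lerDl ltW].
- exact: capacity_ge (ltW a0) mup.
Qed.
End Dyadic.

(** * The lower comparison *)

Section OneStepLower.
Context {R : realType} {d : nat}.
Local Notation V := 'rV[int]_d.
Local Notation nrm := (@nrm R d).
Local Notation ker := (@ker R d).
Local Notation law := (@law R d).
Implicit Types (x y z w : V) (A B E W Q Y Z S : {fset V}) (l : law).

Lemma Ex_exchange l l' (f : {fset V} -> {fset V} -> R) :
  Ex l (fun S => Ex l' (f S)) = Ex l' (fun S' => Ex l (fun S => f S S')).
Proof.
rewrite /Ex; under eq_bigr do rewrite mulr_sumr.
rewrite exchange_big/=; apply: eq_bigr => q _; rewrite mulr_sumr.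
by apply: eq_bigr => r _; rewrite mulrCA.
Qed.

Lemma ExD l f g : Ex l (fun S => f S + g S) = Ex l f + Ex l g.
Proof. by rewrite /Ex -big_split; apply: eq_bigr => q _; rewrite mulrDr. Qed.

Lemma ExN l f : Ex l (fun S => - f S) = - Ex l f.
Proof. by rewrite /Ex -sumrN; apply: eq_bigr => q _; rewrite mulrN. Qed.

Lemma prob2_diag l y : Ex l (fun S => (y \in S)%:R) = prob2 l y y.
Proof. by apply: eq_Ex => q _; rewrite andbb. Qed.

(** Both sides say that [a - r] is in [S'] for some [a] in [A] and [r] in [S]; this
    lets the two random sets exchange their roles. *)
Lemma meets_diffset A S S' Q : {subset S <= Q} ->
  meets S' (diffset A S) = meets S [fset r in Q | r \in diffset A S']%fset.
Proof.
move=> SQ; apply/meetsP/meetsP => -[x xS].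
  move=> /diffsetP[u [r [uA rS xE]]]; exists r => //; rewrite !inE /= SQ//=.
  by apply/diffsetP; exists u, x; split => //; rewrite xE opprB addrC subrK.
rewrite !inE /= => /andP[_ /diffsetP[u [r [uA rS' xE]]]]; exists r => //.
by apply/diffsetP; exists u, x; split => //; rewrite xE opprB addrC subrK.
Qed.

(** Let [S'] be an independent percolating set for [a]. Exchanging the roles of the
    two sets reduces the claim to a lower bound on the expected capacity of
    order [al] of [A - S'], which is tested with the image of a minimal weight of
    [A]; its expected energy composes the kernels of orders [al] and [a]. *)
Lemma Ex_capacity_ge (a al : R) : 0 < a < d%:R -> 0 < al < d%:R -> d%:R < a + al ->
  exists2 c : R, 0 < c & forall A l (K : R) Q,
    0 <= K -> nonneg_law l -> (forall q r, q \in l -> r \in q.2 -> r \in Q) ->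
    (forall B, {subset B <= Q} -> K * capacity al B <= hit l B) ->
    c * (K * (#|` Q|)%:R * capacity (a + al - d%:R) A)
      <= Ex l (fun S => capacity a (diffset A S)).
Proof.
move=> ha hal; have /andP[a0 ad] := ha; have /andP[al0 ald] := hal => aal.
set gam := a + al - d%:R.
have gam0 : 0 < gam by rewrite /gam; lra.
have [C C0 hC] := @percolation_law R d a a0.
have hal' : 0 <= al < d%:R by rewrite (ltW al0).
have ha' : 0 <= a < d%:R by rewrite (ltW a0).
have [|C1 C10 hC1] := conv_upper hal' ha'; first by rewrite addrC.
rewrite [al + a]addrC -/gam in hC1.
exists (2 * C ^+ 2 * C1)^-1; first by rewrite invr_gt0 !mulr_gt0 ?exprn_gt0.
move=> A l K Q K0 l0 lQ lK.
have [->|A0] := eqVneq A fset0.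
  rewrite capacity_fset0 !mulr0; apply: Ex_ge0 => // q _; exact: capacity_ge0 (ltW a0).
have [nu nup nuE] := capacity_approx (ltW gam0) A0 (ltr1n _ 2 : 1 < 2).
have I0 := min_energy_gt0 (ltW gam0) A0.
case: (nup) => nu0 nu1.
have [l' [k k0 [l'0 hl' one two]]] := hC (diffset A Q).
pose D S' := [fset r in Q | r \in diffset A S']%fset.
(* The capacity of A - S is at least the probability that S' meets it, up to the
   density of S'; then the two sets exchange their roles. *)
have st1 : (C * k)^-1 * Ex l' (fun S' => hit l (D S')) <= Ex l (fun S => capacity a (diffset A S)).
  have -> : Ex l' (fun S' => hit l (D S')) = Ex l (fun S => hit l' (diffset A S)).
    rewrite [RHS]Ex_exchange; apply: eq_Ex => q' _; apply: eq_Ex => q ql.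
    by rewrite (@meets_diffset _ _ _ Q)// => r; exact: lQ.
  rewrite -ExZ; apply: ler_Ex => // q ql.
  rewrite mulrC ler_pdivrMr ?mulr_gt0// mulrC; apply: hl' => b /diffsetP[u [r [uA rS ->]]].
  by apply/diffsetP; exists u, r; split => //; exact: lQ ql rS.
apply: le_trans st1.
(* The value of th that makes the second moment term half of the first. *)
pose th := (2 * C * C1 * min_energy gam A)^-1.
have th0 : 0 < th by rewrite invr_gt0 !mulr_gt0.
(* Image of the weight nu under the difference with S'; it is carried by D S'. *)
pose lam S' r : R := \sum_(u <- A) nu u * (u - r \in S')%:R.
have lam0 S' r : 0 <= lam S' r by apply: sumr_seq_ge0 => u uA; rewrite mulr_ge0 ?nu0.
have lamD S' r : r \in Q -> r \notin D S' -> lam S' r = 0.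
  move=> rQ rD; rewrite /lam big1_seq// => u /andP[_ uA].
  have [uS|_] := boolP (u - r \in S'); last by rewrite mulr0.
  case/negP: rD; rewrite !inE rQ /=; apply/diffsetP; exists u, (u - r); split => //.
  by rewrite opprB addrC subrK.
have DQ S' : {subset D S' <= Q} by move=> r; rewrite !inE => /andP[].
have sumD S' (F : V -> R) : \sum_(r <- D S') lam S' r * F r = \sum_(r <- Q) lam S' r * F r.
  rewrite -(sum_restrict _ (DQ S')); apply: eq_big_seq => r rQ.
  by case: ifPn => // /(lamD _ _ rQ) ->; rewrite mul0r.
pose En S' := \sum_(r <- Q) \sum_(r' <- Q) lam S' r * lam S' r' * ker al (r - r').
have capD S' : 2 * th * (\sum_(r <- Q) lam S' r) - th ^+ 2 * En S' <= capacity al (D S').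
  have := @capacity_ge_quadratic _ _ al (D S') (lam S') th (ltW al0) (fun x _ => lam0 S' x) (ltW th0).
  have -> : \sum_(r <- D S') lam S' r = \sum_(r <- Q) lam S' r.
    have := sumD S' (fun=> 1); under eq_bigr do rewrite mulr1.
    by move=> ->; apply: eq_bigr => r _; rewrite mulr1.
  rewrite energyE /pot.
  have -> // : \sum_(r <- D S') lam S' r * (\sum_(r' <- D S') lam S' r' * ker al (r - r')) = En S'.
  rewrite sumD /En; apply: eq_bigr => r _; rewrite sumD mulr_sumr.
  by apply: eq_bigr => r' _; rewrite mulrA.
have EM : Ex l' (fun S' => \sum_(r <- Q) lam S' r) = (#|` Q|)%:R * k.
  rewrite Ex_sum (eq_big_seq (fun=> k)) => [|r rQ].
    by rewrite big_const_seq count_predT iter_addr_0 mulr_natl.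
  rewrite /lam Ex_sum; transitivity (\sum_(u <- A) nu u * k); last by rewrite -mulr_suml nu1 mul1r.
  apply: eq_big_seq => u uA.
  rewrite ExZ prob2_diag one//; apply/diffsetP; by exists u, r.
have EE : Ex l' En <= C * k * (C1 * (#|` Q|)%:R * (2 * min_energy gam A)).
  have -> : Ex l' En = \sum_(r <- Q) \sum_(r' <- Q) \sum_(u <- A) \sum_(u' <- A)
      nu u * nu u' * ker al (r - r') * prob2 l' (u - r) (u' - r').
    rewrite /En Ex_sum; apply: eq_bigr => r _; rewrite Ex_sum; apply: eq_bigr => r' _.
    rewrite /lam.
    have e S' : (\sum_(u <- A) nu u * (u - r \in S')%:R) * (\sum_(u <- A) nu u * (u - r' \in S')%:R) * ker al (r - r') =
       \sum_(u <- A) \sum_(u' <- A) nu u * nu u' * ker al (r - r') * ((u - r \in S') && (u' - r' \in S'))%:R.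
      rewrite -mulrA mulr_suml; apply: eq_bigr => u _.
      rewrite mulr_suml mulr_sumr; apply: eq_bigr => u' _.
      by rewrite -mulnb natrM; ring.
    rewrite (eq_Ex (g := fun S' => \sum_(u <- A) \sum_(u' <- A) nu u * nu u' * ker al (r - r') * ((u - r \in S') && (u' - r' \in S'))%:R)) => [|q _]; last exact: e.
    rewrite Ex_sum; apply: eq_bigr => u _; rewrite Ex_sum; apply: eq_bigr => u' _.
    by rewrite ExZ.
  have -> : C * k * (C1 * (#|` Q|)%:R * (2 * min_energy gam A)) =
      \sum_(r <- Q) C * k * C1 * (2 * min_energy gam A).
    by rewrite big_const_seq count_predT iter_addr_0 -mulr_natl; ring.
  apply: ler_sum_seq => r rQ.
  apply: (@le_trans _ _ (\sum_(u <- A) \sum_(u' <- A) nu u * nu u' * (C * k * (C1 * ker gam (u - u'))))).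
    rewrite exchange_big/=; apply: ler_sum_seq => u uA.
    rewrite exchange_big/=; apply: ler_sum_seq => u' uA'.
    under eq_bigr do rewrite -mulrA.
    rewrite -mulr_sumr ler_wpM2l ?mulr_ge0 ?nu0//.
    apply: (@le_trans _ _ (\sum_(r' <- Q) C * k * (ker al (r - r') * ker a (r' - (r - u + u'))))).
      apply: ler_sum_seq => r' rQ'.
      rewrite [leRHS]mulrCA ler_wpM2l ?ker_ge0//.
      have -> : ker a (r' - (r - u + u')) = ker a (u - r - (u' - r')).
        by congr ker; rewrite [- (u' - r')]opprB opprD opprB addrCA.
      by apply: two; apply/diffsetP; [exists u, r|exists u', r'].
    rewrite -mulr_sumr ler_wpM2l ?mulr_ge0 ?(ltW C0) ?(ltW k0)//.
    apply: le_trans (hC1 Q _ _) _; apply: eq_ler.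
    by congr (_ * _); congr ker; rewrite opprD opprB addrA [r + _]addrC subrK.
  have -> : \sum_(u <- A) \sum_(u' <- A) nu u * nu u' * (C * k * (C1 * ker gam (u - u'))) =
     C * k * C1 * energy gam A nu.
    rewrite energyE /pot mulr_sumr; apply: eq_bigr => u _; rewrite mulrCA !mulr_sumr.
    by apply: eq_bigr => u' _; ring.
  by rewrite ler_wpM2l// !mulr_ge0// ltW.
have ED : 2 * th * ((#|` Q|)%:R * k) - th ^+ 2 * (C * k * (C1 * (#|` Q|)%:R * (2 * min_energy gam A)))
    <= Ex l' (fun S' => capacity al (D S')).
  apply: le_trans (_ : Ex l' (fun S' => 2 * th * (\sum_(r <- Q) lam S' r) - th ^+ 2 * En S') <= _).
    by rewrite ExD ExN !ExZ EM lerD2l lerN2 ler_wpM2l ?sqr_ge0.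
  by apply: ler_Ex => // q _; exact: capD.
have EH : K * Ex l' (fun S' => capacity al (D S')) <= Ex l' (fun S' => hit l (D S')).
  by rewrite -ExZ; apply: ler_Ex => // q _; exact: lK.
apply: (@le_trans _ _ ((C * k)^-1 * (K * (2 * th * ((#|` Q|)%:R * k) - th ^+ 2 * (C * k * (C1 * (#|` Q|)%:R * (2 * min_energy gam A))))))); last first.
  apply: ler_wpM2l; first by rewrite invr_ge0 ltW// mulr_gt0.
  by apply: le_trans EH; rewrite ler_wpM2l.
rewrite capacityE /th; apply: eq_ler; field.
by rewrite !gt_eqF.
Qed.
End OneStepLower.

(** * Sums of independent random finite sets *)

Section SumLaw.
Context {R : realType} {d : nat}.
Local Notation V := 'rV[int]_d.
Local Notation nrm := (@nrm R d).
Local Notation enorm := (enorm R).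
Local Notation law := (@law R d).
Implicit Types (x y z w : V) (A B E W Q Y Z S : {fset V}) (l : law).

Definition sumset A B : {fset V} := [fset (a + b)%R | a in A, b in B]%fset.

Lemma sumsetP A B x : reflect (exists a b, [/\ a \in A, b \in B & x = a + b]) (x \in sumset A B).
Proof.
apply: (iffP (imfset2P _ _ _ _ _)) => /=.
  by move=> [a aA [b bB ->]]; exists a, b.
by move=> [a [b [aA bB ->]]]; exists a => //; exists b.
Qed.

Definition sumlaw (ls : seq law) : law :=
  foldr (fun l acc => [seq (u.1 * v.1, sumset u.2 v.2) | u <- l, v <- acc])
    [:: (1, [fset 0]%fset)] ls.

Lemma Ex_sumlaw0 f : Ex (sumlaw [::]) f = f [fset 0]%fset.
Proof. by rewrite /Ex big_seq1 mul1r. Qed.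

Lemma Ex_sumlaw_cons l ls f :
  Ex (sumlaw (l :: ls)) f = Ex l (fun S => Ex (sumlaw ls) (fun S' => f (sumset S S'))).
Proof.
rewrite /Ex /= big_allpairs_dep; apply: eq_bigr => u _; rewrite mulr_sumr.
by apply: eq_bigr => v _ /=; rewrite mulrA.
Qed.

Lemma sumlaw_nonneg (I : Type) (lw : I -> law) (r : seq I) :
  (forall i, nonneg_law (lw i)) -> nonneg_law (sumlaw (map lw r)).
Proof.
move=> h; elim: r => [|i r IH] q; first by rewrite inE => /eqP ->.
by move=> /allpairsP[[u v] /= [ul vl ->]] /=; exact: mulr_ge0 (h i _ ul) (IH _ vl).
Qed.

Lemma diffset_sumset A S S' : diffset A (sumset S S') = diffset (diffset A S') S.
Proof.
apply/fsetP => x; apply/diffsetP/diffsetP.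
  move=> [a [_ [aA /sumsetP[u [v [uS vS' ->]]] ->]]]; exists (a - v), u; split => //.
    by apply/diffsetP; exists a, v.
  by rewrite opprD addrA addrAC.
move=> [_ [u [/diffsetP[a [v [aA vS' ->]]] uS ->]]]; exists a, (u + v); split => //.
  by apply/sumsetP; exists u, v.
by rewrite opprD addrA addrAC.
Qed.

Lemma diffset0 A : diffset A [fset 0]%fset = A.
Proof.
apply/fsetP => x; apply/diffsetP/idP => [[a [r [aA]]]|xA].
  by rewrite inE => /eqP -> ->; rewrite subr0.
by exists x, 0; rewrite inE subr0; split.
Qed.

Lemma sumlaw_enorm (I : Type) (lw : I -> law) (s : I -> R) (r : seq I) :
  (forall i q x, q \in lw i -> x \in q.2 -> nrm x <= s i) ->
  forall q x, q \in sumlaw (map lw r) -> x \in q.2 -> enorm x <= \sum_(i <- r) s i.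
Proof.
move=> hs; elim: r => [|i r IH] q x.
  by rewrite inE => /eqP -> /=; rewrite inE => /eqP ->; rewrite enorm0 big_nil.
move=> /allpairsP[[u v] /= [ul vl ->]] /= /sumsetP[y [z [yu zv ->]]].
rewrite big_cons; apply: le_trans (ler_enormD _ _) _; rewrite lerD//.
  exact: le_trans (enorm_nrm _) (hs _ _ _ ul yu).
exact: IH vl zv.
Qed.

Lemma sumr_drop_neg (I : Type) (r : seq I) (f : I -> R) : (forall i, f i < 0) -> \sum_(i <- r) f i <= 0.
Proof. by move=> h; elim: r => [|i r IH]; rewrite ?big_nil// big_cons; have := h i; lra. Qed.

(** The sets are removed by decreasing size, so that each one is compared with the
    difference of [A] and the smaller sets, whose diameter is of the order of [D]
    or of its own size. *)
Lemma Ex_sumlaw_capacity_le (I : Type) (al : I -> R) (r : seq I) :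
  (forall i, 0 < al i < d%:R) -> forall a : R, 0 < a < d%:R ->
  0 < a + \sum_(i <- r) (al i - d%:R) ->
  exists2 C : R, 0 < C & forall (lw : I -> law) (K s : I -> R) (D : R) A,
    (forall i, 0 <= K i) -> (forall i, 1 <= s i) -> 1 <= D ->
    pairwise (fun i j => s j <= s i) r ->
    (forall i, nonneg_law (lw i)) ->
    (forall i q x, q \in lw i -> x \in q.2 -> nrm x <= s i) ->
    (forall i B, (forall b, b \in B -> nrm b <= s i) -> hit (lw i) B <= K i * capacity (al i) B) ->
    (forall x y, x \in A -> y \in A -> nrm (x - y) <= D) ->
    Ex (sumlaw (map lw r)) (fun S => capacity a (diffset A S)) <=
      C * (\prod_(i <- r) (K i * (s i `^ al i * Num.max D (s i) `^ (d%:R - al i))))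
        * capacity (a + \sum_(i <- r) (al i - d%:R)) A.
Proof.
move=> hal; have neg i : al i - d%:R < 0 by have /andP[_] := hal i; rewrite subr_lt0.
elim: r => [|i r IH] a ha; rewrite ?big_nil ?big_cons => hpos.
  exists 1 => // lw K s D A *; rewrite Ex_sumlaw0 diffset0 big_nil !mul1r addr0.
  by [].
have negr := sumr_drop_neg r neg.
have ai0 : d%:R < a + al i by move: hpos negr; set X := \sum_(_ <- _) _; lra.
have /andP[ia id] := hal i.
have ha' : 0 < a + al i - d%:R < d%:R.
  case/andP: ha => a0 ad; have := neg i; rewrite subr_gt0 ai0/=; lra.
have [C0 C00 hC0] := @Ex_capacity_le R d a (al i) ha (hal i) ai0.
have [|C1 C10 hC1] := IH (a + al i - d%:R) ha'; first by rewrite -!addrA in hpos *.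
(* The sets in r have radius at most s i, so the difference of A and their sum has
   diameter at most D + 2 (size r) (s i). *)
pose m : R := 1 + 2 * (size r)%:R.
have m1 : 1 <= m by rewrite /m lerDl mulr_ge0.
have m0 : 0 < m by exact: lt_le_trans m1.
exists (C0 * m `^ (d%:R - al i) * C1); first by rewrite !mulr_gt0 ?powR_gt0.
move=> lw K s D A K0 s1 D1 /= /andP[sle sr] l0 ls lK hA.
rewrite Ex_sumlaw_cons big_cons Ex_exchange.
pose L := m * Num.max D (s i).
have mx1 : 1 <= Num.max D (s i) by rewrite le_max D1.
have mx0 : 0 < Num.max D (s i) by exact: lt_le_trans mx1.
have sum_s : \sum_(j <- r) s j <= (size r)%:R * s i.
  elim: (r) sle => [|j r' IH'] /=; first by rewrite big_nil mul0r.
  by move=> /andP[h /IH']; rewrite big_cons -addn1 natrD; lra.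
have siL : s i <= L.
  apply: (@le_trans _ _ (Num.max D (s i))); first by rewrite le_max lexx orbT.
  by rewrite ler_peMl// ltW.
have step : Ex (sumlaw (map lw r)) (fun S' => Ex (lw i) (fun S => capacity a (diffset A (sumset S S')))) <=
  C0 * (K i * (s i `^ al i * L `^ (d%:R - al i))) * Ex (sumlaw (map lw r)) (fun S' => capacity (a + al i - d%:R) (diffset A S')).
  rewrite -ExZ; apply: ler_Ex => [|q qr]; first exact: sumlaw_nonneg.
  rewrite (eq_Ex (g := fun S => capacity a (diffset (diffset A q.2) S))) => [|u _]; last by rewrite diffset_sumset.
  rewrite -[leRHS]mulrA.
  apply: (@hC0 (diffset A q.2) (lw i) (K i) (s i) L (K0 i) (s1 i) siL _ (l0 i) (ls i) (lK i)).
  move=> x y /diffsetP[u [v [uA vq ->]]] /diffsetP[u' [v' [uA' vq' ->]]].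
  rewrite nrm_le; apply/andP; split; last by apply: le_trans (s1 i) siL.
  have hv := sumlaw_enorm ls qr vq; have hv' := sumlaw_enorm ls qr vq'.
  have -> : u - v - (u' - v') = (u - u') + (v' - v) by rewrite opprB addrACA [- v + _]addrC [RHS]addrACA.
  apply: le_trans (ler_enormD _ _) _.
  have h1 := le_trans (enorm_nrm (R := R) _) (hA u u' uA uA').
  have h2 := @ler_enormD R _ v' (- v); rewrite enormN in h2.
  rewrite /L /m mulrDl mul1r.
  have h3 : D <= Num.max D (s i) by rewrite le_max lexx.
  have h4 : s i <= Num.max D (s i) by rewrite le_max lexx orbT.
  have h5 : (size r)%:R * s i <= (size r)%:R * Num.max D (s i) by rewrite ler_wpM2l.
  lra.
apply: le_trans step _.
have := @hC1 lw K s D A K0 s1 D1 sr l0 ls lK hA.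
have -> : a + al i - d%:R + \sum_(j <- r) (al j - d%:R) = a + (al i - d%:R + \sum_(j <- r) (al j - d%:R)) by rewrite !addrA.
move=> h.
have c0 : 0 <= C0 * (K i * (s i `^ al i * L `^ (d%:R - al i))) by rewrite !mulr_ge0 ?powR_ge0 ?(ltW C00).
apply: le_trans (ler_wpM2l c0 h) _.
rewrite /L powRM ?(ltW m0) ?(ltW mx0)//; apply: eq_ler; ring.
Qed.

Lemma Ex_sumlaw_capacity_ge (I : Type) (al : I -> R) (r : seq I) :
  (forall i, 0 < al i < d%:R) -> forall a : R, 0 < a < d%:R ->
  0 < a + \sum_(i <- r) (al i - d%:R) ->
  exists2 c : R, 0 < c & forall (lw : I -> law) (K : I -> R) (Q : I -> {fset V}) A,
    (forall i, 0 <= K i) ->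
    (forall i, nonneg_law (lw i)) ->
    (forall i q x, q \in lw i -> x \in q.2 -> x \in Q i) ->
    (forall i B, {subset B <= Q i} -> K i * capacity (al i) B <= hit (lw i) B) ->
    c * (\prod_(i <- r) (K i * (#|` Q i|)%:R)) * capacity (a + \sum_(i <- r) (al i - d%:R)) A
      <= Ex (sumlaw (map lw r)) (fun S => capacity a (diffset A S)).
Proof.
move=> hal; have neg i : al i - d%:R < 0 by have /andP[_] := hal i; rewrite subr_lt0.
elim: r => [|i r IH] a ha; rewrite ?big_nil ?big_cons => hpos.
  exists 1 => // lw K Q A *; rewrite Ex_sumlaw0 diffset0 big_nil !mul1r addr0.
  by [].
have negr := sumr_drop_neg r neg.
have ai0 : d%:R < a + al i by move: hpos negr; set X := \sum_(_ <- _) _; lra.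
have /andP[ia id] := hal i.
have ha' : 0 < a + al i - d%:R < d%:R.
  case/andP: ha => a0 ad; have := neg i; rewrite subr_gt0 ai0/=; lra.
have [C0 C00 hC0] := @Ex_capacity_ge R d a (al i) ha (hal i) ai0.
have [|C1 C10 hC1] := IH (a + al i - d%:R) ha'; first by rewrite -!addrA in hpos *.
exists (C0 * C1); first by rewrite mulr_gt0.
move=> lw K Q A K0 l0 lQ lK.
rewrite Ex_sumlaw_cons big_cons Ex_exchange.
have step : C0 * (K i * (#|` Q i|)%:R) * Ex (sumlaw (map lw r)) (fun S' => capacity (a + al i - d%:R) (diffset A S')) <=
    Ex (sumlaw (map lw r)) (fun S' => Ex (lw i) (fun S => capacity a (diffset A (sumset S S')))).
  rewrite -ExZ; apply: ler_Ex => [|q qr]; first exact: sumlaw_nonneg.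
  rewrite (eq_Ex (g := fun S => capacity a (diffset (diffset A q.2) S))) => [|u _]; last by rewrite diffset_sumset.
  have := @hC0 (diffset A q.2) (lw i) (K i) (Q i) (K0 i) (l0 i) (lQ i) (lK i).
  by rewrite mulrA.
apply: le_trans step.
have := @hC1 lw K Q A K0 l0 lQ lK.
have -> : a + al i - d%:R + \sum_(j <- r) (al j - d%:R) = a + (al i - d%:R + \sum_(j <- r) (al j - d%:R)) by rewrite !addrA.
move=> h.
have c0 : 0 <= C0 * (K i * (#|` Q i|)%:R) by rewrite !mulr_ge0 ?(ltW C00).
apply: le_trans (ler_wpM2l c0 h).
by apply: eq_ler; ring.
Qed.
End SumLaw.

(** * Finite windows of independent random sets *)

Section Independent.
Context {disp : measure_display} {T : measurableType disp} {R : realType}.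
Context (P : probability T R) {d : nat} {I : finType}.
Local Notation V := 'rV[int]_d.
Local Notation law := (@law R d).
Context (X : I -> T -> set V).
Hypothesis mX : forall i, random_subset (X i).
Hypothesis iX : mutually_independent P X.
Implicit Types (Z : I -> {fset V}) (S : {fset V}).

Definition window Z i w : {fset V} := [fset z in Z i | `[< X i w z >]]%fset.

Definition window_law Z i : law :=
  [seq (fine (P [set w | window Z i w = U]), U) | U <- fpowerset (Z i)].

Lemma measurable_window_gen (disp' : measure_display) (T' : measurableType disp')
    (Y : T' -> set V) (W S : {fset V}) : (forall v, measurable [set w | Y w v]) ->
  measurable [set w | [fset z in W | `[< Y w z >]]%fset = S].
Proof.
move=> mY; have [SW|SW] := boolP (S `<=` W)%fset; last first.
  rewrite (_ : [set w | _] = set0) ?measurable0//; apply/seteqP; split => // w /= e.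
  case/negP: SW; rewrite -e; apply/fsubsetP => z; by rewrite !inE => /andP[].
rewrite (_ : [set w | _] = \bigcap_(z in [set` W])
   (if z \in S then [set w | Y w z] else ~` [set w | Y w z])).
  apply: fin_bigcap_measurable => // z _; case: ifP => _; first exact: mY.
  exact: measurableC (mY z).
apply/seteqP; split => w /=.
  move=> <- z /= zW; rewrite !inE /= zW /=; case: ifPn; first by move/asboolP.
  by move/asboolP.
move=> h; apply/fsetP => z; rewrite !inE /=; apply/andP/idP => [[zW /asboolP Yz]|zS].
  by have := h z zW; case: ifP.
have zW : z \in W by exact: (fsubsetP SW).
by split => //; apply/asboolP; have := h z zW; rewrite zS.
Qed.

Lemma measurable_window Z i S : measurable [set w | window Z i w = S].
Proof. exact: measurable_window_gen (mX i). Qed.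

Lemma sigma_window Z i S : sigma_random_subset (X i) [set w | window Z i w = S].
Proof.
pose G := range (fun v => [set w | X i w v]).
have := @measurable_window_gen _ (g_sigma_algebraType G) (X i) (Z i) S.
apply => v; apply: sub_sigma_algebra; by exists v.
Qed.

Lemma window_sub Z i w : (window Z i w \in fpowerset (Z i)).
Proof. by rewrite fpowersetE; apply/fsubsetP => z; rewrite !inE => /andP[]. Qed.

Definition window_sum Z (r : seq I) w : {fset V} :=
  foldr (fun i S => sumset (window Z i w) S) [fset 0]%fset r.

Lemma measurable_window_sum Z r (f : {fset V} -> bool) :
  measurable [set w | f (window_sum Z r w)].
Proof.
elim: r f => [|i r IH] f /=.
  case: (f _); last by rewrite (_ : [set _ | _] = set0) ?measurable0//; apply/seteqP; split.
  by rewrite (_ : [set _ | _] = setT) ?measurableT//; apply/seteqP; split.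
rewrite (_ : [set w | _] = \bigcup_(S in [set` fpowerset (Z i)])
   ([set w | window Z i w = S] `&` [set w | f (sumset S (window_sum Z r w))])).
  apply: fin_bigcup_measurable => // S _; apply: measurableI; first exact: measurable_window.
  exact: (IH (fun S' => f (sumset S S'))).
apply/seteqP; split => w /=.
  by move=> fw; exists (window Z i w) => //; exact: window_sub.
by move=> [S _ [/= -> ]].
Qed.

(** Joint law of some windows and of the sum of the others; the induction moves the
    windows one by one from the sum to the intersection, where independence
    applies. *)
Lemma window_joint Z r (f : {fset V} -> bool) (J : {set I}) (sg : I -> {fset V}) :
  uniq r -> (forall i, i \in r -> i \notin J) ->
  P ((\bigcap_(i in [set` J]) [set w | window Z i w = sg i]) `&`
     [set w | f (window_sum Z r w)]) =
  ((\prod_(i in J) fine (P [set w | window Z i w = sg i])) *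
    Ex (sumlaw (map (window_law Z) r)) (fun S => (f S)%:R))%:E.
Proof.
have PE i S : P [set w | window Z i w = S] = (fine (P [set w | window Z i w = S]))%:E.
  by rewrite fineK// fin_num_measure//; exact: measurable_window.
elim: r f J sg => [|i r IH] f J sg /=.
  move=> _ _; rewrite Ex_sumlaw0.
  have PJ : P (\bigcap_(i in [set` J]) [set w | window Z i w = sg i]) =
      (\prod_(i in J) fine (P [set w | window Z i w = sg i]))%:E.
    rewrite iX; last by move=> i _; exact: sigma_window.
    by rewrite -prodEFin; apply: eq_bigr => i _; rewrite -PE.
  case: (f _).
    have -> : [set _ : T | true] = setT by apply/seteqP; split.
    by rewrite setIT mulr1.
  have -> : [set _ : T | false] = set0 by apply/seteqP; split.
  by rewrite setI0 measure0 mulr0.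
move=> /andP[ir ur] rJ.
set G := \bigcap_(j in _) _.
have iJ : i \notin J by apply: rJ; rewrite mem_head.
have mG : measurable G.
  apply: fin_bigcap_measurable => // j _; exact: measurable_window.
rewrite (_ : _ `&` _ = \bigcup_(S in [set` fpowerset (Z i)])
   (G `&` [set w | window Z i w = S] `&` [set w | f (sumset S (window_sum Z r w))])); last first.
  apply/seteqP; split => w /=.
    by move=> [Gw fw]; exists (window Z i w); [exact: window_sub|].
  by move=> [S _ [[Gw /= ->]]].
rewrite measure_fin_bigcup//=; last 2 first.
- by move=> S S' _ _ [w /= [[[_ <-] _] [[_ <-] _]]].
- move=> S _; apply: measurableI; last exact: (measurable_window_sum Z r (fun S' => f (sumset S S'))).
  by apply: measurableI => //; exact: measurable_window.
rewrite -fsbig_seq/=; last exact: fset_uniq.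
rewrite Ex_sumlaw_cons /Ex /window_law big_map mulr_sumr -sumEFin.
apply: eq_bigr => S _.
pose sg' j := if j == i then S else sg j.
have := IH (fun S' => f (sumset S S')) (i |: J)%SET sg' ur _.
have -> : \bigcap_(j in [set` (i |: J)%SET]) [set w | window Z j w = sg' j] =
   G `&` [set w | window Z i w = S].
  apply/seteqP; split => w /=.
    move=> h; split.
      move=> j /= jJ; have := h j; rewrite /= !inE jJ orbT => /(_ isT).
      by rewrite /sg'; case: eqP => [e|//]; rewrite -e jJ in iJ.
    by have := h i; rewrite /= !inE eqxx => /(_ isT); rewrite /sg' eqxx.
  move=> [Gw Sw] j; rewrite /= !inE => /orP[/eqP->|jJ]; rewrite /sg'.
    by rewrite eqxx.
  by case: eqP => [->//|_]; exact: Gw.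
move=> ->; last first.
  move=> j jr; rewrite !inE negb_or; apply/andP; split.
    by apply: contraNneq ir => <-.
  by apply: rJ; rewrite inE jr orbT.
congr (_%:E); rewrite big_setU1//= {1}/sg' eqxx.
rewrite (eq_bigr (fun j => fine (P [set w | window Z j w = sg j]))); last first.
  by move=> j jJ; rewrite /sg'; case: eqP => // e; rewrite -e jJ in iJ.
by rewrite /Ex; ring.
Qed.

Lemma window_sum_law Z r (f : {fset V} -> bool) : uniq r ->
  P [set w | f (window_sum Z r w)] =
  (Ex (sumlaw (map (window_law Z) r)) (fun S => (f S)%:R))%:E.
Proof.
move=> ur; have := window_joint Z f (J := finset.set0) (fun=> fset0) ur.
rewrite big_set0 mul1r => <-; last by move=> i; rewrite inE.
rewrite (_ : \bigcap_(i in _) _ = setT) ?setTI//; apply/seteqP; split => // w _ i /=.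
by rewrite inE.
Qed.

Lemma measurable_hits i (B : {fset V}) : measurable (hits (X i) [set` B]).
Proof.
rewrite (_ : hits _ _ = \bigcup_(v in [set` B]) [set w | X i w v]).
  by apply: fin_bigcup_measurable => // v _; exact: mX.
by apply/seteqP; split => w /= [v]; [move=> [Xv Bv]; exists v|move=> Bv Xv; exists v].
Qed.

Lemma window_law_nonneg Z i : nonneg_law (window_law Z i).
Proof. by move=> q /mapP[S _ ->] /=; exact: fine_ge0. Qed.

Lemma window_law_sub Z i q x : q \in window_law Z i -> x \in q.2 -> x \in Z i.
Proof. by move=> /mapP[S + ->] /=; rewrite fpowersetE => /fsubsetP; apply. Qed.

(** A set contained in the window is met by the random set as soon as it is met by
    the part of it in the window. *)
Lemma hit_window_law Z i B : {subset B <= Z i} ->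
  (hit (window_law Z i) B)%:E = P (hits (X i) [set` B]).
Proof.
move=> BZ.
have := @window_sum_law Z [:: i] (fun S => meets S B) isT.
rewrite Ex_sumlaw_cons (eq_Ex (g := fun S => (meets S B)%:R)) => [|q _]; last first.
  rewrite Ex_sumlaw0; congr (nat_of_bool (meets _ _))%:R; apply/fsetP => x.
  apply/sumsetP/idP => [[a [b [aq]]]|xq]; first by rewrite inE => /eqP -> ->; rewrite addr0.
  by exists x, 0; rewrite inE addr0.
move=> <-; congr (P _); apply/seteqP; split => w /=.
  move=> /meetsP[x /sumsetP[a [b [+ + ->]]] xB]; rewrite !inE => /andP[_ /asboolP Xa] /eqP b0.
  by exists a; split => //; rewrite b0 addr0 in xB.
move=> [x [Xx /= xB]]; apply/meetsP; exists x => //; apply/sumsetP; exists x, 0; split.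
- by rewrite !inE /= BZ//=; apply/asboolP.
- by rewrite inE.
- by rewrite addr0.
Qed.

Lemma mem_window_sum Z r w x : uniq r ->
  x \in window_sum Z r w <-> exists g : I -> V, (forall i, i \in r -> g i \in Z i /\ X i w (g i)) /\ x = \sum_(i <- r) g i.
Proof.
elim: r x => [|i r IH] x /=.
  by move=> _; rewrite inE; split => [/eqP ->|[g [_ ->]]]; rewrite ?big_nil//; exists (fun=> 0); rewrite big_nil.
move=> /andP[ir ur]; split.
  move=> /sumsetP[a [b [+ /(IH _ ur)[g [hg ->]] ->]]]; rewrite !inE => /andP[aZ /asboolP Xa].
  exists (fun j => if j == i then a else g j); split.
    move=> j; rewrite inE; case: eqP => [->//|_ /= jr]; exact: hg.
  rewrite big_cons eqxx; congr (_ + _); apply: eq_big_seq => j jr.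
  by case: eqP => // ji; rewrite -ji jr in ir.
move=> [g [hg ->]]; rewrite big_cons; apply/sumsetP; exists (g i), (\sum_(j <- r) g j); split => //.
  by have [gZ /asboolP Xg] := hg i (mem_head _ _); rewrite !inE gZ.
by apply/(IH _ ur); exists g; split => // j jr; apply: hg; rewrite inE jr orbT.
Qed.
End Independent.

Lemma mem_minkowski_big (V : nmodType) (k : nat) (F : 'I_k -> set V) x :
  (\big[@minkowski_sum _/[set 0]]_(i < k) F i) x <->
  exists g : 'I_k -> V, (forall i, F i (g i)) /\ x = \sum_(i < k) g i.
Proof.
elim: k F x => [|k IH] F x.
  rewrite big_ord0; split => [->|[g [_ ->]]]; last by rewrite big_ord0.
  by exists (fun=> 0); split; [case|rewrite big_ord0].
rewrite big_ord_recl; split.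
  move=> [a Fa [b /IH[g [Fg ->]] <-]].
  exists (fun i => if unlift ord0 i is Some j then g j else a); split.
    by move=> i; case: unliftP => [j ->|->].
  rewrite big_ord_recl unlift_none; congr (_ + _); apply: eq_bigr => i _.
  by rewrite liftK.
move=> [g [Fg ->]]; rewrite big_ord_recl; exists (g ord0) => //.
exists (\sum_(i < k) g (lift ord0 i)) => //; apply/IH; exists (fun i => g (lift ord0 i)).
by split.
Qed.

(** * Diameters and sums over dyadic scales *)

Section Diameter.
Context {R : realType} {d : nat}.
Local Notation V := 'rV[int]_d.
Local Notation enorm := (enorm R).
Implicit Types (x y : V) (A : {fset V}).

Lemma le_diam A x y : x \in A -> y \in A -> enorm (x - y) <= diam R A.
Proof.
move=> xA yA; apply: ub_le_sup; last by exists x => //; exists y.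
have [r _ hr] := @radius_exists R d A; exists r => _ [u uA [v vA <-]].
exact: le_trans (enorm_nrm _) (hr _ _ uA vA).
Qed.

Lemma diam_le A (r : R) : A != fset0 ->
  (forall x y, x \in A -> y \in A -> enorm (x - y) <= r) -> diam R A <= r.
Proof.
move=> /fset0Pn[a aA] h; apply: ge_sup.
  by exists (enorm (a - a)), a => //; exists a.
by move=> _ [u uA [v vA <-]]; exact: h.
Qed.
End Diameter.

Lemma geometric_sum_le {R : realType} (q : R) (n : nat) : 1 < q ->
  \sum_(m < n.+1) q ^+ m <= q / (q - 1) * q ^+ n.
Proof.
move=> q1; have q0 : 0 < q - 1 by rewrite subr_gt0.
elim: n => [|n IH].
  by rewrite big_ord_recr big_ord0/= add0r expr0 mulr1 ler_pdivlMr// mul1r gerBl.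
rewrite big_ord_recr/=; apply: le_trans (lerD IH (lexx _)) _.
have -> : q / (q - 1) * q ^+ n.+1 = q / (q - 1) * q ^+ n + q ^+ n.+1.
  by rewrite !exprS; field; rewrite gt_eqF.
by [].
Qed.

(** The scales larger than [r] form a geometric series of ratio [2 ^ (D - b)],
    dominated by its last term. The scales below [r] contribute
    [r ^ (D - a)] times a sum of powers of [2 ^ (a - b)], which has about [log r]
    terms of order at most one when [a <= b], and is a geometric series dominated by
    its last term when [b < a]; in the first case the condition on [N] bounds
    [r ^ (D - a) * ln (r + 1)] by [N ^ (D - b)]. *)
Lemma sum_scales_le {R : realType} (D a b k : R) : 0 < a < D -> 0 < b < D -> 0 < k ->
  exists2 C : R, 0 < C & forall (r N : R) (J : nat), 0 <= r ->
    2 * r + (if a <= b then r `^ ((D - a) / (D - b)) * ln (r + 1) `^ (D - b)^-1 else 0) <= N ->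
    N <= k * 2 ^+ J ->
    \sum_(m < J.+1) (2 ^+ m) `^ (a - b) * Num.max (Num.max r 1) (2 ^+ m) `^ (D - a)
      <= C * (2 ^+ J) `^ (D - b).
Proof.
move=> /andP[a0 aD] /andP[b0 bD] k0.
have Da : 0 < D - a by rewrite subr_gt0.
have Db : 0 < D - b by rewrite subr_gt0.
have ln20 : 0 < ln 2 :> R by rewrite ln_gt0// ltr1n.
pose q := 2 `^ (D - b) : R; have q1 : 1 < q by rewrite powR_gt1 ?ltr1n.
pose p := 2 `^ (a - b) : R.
have p0 : 0 < p by rewrite powR_gt0.
have kD0 : 0 < k `^ (D - b) by rewrite powR_gt0.
pose C2 := (if a <= b then 2 / ln 2 else p / (p - 1)) * k `^ (D - b).
have C20 : 0 < C2.
  rewrite /C2 mulr_gt0//; case: (leP a b) => [_|ba]; first by rewrite divr_gt0.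
  by rewrite divr_gt0// subr_gt0 powR_gt1 ?ltr1n ?subr_gt0.
have q10 : 0 < q / (q - 1) by rewrite divr_gt0 ?subr_gt0// (lt_trans ltr01).
exists (q / (q - 1) + C2); first by rewrite addr_gt0.
move=> r N J r0 hN hNJ.
have N0 : 0 <= N.
  apply: le_trans hN; rewrite addr_ge0 ?mulr_ge0//.
  by case: ifP => // _; rewrite mulr_ge0 ?powR_ge0.
have two m : 1 <= 2 ^+ m :> R by rewrite exprn_ege1// ler1n.
have two0 m : 0 < 2 ^+ m :> R by rewrite exprn_gt0.
(* The first term is the value for [2 ^ m >= r]; the second one is present
   only at the scales below r. *)
have pw m : (2 ^+ m) `^ (a - b) * Num.max (Num.max r 1) (2 ^+ m) `^ (D - a) <=
   q ^+ m + (if 2 ^+ m < r then r `^ (D - a) * p ^+ m else 0).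
  have e1 : (2 ^+ m) `^ (a - b) * (2 ^+ m) `^ (D - a) = q ^+ m :> R.
    rewrite -powRD; last by rewrite (gt_eqF (two0 m)) implybT.
    have -> : a - b + (D - a) = D - b by ring.
    by rewrite expr_powR.
  have [h|h] := ltP (2 ^+ m) r.
    have -> : Num.max (Num.max r 1) (2 ^+ m) = r.
      have r1 : 1 <= r by apply: le_trans (two m) (ltW h).
      by rewrite (max_l r1) max_l// ltW.
    by rewrite expr_powR// mulrC lerDr exprn_ge0// ltW// (lt_trans ltr01).
  have -> : Num.max (Num.max r 1) (2 ^+ m) = 2 ^+ m.
    by rewrite max_r// ge_max h two.
  by rewrite e1 addr0.
apply: le_trans (ler_sum _ (fun (m : 'I_J.+1) _ => pw m)) _.
rewrite big_split/= mulrDl; apply: lerD.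
  by rewrite expr_powR//; exact: geometric_sum_le.
have [r1|r1] := ltP r 1.
  rewrite big1 => [|m _]; first exact: mulr_ge0 (ltW C20) (powR_ge0 _ _).
  rewrite ifF//.
  by apply/negP => h; have := lt_trans h r1; rewrite ltNge two.
have [n /andP[n1 n2]] := pow2_floor r1.
have sub : \sum_(m < J.+1) (if 2 ^+ m < r then r `^ (D - a) * p ^+ m else 0) <=
    r `^ (D - a) * \sum_(m < n.+1) p ^+ m.
  rewrite mulr_sumr.
  rewrite -(big_mkord xpredT (fun m => if 2 ^+ m < r then r `^ (D - a) * p ^+ m else 0)).
  rewrite -(big_mkord xpredT (fun m => r `^ (D - a) * p ^+ m)).
  have tp m : 0 <= r `^ (D - a) * p ^+ m by rewrite mulr_ge0 ?powR_ge0 ?exprn_ge0 ?(ltW p0).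
  have hz m : (n.+1 <= m)%N -> (if 2 ^+ m < r then r `^ (D - a) * p ^+ m else 0) = 0.
    move=> nm; rewrite ifF//; apply/negP => h.
    have : 2 ^+ n.+1 <= 2 ^+ m :> R by rewrite ler_eXn2l ?ltr1n.
    by move=> h'; have := lt_trans n2 (le_lt_trans h' h); rewrite ltxx.
  have [Jn|nJ] := leqP J.+1 n.+1.
    rewrite [leRHS](big_cat_nat (n := J.+1))//= -[leLHS]addr0 lerD ?sumr_ge0//.
    by apply: ler_sum => m _; case: ifP.
  rewrite (big_cat_nat (n := n.+1))//=; last by exact: ltnW.
  rewrite [X in _ + X]big_nat_cond [X in _ + X]big1 ?addr0.
    by apply: ler_sum => m _; case: ifP.
  by move=> m /andP[/andP[nm _] _]; exact: hz.
apply: le_trans sub _.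
have NJ : N `^ (D - b) <= k `^ (D - b) * (2 ^+ J) `^ (D - b).
  rewrite -powRM ?(ltW k0) ?exprn_ge0//.
  by rewrite ge0_ler_powR ?(ltW Db) ?nnegrE ?mulr_ge0 ?(ltW k0) ?exprn_ge0.
suff main : r `^ (D - a) * \sum_(m < n.+1) p ^+ m <=
    (if a <= b then 2 / ln 2 else p / (p - 1)) * N `^ (D - b).
  apply: le_trans main _; rewrite /C2 -mulrA ler_wpM2l//.
  by have := C20; rewrite /C2 pmulr_lgt0// => /ltW.
have rN : r <= N.
  apply: le_trans hN; apply: le_trans (_ : 2 * r <= _); first by rewrite ler_peMl// ler1n.
  by rewrite lerDl; case: ifP => // _; rewrite mulr_ge0 ?powR_ge0.
have [ab|ba] := leP a b; last first.
  have p1 : 1 < p by rewrite powR_gt1 ?ltr1n ?subr_gt0.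
  apply: (@le_trans _ _ (r `^ (D - a) * (p / (p - 1) * p ^+ n))).
    by rewrite ler_wpM2l ?powR_ge0//; exact: geometric_sum_le.
  rewrite mulrCA ler_wpM2l ?divr_ge0 ?(ltW p0) ?subr_ge0 ?(ltW p1)//.
  apply: (@le_trans _ _ (r `^ (D - b))); last first.
    by rewrite ge0_ler_powR ?(ltW Db) ?nnegrE.
  have -> : D - b = (D - a) + (a - b) by ring.
  rewrite [leRHS]powRD; last by rewrite (gt_eqF (lt_le_trans ltr01 r1)) implybT.
  rewrite ler_wpM2l ?powR_ge0// -expr_powR// ge0_ler_powR ?subr_ge0 ?(ltW ba) ?nnegrE ?exprn_ge0//.
have p1 : p <= 1.
  by rewrite /p -[a - b]opprK powRN invf_le1 ?powR_gt0// -[leLHS](powRr0 (2 : R)) ler_powR ?ler1n// oppr_ge0 subr_le0.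
have ln1 : 0 < ln (r + 1) by rewrite ln_gt0// ltrDr (lt_le_trans ltr01).
have cnt : \sum_(m < n.+1) p ^+ m <= 2 / ln 2 * ln (r + 1).
  apply: (@le_trans _ _ (\sum_(m < n.+1) 1)).
    by apply: ler_sum => m _; rewrite exprn_ile1// ltW.
  rewrite sumr_const card_ord mulrAC ler_pdivlMr//.
  have h1 : ln 2 <= ln (r + 1) by rewrite ler_ln ?posrE//; lra.
  have h2 : n%:R * ln 2 <= ln (r + 1).
    rewrite mulr_natl -lnXn// ler_ln ?posrE ?exprn_gt0//; last by rewrite addr_gt0// (lt_le_trans ltr01).
    by apply: le_trans n1 _; rewrite lerDl.
  by rewrite -addn1 natrD mulrDl mul1r; lra.
apply: (@le_trans _ _ (r `^ (D - a) * (2 / ln 2 * ln (r + 1)))).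
  by rewrite ler_wpM2l ?powR_ge0.
rewrite mulrCA ler_wpM2l ?divr_ge0 ?(ltW ln20)//.
rewrite ab in hN.
have -> : r `^ (D - a) * ln (r + 1) = (r `^ ((D - a) / (D - b)) * ln (r + 1) `^ (D - b)^-1) `^ (D - b).
  rewrite powRM ?powR_ge0// -!powRrM divfK ?gt_eqF// mulVf ?gt_eqF// powRr1//.
  exact: ltW.
rewrite ge0_ler_powR ?(ltW Db) ?nnegrE ?mulr_ge0 ?powR_ge0//.
by apply: le_trans hN; rewrite lerDr mulr_ge0.
Qed.

(** * Hitting probabilities at a given distance from the origin *)

Section Shells.
Context {R : realType} {d : nat}.
Local Notation V := 'rV[int]_d.
Local Notation law := (@law R d).
Local Notation nrm := (@nrm R d).
Implicit Types (x y z b : V) (B : {fset V}).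

Definition shell (j : nat) : {fset V} :=
  locked [fset z in ball 0 (2 ^+ j : R) | (j == 0%N) || ((2 ^+ j.-1 : R) < nrm z)%R]%fset.

Lemma in_shell j z : (z \in shell j) =
  (nrm z <= 2 ^+ j) && ((j == 0%N) || (2 ^+ j.-1 < nrm z)).
Proof. by rewrite /shell -lock !inE in_ball subr0. Qed.

Lemma shell_nrm j z : z \in shell j -> nrm z <= 2 ^+ j.
Proof. by rewrite in_shell => /andP[]. Qed.

(** Cells of side [2 ^ (j - split_level)] have a diameter at most one quarter of the
    radius [2 ^ j] of the shell to be cut. *)
Definition split_level : nat := (d + 2)%N.

Lemma split_levelP : 4 * d%:R <= 2 ^+ split_level :> R.
Proof.
have -> : 2 ^+ split_level = 4 * 2 ^+ d :> R by rewrite /split_level addn2 !exprS; ring.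
by rewrite ler_wpM2l// -natrX ler_nat ltnW// ltn_expl.
Qed.

Lemma hit_union_le (l : law) (J : choiceType) (s : seq J) (B : {fset V}) (F : J -> {fset V}) :
  nonneg_law l -> (forall b, b \in B -> exists2 q, q \in s & b \in F q) ->
  hit l B <= \sum_(q <- s) hit l (F q).
Proof.
move=> l0 hF; rewrite /hit -Ex_sum; apply: ler_Ex => // q ql.
case: (boolP (meets q.2 B)) => [/meetsP[x xq /hF[r rs xr]]|_]; last by apply: sumr_ge0.
rewrite (big_rem r)//=.
have -> : meets q.2 (F r) by apply/meetsP; exists x.
by rewrite lerDl sumr_ge0.
Qed.

Lemma hit_le (l : law) (B B' : {fset V}) : nonneg_law l ->
  (forall q x, q \in l -> x \in q.2 -> x \in B -> x \in B') -> hit l B <= hit l B'.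
Proof.
move=> l0 h; apply: ler_Ex => // q ql; rewrite ler_nat.
case: (boolP (meets q.2 B)) => // /meetsP[x xq xB].
by rewrite lt0b; apply/meetsP; exists x => //; exact: h ql xq xB.
Qed.

End Shells.

Definition capacity_hitting {disp : measure_display} {T : measurableType disp} {R : realType}
    (P : probability T R) {d : nat} {I : finType} (X : I -> T -> set 'rV[int]_d)
    (alpha beta : I -> R) (c C : R) : Prop :=
  forall (i : I) (B : {fset 'rV[int]_d}) (x : 'rV[int]_d),
    0 \in B -> x != 0 -> 2 * diam R B <= enorm R x ->
    ((c * enorm R x `^ (- beta i) * capacity (alpha i) B)%:E
       <= P (hits (X i) (translate x [set` B]))
       <= (C * enorm R x `^ (- beta i) * capacity (alpha i) B)%:E)%E.

Section HitBounds.
Context {disp : measure_display} {T : measurableType disp} {R : realType}.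
Context (P : probability T R) {d : nat} {I : finType}.
Local Notation V := 'rV[int]_d.
Local Notation law := (@law R d).
Local Notation nrm := (@nrm R d).
Local Notation enorm := (enorm R).
Local Notation shell := (@shell R d).
Local Notation split_level := (@split_level d).
Context (X : I -> T -> set V) (alpha beta : I -> R) (c C : R).
Hypothesis mX : forall i, random_subset (X i).
Hypothesis iX : mutually_independent P X.
Hypothesis halpha : forall i, 0 < alpha i < d%:R.
Hypothesis hbeta : forall i, 0 < beta i < d%:R.
Hypothesis c0 : 0 < c.
Hypothesis C0 : 0 < C.
Hypothesis hX : capacity_hitting P X alpha beta c C.

(** Any point of the set can serve as the centre, by translation. *)
Lemma hit_bounds i (B : {fset V}) b (r : R) : b \in B -> b != 0 ->
  (forall x y, x \in B -> y \in B -> enorm (x - y) <= r) -> 2 * r <= enorm b ->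
  ((c * enorm b `^ (- beta i) * capacity (alpha i) B)%:E
          <= P (hits (X i) [set` B])
          <= (C * enorm b `^ (- beta i) * capacity (alpha i) B)%:E)%E.
Proof.
move=> bB b0 hr r2; pose B' := [fset x - b | x in B]%fset.
have B'0 : 0 \in B' by apply/imfsetP; exists b => //; rewrite subrr.
have capB : capacity (alpha i) B' = capacity (alpha i) B.
  apply: (@capacity_isom _ _ _ B _ (fun z => z + b)) => [z|z||u v].
  - by rewrite subrK.
  - by rewrite addrK.
  - by case/andP: (halpha i) => /ltW.
  - by rewrite opprB addrA subrK.
have diamB : diam R B' <= r.
  apply: diam_le; first by apply/fset0Pn; exists 0.
  move=> _ _ /imfsetP[x /= xB ->] /imfsetP[y /= yB ->].
  by rewrite opprB addrA subrK; exact: hr.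
have -> : [set` B] = translate b [set` B'].
  apply/seteqP; split => x /=.
    by move=> xB; exists (x - b); [apply/imfsetP; exists x|rewrite addrC subrK].
  by move=> [_ /imfsetP[y /= yB ->] <-]; rewrite addrC subrK.
rewrite -capB; apply: hX => //; apply: le_trans r2; by rewrite ler_wpM2l.
Qed.

Definition shell_const : R :=
  1 + (#|` cube (0 : V) (2 ^ split_level)|)%:R * (C * 2 ^+ d).

Lemma shell_const_gt0 : 0 < shell_const.
Proof. by rewrite /shell_const ltr_pwDl// mulr_ge0// mulr_ge0 ?exprn_ge0// ltW. Qed.

(** A shell is too large for its distance to the origin, but it is covered by
    a bounded number of cells that are not. *)
Lemma hit_shell_le (Z : I -> {fset V}) i j (B : {fset V}) : Z i = shell j ->
  hit (window_law P X Z i) B <= shell_const * (2 ^+ j) `^ (- beta i) * capacity (alpha i) B.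
Proof.
move=> Zi; have l0 : nonneg_law (window_law P X Z i) by exact: window_law_nonneg.
have /andP[al0 ald] := halpha i; have /andP[be0 bed] := hbeta i.
have [->|B0] := eqVneq B fset0.
  rewrite capacity_fset0 mulr0 /hit (eq_Ex (g := fun=> 0 * 1)) ?ExZ ?mul0r// => q _.
  by rewrite /meets fsetI0 eqxx ?mul0r.
pose B' := [fset z in B | z \in shell j]%fset.
have B'Z : {subset B' <= Z i} by move=> z; rewrite Zi !inE /= => /andP[].
have B'B : {subset B' <= B} by move=> z; rewrite !inE /= => /andP[].
have hB : hit (window_law P X Z i) B <= hit (window_law P X Z i) B'.
  apply: hit_le => // q x ql xq xB.
  by have := window_law_sub ql xq; rewrite Zi => xs; rewrite !inE /= xB xs.
apply: le_trans hB _.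
have hPE (E : {fset V}) : {subset E <= Z i} ->
    (hit (window_law P X Z i) E)%:E = P (hits (X i) [set` E]).
  by move=> EZ; exact: hit_window_law.
case: j Zi @B' B'Z B'B => [|j] Zi B' B'Z B'B.
  rewrite expr0 powR1 mulr1.
  have h1 : hit (window_law P X Z i) B' <= 1.
    have := hPE B' B'Z; rewrite -lee_fin => ->; apply: probability_le1.
    exact: measurable_hits.
  apply: le_trans h1 _; rewrite -[leLHS]mul1r ler_pM ?capacity_ge1 ?(ltW al0)//.
  by rewrite /shell_const lerDl mulr_ge0// mulr_ge0 ?exprn_ge0// ltW.
clearbody B'; set m := split_level; set h := (j.+1 - m)%N.
have side : (d%:R * 2 ^+ h * 4 <= 2 ^+ j.+1 :> R) \/ h = 0%N.
  have [jm|jm] := leqP j.+1 m; first by right; apply/eqP.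
  left; have -> : j.+1 = (m + h)%N by rewrite /h subnKC// ltnW.
  by rewrite exprD mulrAC ler_wpM2r ?exprn_ge0// mulrC split_levelP.
(* If h = 0 the pieces are points, and the condition on diameters is void. *)
pose F q := [fset z in B' | cell h z == q]%fset.
have FB' q : {subset F q <= B'} by move=> z; rewrite !inE /= => /andP[].
have cover b : b \in B' -> exists2 q, q \in cube (0 : V) (2 ^ m) & b \in F q.
  move=> bB; exists (cell h b); last by rewrite !inE bB /=.
  rewrite in_cube subr0; apply/forallP => r; rewrite mxE.
  have bn : nrm b <= 2 ^+ j.+1 by have := B'Z _ bB; rewrite Zi; exact: shell_nrm.
  have := le_trans (le_trans (enorm_coord b r) (enorm_nrm _)) bn.
  rewrite -intr_norm; have -> : 2 ^+ j.+1 = ((2 ^+ j.+1)%:~R : R) by rewrite rmorphXn.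
  rewrite ler_int => hb.
  have hjm : (2 : int) ^+ j.+1 <= 2 ^+ m * 2 ^+ h.
    by rewrite -exprD ler_eXn2l// -leq_subLR.
  have -> : (2 ^ m)%N%:Z = 2 ^+ m by rewrite -natz natrX.
  have N0 : (0 : int) < 2 ^+ h by rewrite exprn_gt0.
  have N1 : (2 : int) ^+ h != 0 by rewrite gt_eqF.
  have M0 : (0 : int) < 2 ^+ m by rewrite exprn_gt0.
  have := divz_eq (b 0 r) (2 ^+ h); have := modz_ge0 (b 0 r) N1; have := ltz_mod (b 0 r) N1.
  move: (b 0 r) hb hjm N0 M0; rewrite -/((2 : int) ^+ h) -/((2 : int) ^+ m).
  move: (2 ^+ j.+1) (2 ^+ m) (2 ^+ h) => u v w t.
  move: (divz t w) (modz t w) => q0 r0 hb hjm N0 M0 h1 h2 h3.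
  nia.
have [bb bbB] : exists b, b \in B by apply/fset0Pn.
apply: le_trans (hit_union_le l0 cover) _.
have Fle q : hit (window_law P X Z i) (F q) <= C * 2 ^+ d * (2 ^+ j.+1) `^ (- beta i) * capacity (alpha i) B.
  have [F0|/fset0Pn[b bF]] := eqVneq (F q) fset0.
    rewrite F0 /hit (eq_Ex (g := fun=> 0 * 1)) ?ExZ ?mul0r; last first.
      by move=> q' _; rewrite /meets fsetI0 eqxx ?mul0r.
    by rewrite !mulr_ge0 ?powR_ge0 ?exprn_ge0 ?capacity_ge0 ?(ltW C0) ?(ltW al0).
  have bB' := FB' _ _ bF; have := B'Z _ bB'; rewrite Zi in_shell /= => /andP[_ bn].
  have b1 : 1 < nrm b by apply: le_lt_trans bn; rewrite exprn_ege1// ler1n.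
  have b0 : b != 0 by apply/eqP => b0; rewrite b0 nrm0 ltxx in b1.
  rewrite (nrm_neq0 b0) in bn.
  have hr x y : x \in F q -> y \in F q -> enorm (x - y) <= if h == 0%N then 0 else d%:R * 2 ^+ h.
    rewrite !inE /= => /andP[_ /eqP xq] /andP[_ /eqP yq].
    case: eqP => [h0|_].
      have xy : x = y by have := xq; rewrite -yq h0 !cell0.
      by rewrite xy subrr enorm0.
    apply: enorm_le_coord => r; rewrite -intr_norm.
    have -> : 2 ^+ h = ((2 ^+ h)%:~R : R) by rewrite rmorphXn.
    by rewrite ler_int; apply: cell_same_near; rewrite xq yq.
  have FZ : {subset F q <= Z i} by move=> z /FB' /B'Z.
  have := hit_bounds i bF b0 hr _; rewrite -(hPE _ FZ) !lee_fin => /(_ _)/andP[|_ hh].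
    case: eqP => [_|hn0]; first by rewrite mulr0 enorm_ge0.
    apply: le_trans (ltW bn); case: side => [side|//].
    move: side; rewrite exprS; lra.
  apply: le_trans hh _; rewrite -[leRHS]mulrA -[leLHS]mulrA -[X in _ <= X]mulrA ler_wpM2l ?(ltW C0)//.
  rewrite mulrA; apply: ler_pM; rewrite ?powR_ge0 ?capacity_ge0 ?(ltW al0)//; last first.
    by apply: capacity_mono; [exact: ltW|move=> z /FB' /B'B].
  apply: le_trans (ler_powRN (ltW be0) _ (ltW bn)) _; first by rewrite exprn_gt0.
  rewrite exprS powRM ?exprn_ge0// mulrA -[leLHS]mul1r ler_wpM2r ?powR_ge0//.
  rewrite -powR_mulrn// -powRD; last by rewrite (gt_eqF (ltr0n _ 2)) implybT.
  by rewrite -[leLHS](powRr0 (2 : R)) ler_powR ?ler1n// subr_ge0 ltW.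
apply: le_trans (ler_sum _ (fun q _ => Fle q)) _.
rewrite big_const_seq count_predT iter_addr_0 -[leLHS]mulr_natl /shell_const -/m.
have u0 : 0 <= (2 ^+ j.+1 : R) `^ (- beta i) by exact: powR_ge0.
have v0 := capacity_ge0 B (ltW al0).
move: (_ `^ (- beta i)) u0 (capacity _ _) v0 => u u0 v v0.
set n := (#|` _|)%:R.
have -> : n * (C * 2 ^+ d * u * v) = n * (C * 2 ^+ d) * (u * v) by ring.
by rewrite -[leRHS]mulrA ler_wpM2r ?mulr_ge0// lerDr.
Qed.
End HitBounds.

(** * The upper bound *)

Lemma uniform_const {R : realType} (J : eqType) (s : seq J) (Q : J -> R -> Prop) :
  (forall j C C', C <= C' -> Q j C -> Q j C') ->
  (forall j, j \in s -> exists2 C : R, 0 < C & Q j C) ->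
  exists2 C : R, 0 < C & forall j, j \in s -> Q j C.
Proof.
move=> mono; elim: s => [|j s IH] h; first by exists 1.
have [|C1 C10 h1] := IH; first by move=> i iS; apply: h; rewrite inE iS orbT.
have [C2 C20 h2] := h j (mem_head _ _).
exists (C1 + C2) => [|i]; first by rewrite addr_gt0.
rewrite inE => /orP[/eqP->|iS].
  by apply: mono h2; rewrite lerDr ltW.
by apply: mono (h1 i iS); rewrite lerDl ltW.
Qed.

Lemma measure_bigU_le {disp} {T : measurableType disp} {R : realType} (P : probability T R)
    (J : Type) (s : seq J) (E : J -> set T) : (forall j, measurable (E j)) ->
  (P (\big[setU/set0]_(j <- s) E j) <= \sum_(j <- s) P (E j))%E.
Proof.
move=> mE; elim: s => [|j s IH]; first by rewrite !big_nil measure0.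
rewrite !big_cons; apply: le_trans (measureU2 _ _ _) _ => //.
  exact: bigsetU_measurable.
exact: leeD2l.
Qed.

(** Conditioning on the sum of the other summands. *)
Lemma hit_sumlaw_cons {R : realType} {d : nat} (l : @law R d) ls (A : {fset 'rV[int]_d}) :
  hit (sumlaw (l :: ls)) A = Ex (sumlaw ls) (fun S => hit l (diffset A S)).
Proof.
rewrite /hit Ex_sumlaw_cons Ex_exchange.
apply: eq_Ex => q _; apply: eq_Ex => u _; congr (nat_of_bool _)%:R.
apply/meetsP/meetsP => -[x].
  move=> /sumsetP[a [b [au bq ->]]] abA; exists a => //; apply/diffsetP; exists (a + b), b.
  by rewrite addrK.
move=> xu /diffsetP[a [b [aA bq xE]]]; exists a => //; apply/sumsetP; exists x, b; split => //.
by rewrite xE subrK.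
Qed.

Section UpperLaw.
Context {R : realType} {d k : nat}.
Local Notation V := 'rV[int]_d.
Local Notation law := (@law R d).
Local Notation nrm := (@nrm R d).
Context (alpha beta : 'I_k -> R).
Hypothesis halpha : forall i, 0 < alpha i < d%:R.
Local Notation gam := (\sum_(i < k) alpha i - (k%:R - 1) * d%:R).
Hypothesis hgamma : 0 < gam.

(** The order left when the summands are removed does not depend on which of them
    comes first. *)
Lemma gamma_perm (i : 'I_k) (r : seq 'I_k) : perm_eq (i :: r) (enum 'I_k) ->
  alpha i + \sum_(j <- r) (alpha j - d%:R) = gam.
Proof.
move=> pr; have szr : (size r).+1 = k.
  by have := perm_size pr; rewrite /= size_enum_ord.
have -> : \sum_(j < k) alpha j = alpha i + \sum_(j <- r) alpha j.
  by rewrite -big_enum/= -(perm_big _ pr) big_cons.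
have kR : k%:R = (size r)%:R + 1 :> R by rewrite natr1 szr.
by rewrite sumrB big_const_seq count_predT iter_addr_0 -mulr_natr kR; ring.
Qed.

Definition scale_factor (Kc D : R) (s : 'I_k -> R) i :=
  Kc * (s i `^ (alpha i - beta i) * Num.max D (s i) `^ (d%:R - alpha i)).

(** Removing a summand costs, besides its hitting probability, a factor
    [s ^ alpha * max(D, s) ^ (d - alpha)]. The first summand, taken at the largest
    scale, is not removed but hits what remains, whence the power
    [s i0 ^ - d]. *)
Lemma hit_sumlaw_le : exists2 C : R, 0 < C &
  forall (lw : 'I_k -> law) (Kc D : R) (s : 'I_k -> R) (A : {fset V}),
    0 <= Kc -> 1 <= D -> (forall i, 1 <= s i) ->
    (forall i, nonneg_law (lw i)) ->
    (forall i q x, q \in lw i -> x \in q.2 -> nrm x <= s i) ->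
    (forall i B, hit (lw i) B <= Kc * s i `^ (- beta i) * capacity (alpha i) B) ->
    (forall x y, x \in A -> y \in A -> nrm (x - y) <= D) ->
    forall i0 r, perm_eq (i0 :: r) (enum 'I_k) -> pairwise (fun i j => s j <= s i) (i0 :: r) ->
    hit (sumlaw (map lw (i0 :: r))) A <=
      C * s i0 `^ (- d%:R) * (\prod_(i < k) scale_factor Kc D s i) * capacity gam A.
Proof.
pose Q (p : seq 'I_k) (C : R) := if p is i0 :: r then
  forall (lw : 'I_k -> law) (Kc D : R) (s : 'I_k -> R) (A : {fset V}),
    0 <= Kc -> 1 <= D -> (forall i, 1 <= s i) ->
    (forall i, nonneg_law (lw i)) ->
    (forall i q x, q \in lw i -> x \in q.2 -> nrm x <= s i) ->
    (forall i B, hit (lw i) B <= Kc * s i `^ (- beta i) * capacity (alpha i) B) ->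
    (forall x y, x \in A -> y \in A -> nrm (x - y) <= D) ->
    perm_eq (i0 :: r) (enum 'I_k) -> pairwise (fun i j => s j <= s i) (i0 :: r) ->
    hit (sumlaw (map lw (i0 :: r))) A <=
      C * s i0 `^ (- d%:R) * (\prod_(i < k) scale_factor Kc D s i) * capacity gam A else True.
have [] := @uniform_const R _ (permutations (enum 'I_k)) Q.
- move=> [|i0 r] C C' CC' // h lw Kc D s A Kc0 D1 s1 l0 ls lK hA pr sr.
  apply: le_trans (h lw Kc D s A Kc0 D1 s1 l0 ls lK hA pr sr) _.
  rewrite ler_wpM2r ?capacity_ge0 ?(ltW hgamma)// ler_wpM2r; last first.
  - by rewrite ler_wpM2r ?powR_ge0.
  - by apply: prodr_ge0 => i _; rewrite /scale_factor !mulr_ge0 ?powR_ge0.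
  - by [].
- move=> [|i0 r]; first by exists 1.
  rewrite mem_permutations => pr.
  have hr : 0 < alpha i0 + \sum_(i <- r) (alpha i - d%:R) by rewrite gamma_perm.
  have [C C0 hC] := Ex_sumlaw_capacity_le halpha (halpha i0) hr.
  exists C => // lw Kc D s A Kc0 D1 s1 l0 ls lK hA _ sr.
  have s0 i : 0 < s i by apply: lt_le_trans (s1 i).
  rewrite map_cons hit_sumlaw_cons.
  pose K i := Kc * s i `^ (- beta i).
  have K0 i : 0 <= K i by rewrite mulr_ge0 ?powR_ge0.
  apply: (@le_trans _ _ (K i0 * Ex (sumlaw (map lw r)) (fun S => capacity (alpha i0) (diffset A S)))).
    by rewrite -ExZ; apply: ler_Ex => [|q _]; [exact: sumlaw_nonneg|exact: lK].
  move: sr => /= /andP[_ sr].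
  have := hC lw K s D A K0 s1 D1 sr l0 ls (fun i B _ => lK i B) hA.
  rewrite gamma_perm// => h; apply: le_trans (ler_wpM2l (K0 i0) h) _.
  have KE i : K i * (s i `^ alpha i * Num.max D (s i) `^ (d%:R - alpha i)) = scale_factor Kc D s i.
    rewrite /K /scale_factor [s i `^ (alpha i - beta i)]powRD; last by rewrite (gt_eqF (s0 i)) implybT.
    by ring.
  rewrite (eq_bigr _ (fun i _ => KE i)).
  have -> : \prod_(i < k) scale_factor Kc D s i = scale_factor Kc D s i0 * \prod_(i <- r) scale_factor Kc D s i.
    by rewrite -big_enum/= -(perm_big _ pr) big_cons.
  have K1 : K i0 <= s i0 `^ (- d%:R) * scale_factor Kc D s i0.
    rewrite /scale_factor mulrCA /K ler_wpM2l//.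
    have rD (u v : R) : s i0 `^ (u + v) = s i0 `^ u * s i0 `^ v.
      by rewrite powRD// (gt_eqF (s0 i0)) implybT.
    have -> : s i0 `^ (- beta i0) = s i0 `^ (- d%:R) * (s i0 `^ (alpha i0 - beta i0) * s i0 `^ (d%:R - alpha i0)).
      by rewrite -!rD; congr (_ `^ _); ring.
    rewrite ler_wpM2l ?powR_ge0// ler_wpM2l ?powR_ge0//.
    have /andP[_ /ltW ad] := halpha i0.
    by rewrite ge0_ler_powR ?subr_ge0 ?nnegrE ?le_max ?lexx ?orbT ?(ltW (s0 i0)) ?orbT.
  have P0 : 0 <= C * (\prod_(i <- r) scale_factor Kc D s i) * capacity gam A.
    rewrite mulr_ge0 ?capacity_ge0 ?(ltW hgamma)// mulr_ge0 ?(ltW C0)//.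
    by apply: prodr_ge0 => i _; rewrite /scale_factor !mulr_ge0 ?powR_ge0.
  apply: le_trans (ler_wpM2r P0 K1) _.
  by apply: eq_ler; ring.
move=> C C0 hC; exists C => // lw Kc D s A Kc0 D1 s1 l0 ls lK hA i0 r pr sr.
by have := hC (i0 :: r); rewrite mem_permutations => /(_ pr); exact.
Qed.
End UpperLaw.

(** Reduces sums of infinite random sets to sums of finite windows, whose law is
    explicit. *)
Lemma hits_minkowski_windows {disp} {T : measurableType disp} (R : realType) (d k : nat)
    (X : 'I_k -> T -> set 'rV[int]_d) (B : {fset 'rV[int]_d}) :
  [set w | (\big[@minkowski_sum _/[set 0]]_(i < k) X i w `&` [set` B]) !=set0] =
  \bigcup_M [set w | meets (window_sum X (fun _ => ball 0 (2 ^+ M : R)) (enum 'I_k) w) B].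
Proof.
have uen : uniq (enum 'I_k) by exact: enum_uniq.
apply/seteqP; split => w.
  move=> [z [/mem_minkowski_big[g [hg zE]] zB]].
  have [M hM] : exists M, forall i, nrm (g i) <= (2 ^+ M : R).
    exists (Num.truncn (\sum_i nrm (g i) : R)).+1 => i.
    have sum0 : 0 <= \sum_i nrm (g i) :> R by apply: sumr_ge0 => i' _; exact: nrm_ge0.
    have /andP[_ h] := truncn_itv sum0.
    have h1 : nrm (g i) <= \sum_i nrm (g i) :> R.
      by rewrite (bigD1 i)//= lerDl; apply: sumr_ge0 => i' _; exact: nrm_ge0.
    apply: le_trans h1 (ltW (lt_trans h _)).
    by rewrite -natrX ltr_nat ltn_expl.
  exists M => //; apply/meetsP; exists z => //.
  apply/(mem_window_sum _ _ _ _ uen); exists g; split; last by rewrite zE big_enum.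
  by move=> i _; split; [rewrite in_ball subr0|].
move=> [M _ /meetsP[z /(mem_window_sum _ _ _ _ uen)[g [hg zE]] zB]].
exists z; split => //.
apply/mem_minkowski_big; exists g; split; last by rewrite zE big_enum.
by move=> i; case: (hg i (mem_enum _ _)).
Qed.

Lemma translate_fset (V : zmodType) (x : V) (A : {fset V}) :
  translate x [set` A] = [set` [fset (x + a)%R | a in A]%fset].
Proof.
apply/seteqP; split => z /=; first by move=> [a aA <-]; apply/imfsetP; exists a.
by move=> /imfsetP[a /= aA ->]; exists a.
Qed.

(** The event is covered by the events that the sum of the parts in given shells
    meets [x + A]. Those whose largest radius [2 ^ J] is too small compared with
    [|x|] are empty, and the others are bounded by a product of functions of the
    individual scales; the sum over the tuples of scales below [J] is therefore
    a product of sums over scales. *)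
Lemma upper_bound (R : realType) (d k : nat) (hk : (1 <= k)%N) (alpha beta : 'I_k -> R)
    (halpha : forall i, 0 < alpha i < d%:R)
    (hbeta : forall i, 0 < beta i < d%:R)
    (hgamma : 0 < \sum_(i < k) alpha i - (k%:R - 1) * d%:R)
    (hbetasum : 0 < \sum_(i < k) beta i - (k%:R - 1) * d%:R)
    (c C : R) (c0 : 0 < c) (C0 : 0 < C) :
  exists2 C' : R, 0 < C' &
  forall (disp : measure_display) (T : measurableType disp)
    (P : probability T R) (X : 'I_k -> T -> set 'rV[int]_d),
    (forall i, random_subset (X i)) ->
    mutually_independent P X ->
    capacity_hitting P X alpha beta c C ->
    forall (A : {fset 'rV[int]_d}) (x : 'rV[int]_d),
      0 \in A -> x != 0 ->
      2 * diam R A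
        + \big[Num.max/0]_(i < k)
            (if alpha i <= beta i then
               diam R A `^ ((d%:R - alpha i) / (d%:R - beta i))
                 * ln (diam R A + 1) `^ (d%:R - beta i)^-1
             else 0)
        <= enorm R x ->
      (P (hits (fun w => (\big[@minkowski_sum _/[set 0]]_(i < k) X i w)%R) (translate x [set` A]))
         <= (C' * enorm R x `^ ((k%:R - 1) * d%:R - \sum_(i < k) beta i) *
              capacity (\sum_(i < k) alpha i - (k%:R - 1) * d%:R) A)%:E)%E.
Proof.
set gam := \sum_(i < k) alpha i - (k%:R - 1) * d%:R.
set e := (k%:R - 1) * d%:R - \sum_(i < k) beta i.
have e0 : e < 0 by rewrite /e -oppr_gt0 opprB.
have k0 : 0 < k%:R :> R by rewrite ltr0n.
have kk0 : 0 < 2 * k%:R :> R by rewrite mulr_gt0.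
have [C2 C20 hC2] := @hit_sumlaw_le R d k alpha beta halpha hgamma.
have /choice[C3 hC3] : forall i, exists C3 : R, 0 < C3 /\ forall (r N : R) (J : nat), 0 <= r ->
    2 * r + (if alpha i <= beta i then r `^ ((d%:R - alpha i) / (d%:R - beta i)) * ln (r + 1) `^ (d%:R - beta i)^-1 else 0) <= N ->
    N <= (2 * k%:R) * 2 ^+ J ->
    \sum_(m < J.+1) (2 ^+ m) `^ (alpha i - beta i) * Num.max (Num.max r 1) (2 ^+ m) `^ (d%:R - alpha i)
      <= C3 * (2 ^+ J) `^ (d%:R - beta i).
  by move=> i; have [C3 ? ?] := sum_scales_le (halpha i) (hbeta i) kk0; exists C3.
pose Kc := @shell_const R d C.
have Kc0 : 0 < Kc by exact: shell_const_gt0.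
pose p : R := 2 `^ e.
have p0 : 0 < p by rewrite powR_gt0.
have p1 : p < 1 by rewrite powR_lt1 ?ltr1n.
have p01 : 0 < p < 1 by rewrite p0.
pose C4 := \prod_(i < k) (Kc * C3 i).
have C40 : 0 < C4 by apply: prodr_gt0 => i _; rewrite mulr_gt0//; case: (hC3 i).
pose C' := C2 * C4 * ((2 * k%:R)^-1 `^ e / (1 - p)).
have C'0 : 0 < C'.
  by rewrite /C' !mulr_gt0 ?powR_gt0 ?invr_gt0 ?subr_gt0.
exists C' => // disp T P X mX iX hX A x A0 x0 hx.
set N := enorm R x in hx *.
pose D0 := diam R A; pose D := Num.max D0 1.
have D00 : 0 <= D0 by have := @le_diam R _ _ _ _ A0 A0; rewrite subrr enorm0.
have D1 : 1 <= D by rewrite /D le_max lexx orbT.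
have N0 : 0 < N by apply: lt_le_trans (enorm_ge1 x0).
have D0N : 2 * D0 <= N.
  apply: le_trans hx; rewrite lerDl; exact: bigmax_ge_id.
have hxi i : 2 * D0 + (if alpha i <= beta i then D0 `^ ((d%:R - alpha i) / (d%:R - beta i)) * ln (D0 + 1) `^ (d%:R - beta i)^-1 else 0) <= N.
  apply: le_trans hx; rewrite lerD2l.
  exact: (@le_bigmax_seq _ R _ (index_enum 'I_k) 0 i xpredT (fun i => if alpha i <= beta i then D0 `^ ((d%:R - alpha i) / (d%:R - beta i)) * ln (D0 + 1) `^ (d%:R - beta i)^-1 else 0) (mem_index_enum i) isT).
pose xA := [fset (x + a)%R | a in A]%fset.
have capxA : capacity gam xA = capacity gam A.
  apply: (@capacity_isom _ _ _ A _ (fun z => - x + z)) => [z|z||u v].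
  - by rewrite addKr.
  - by rewrite addNKr.
  - exact: ltW.
  - by rewrite opprD addrACA subrr add0r.
have diamxA u v : u \in xA -> v \in xA -> nrm (u - v) <= D.
  move=> /imfsetP[a /= aA ->] /imfsetP[b /= bA ->].
  by rewrite opprD addrACA subrr add0r nrmE /D ge_max !le_max lexx orbT andbT le_diam.
pose en := enum 'I_k.
have uen : uniq en by exact: enum_uniq.
pose Zs (j : 'I_k -> nat) i := @shell R d (j i).
pose Ev (j : 'I_k -> nat) := [set w | meets (window_sum X (Zs j) en w) xA].
pose G (J : nat) i (m : nat) : R := if (m <= J)%N then
  Kc * ((2 ^+ m) `^ (alpha i - beta i) * Num.max D (2 ^+ m) `^ (d%:R - alpha i)) else 0.
have G0 J i m : 0 <= G J i m by rewrite /G; case: ifP => // _; rewrite !mulr_ge0 ?powR_ge0 ?(ltW Kc0).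
pose W (J : nat) : R := if N <= 2 * k%:R * 2 ^+ J then C2 * (2 ^+ J) `^ (- d%:R) * capacity gam A else 0.
have W0 J : 0 <= W J.
  by rewrite /W; case: ifP => // _; rewrite !mulr_ge0 ?powR_ge0 ?(ltW C20) ?capacity_ge0 ?(ltW hgamma).
(* The term J = max j alone bounds the probability; writing the bound as a sum
   over J makes it summable over all tuples j. *)
have PEv M (j : 'I_k -> nat) : (forall i, (j i <= M)%N) ->
    (P (Ev j) <= (\sum_(J < M.+1) W J * \prod_(i < k) G J i (j i))%:E)%E.
  move=> jM.
  pose le_j (a b : 'I_k) := (j b <= j a)%N.
  have pr : perm_eq (sort le_j en) en by rewrite perm_sort.
  have sr : pairwise le_j (sort le_j en).
    rewrite -sorted_pairwise; last by move=> a b c' h1 h2; exact: leq_trans h2 h1.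
    by apply: sort_sorted => a b; exact: leq_total.
  case Er : (sort le_j en) pr sr => [|i0 r] pr sr.
    by have := perm_size pr; rewrite size_enum_ord /= => kz; rewrite -kz in hk.
  have ur : uniq (i0 :: r) by rewrite (perm_uniq pr).
  have jmax i : (j i <= j i0)%N.
    have : i \in i0 :: r by rewrite (perm_mem pr) mem_enum.
    rewrite inE => /orP[/eqP->//|ir]; move: sr => /= /andP[/allP h _]; exact: h.
  have EvE : Ev j = [set w | meets (window_sum X (Zs j) (i0 :: r) w) xA].
    have mem w z : (z \in window_sum X (Zs j) en w) = (z \in window_sum X (Zs j) (i0 :: r) w).
      apply/idP/idP => /mem_window_sum.
        move=> /(_ uen)[g [hg ->]]; apply/(mem_window_sum _ _ _ _ ur).
        exists g; split; last by rewrite (perm_big _ pr).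
        by move=> i ir; apply: hg; rewrite -(perm_mem pr).
      move=> /(_ ur)[g [hg ->]]; apply/(mem_window_sum _ _ _ _ uen).
      exists g; split; last by rewrite (perm_big _ pr).
      by move=> i ir; apply: hg; rewrite (perm_mem pr).
    by rewrite /Ev; apply/seteqP; split => w /= /meetsP[z zw zA]; apply/meetsP; exists z; rewrite ?mem// -mem.
  have term_le J : 0 <= W J * \prod_(i < k) G J i (j i).
    by rewrite mulr_ge0//; apply: prodr_ge0.
  rewrite (bigD1 (Ordinal (jM i0 : (j i0 < M.+1)%N)))//= -[leLHS]adde0 EFinD leeD//; last first.
    by rewrite lee_fin; apply: sumr_ge0.
  (* A sum of k points of norm at most [2 ^ j i0] cannot reach x + A when
     [|x|] exceeds [2 k 2 ^ j i0], since the diameter of A is at most [|x| / 2]. *)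
  have [far|near] := ltP (2 * k%:R * 2 ^+ j i0) N.
    rewrite (_ : Ev j = set0) ?measure0 ?lee_fin//; apply/seteqP; split => // w /meetsP[z].
    move=> /(mem_window_sum _ _ _ _ uen)[g [hg ->]] /imfsetP[a /= aA sE].
    have h1 : enorm R (\sum_(i <- en) g i) <= \sum_(i <- en) 2 ^+ j i0.
      elim: (en) (hg) => [|i en' IH] hg'; first by rewrite !big_nil enorm0.
      rewrite !big_cons; apply: le_trans (ler_enormD _ _) _; rewrite lerD//.
        have [gi _] := hg' i (mem_head _ _); apply: le_trans (enorm_nrm _) _.
        apply: le_trans (shell_nrm gi) _; rewrite ler_eXn2l ?ltr1n//; exact: jmax.
      by apply: IH => i' h; apply: hg'; rewrite inE h orbT.
    rewrite big_const_seq count_predT iter_addr_0 size_enum_ord sE -[leRHS]mulr_natl in h1.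
    have h2 : N <= enorm R (x + a) + D0.
      have := @ler_enormD R _ (x + a) (- a); rewrite addrK enormN.
      have := @le_diam R _ _ _ _ aA A0; rewrite subr0 -/D0 -/N; clear; lra.
    by clear -D0N far h1 h2; lra.
  rewrite EvE (window_sum_law mX iX (Zs j) (fun S => meets S xA) ur) lee_fin.
  have := hC2 (window_law P X (Zs j)) Kc D (fun i => 2 ^+ j i) xA (ltW Kc0) D1 _ _ _ _ diamxA i0 r pr.
  rewrite capxA; move=> h; apply: le_trans (h _ _ _ _ _) _.
  - by move=> i; rewrite exprn_ege1// ler1n.
  - by move=> i; exact: window_law_nonneg.
  - move=> i q z ql zq; apply: (@shell_nrm R d); exact: window_law_sub ql zq.
  - by move=> i B; exact: (@hit_shell_le _ _ _ P _ _ X alpha beta c C).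
  - by apply: sub_pairwise sr => a b; rewrite /le_j ler_eXn2l ?ltr1n.
  rewrite /W near.
  have -> : \prod_(i < k) G (j i0) i (j i) = \prod_(i < k) @scale_factor R d k alpha beta Kc D (fun i => 2 ^+ j i) i.
    by apply: eq_bigr => i _; rewrite /G jmax.
  by apply: eq_ler; ring.
pose HM (M : nat) := [set w | meets (window_sum X (fun _ => ball 0 (2 ^+ M : R)) en w) xA].
have HMle M : (P (HM M) <= (C' * N `^ e * capacity gam A)%:E)%E.
  pose tup := index_enum {ffun 'I_k -> 'I_M.+1}.
  have mEv j : measurable (Ev j) by exact: (measurable_window_sum mX (Zs j) en (fun S => meets S xA)).
  apply: (@le_trans _ _ (P (\big[setU/set0]_(j <- tup) Ev (fun i => j i : nat)))).
    apply: le_measure; rewrite ?inE.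
    - exact: (measurable_window_sum mX _ en (fun S => meets S xA)).
    - by apply: bigsetU_measurable => j _; exact: mEv.
    move=> w /= /meetsP[z /(mem_window_sum _ _ _ _ uen)[g [hg ->]] sA].
    have /choice[j hj] : forall i, exists j : 'I_M.+1, g i \in @shell R d j.
      move=> i; have [gb _] := hg i (mem_enum _ _); rewrite in_ball subr0 in gb.
      have ex : exists j, nrm (g i) <= (2 ^+ j : R) by exists M.
      have [j jh jmin] := ex_minnP ex.
      have jM : (j < M.+1)%N by rewrite ltnS; exact: jmin.
      exists (Ordinal jM); rewrite in_shell jh /=.
      case: j jh jmin jM => //= j jh jmin jM; rewrite ltNge; apply/negP => /jmin.
      by rewrite ltnn.
    rewrite -bigcup_seq; exists [ffun i => j i]; first by rewrite /= mem_index_enum.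
    apply/meetsP; exists (\sum_(i <- en) g i) => //; apply/(mem_window_sum _ _ _ _ uen).
    exists g; split => // i ie; have [_ Xg] := hg i ie; split => //.
    by rewrite /Zs ffunE; exact: hj.
  apply: le_trans (measure_bigU_le P tup _) _; first by move=> j; exact: mEv.
  apply: (@le_trans _ _ (\sum_(j <- tup) (\sum_(J < M.+1) W J * \prod_(i < k) G J i (j i))%:E)%E).
    by apply: lee_sum => j _; apply: PEv => i; rewrite -ltnS.
  rewrite sumEFin lee_fin exchange_big/=.
  pose U := \sum_(J < M.+1) C2 * C4 * capacity gam A * (p ^+ J * ((2 * k%:R)^-1 * N <= 2 ^+ J)%R%:R).
  have step : \sum_(J < M.+1) \sum_(j <- tup) W J * \prod_(i < k) G J i (j i) <= U.
    apply: ler_sum => J _; rewrite -mulr_sumr -(bigA_distr_bigA (fun i (m : 'I_M.+1) => G J i m)).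
    rewrite /W mulrC [_^-1 * _]mulrC ler_pdivrMr// [2 ^+ J * _]mulrC.
    case: ifP => [near|_]; last by rewrite !mulr0.
    rewrite mulr1.
    have GJ i : \sum_(m < M.+1) G J i m <= Kc * C3 i * (2 ^+ J) `^ (d%:R - beta i).
      have -> : \sum_(m < M.+1) G J i m = Kc * \sum_(m < J.+1) (2 ^+ m) `^ (alpha i - beta i) * Num.max D (2 ^+ m) `^ (d%:R - alpha i).
        rewrite (big_ord_widen M.+1 (fun m => (2 ^+ m) `^ (alpha i - beta i) * Num.max D (2 ^+ m) `^ (d%:R - alpha i))); last exact: ltn_ord.
        by rewrite mulr_sumr [RHS]big_mkcond/=; apply: eq_bigr => m _; rewrite /G ltnS.
      by rewrite -mulrA ler_wpM2l ?(ltW Kc0)//; case: (hC3 i) => _; apply.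
    apply: (@le_trans _ _ ((\prod_(i < k) (Kc * C3 i * (2 ^+ J) `^ (d%:R - beta i))) * (C2 * (2 ^+ J) `^ (- d%:R) * capacity gam A))).
      rewrite ler_wpM2r//.
        by rewrite !mulr_ge0 ?powR_ge0 ?(ltW C20) ?capacity_ge0 ?(ltW hgamma).
      by apply: ler_prod => i _; rewrite GJ andbT sumr_ge0.
    rewrite big_split/= -/C4.
    have J0 : 0 < 2 ^+ J :> R by rewrite exprn_gt0.
    have -> : \prod_(i < k) (2 ^+ J) `^ (d%:R - beta i) = (2 ^+ J) `^ (\sum_(i < k) (d%:R - beta i)) :> R.
      elim/big_rec2: _ => [|i y1 y2 _ ->]; first by rewrite powRr0.
      by rewrite [RHS]powRD// (gt_eqF J0) implybT.
    have -> : p ^+ J = (2 ^+ J) `^ (\sum_(i < k) (d%:R - beta i)) * (2 ^+ J) `^ (- d%:R) :> R.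
      rewrite -powRD ?(gt_eqF J0) ?implybT// /p -expr_powR//; congr (_ `^ _).
      rewrite sumrB sumr_const card_ord /e -mulr_natl; ring.
    by apply: eq_ler; ring.
  apply: le_trans step _; rewrite /U.
  rewrite -mulr_sumr.
  have NX : 0 <= (2 * k%:R)^-1 * N by rewrite mulr_ge0 ?invr_ge0 ?(ltW kk0) ?(ltW N0).
  have NXp : 0 < (2 * k%:R)^-1 * N by rewrite mulr_gt0 ?invr_gt0.
  have := @geometric_indicator_le R p (((2 * k%:R)^-1 * N) `^ e) M (fun J => (2 * k%:R)^-1 * N <= 2 ^+ J) p01 (powR_ge0 _ _).
  move=> h; apply: le_trans (ler_wpM2l _ (h _)) _.
  - by rewrite !mulr_ge0 ?(ltW C20) ?(ltW C40) ?capacity_ge0 ?(ltW hgamma).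
  - move=> J _ NJ; rewrite /p -expr_powR// -[e]opprK; apply: ler_powRN => //.
    by rewrite oppr_ge0 ltW.
  rewrite powRM ?invr_ge0 ?(ltW kk0) ?(ltW N0)// /C'.
  by apply: eq_ler; ring.
have hitsE : hits (fun w => (\big[@minkowski_sum _/[set 0]]_(i < k) X i w)%R) (translate x [set` A]) = \bigcup_M HM M.
  by rewrite translate_fset /hits (hits_minkowski_windows R).
have mHM M : measurable (HM M) by exact: (measurable_window_sum mX _ en (fun S => meets S xA)).
rewrite hitsE.
have cvg : (P \o HM) n @[n --> \oo] --> P (\bigcup_M HM M).
  apply: nondecreasing_cvg_mu => //; first exact: bigcup_measurable.
  move=> n m nm; apply/subsetPset => w /= /meetsP[z /(mem_window_sum _ _ _ _ uen)[g [hg zE]] zA].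
  apply/meetsP; exists z => //; apply/(mem_window_sum _ _ _ _ uen); exists g; split => // i ie.
  have [gb Xg] := hg i ie; split => //; move: gb; rewrite !in_ball => /le_trans; apply.
  by rewrite ler_eXn2l// ltr1n.
rewrite -(cvg_lim _ cvg)//; apply: lime_le; first by apply/cvg_ex; exists (P (\bigcup_M HM M)).
by apply: nearW => n; exact: HMle.
Qed.

(** * The lower bound *)

Section LowerGeometry.
Context {R : realType} {d : nat}.
Local Notation V := 'rV[int]_d.
Local Notation law := (@law R d).
Local Notation enorm := (enorm R).
Implicit Types (x v : V).

Lemma enormZ (z : int) v : enorm (z *: v) = `|z|%:~R * enorm v.
Proof.
rewrite /Defs.enorm intr_norm -sqrtr_sqr -sqrtrM ?sqr_ge0//; congr Num.sqrt.
by rewrite mulr_sumr; apply: eq_bigr => j _; rewrite mxE rmorphM exprMn.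
Qed.

(** The centres of the windows are multiples of one point by these coefficients,
    whose sum is one and which do not vanish: alternating signs, corrected at the
    first index when [k] is even. *)
Definition centre_coef (k i : nat) : int := (-1) ^+ i + ((i == 0%N) && ~~ odd k)%:Z.

Lemma sum_centre_coef k : (1 <= k)%N -> \sum_(i < k) centre_coef k i = 1.
Proof.
move=> k1; rewrite big_split/=.
have -> : \sum_(i < k) (-1) ^+ i = (odd k)%:Z.
  elim: (k) => [|n IH]; first by rewrite big_ord0.
  by rewrite big_ord_recr/= IH -signr_odd; case: (odd n).
case: k k1 => // k _; rewrite big_ord_recl big1 ?addr0//=.
by case: (odd k).
Qed.

Lemma centre_coef_norm k i : 1 <= `|centre_coef k i| <= 2.
Proof.
rewrite /centre_coef; case: i => [|i]; first by case: (odd k).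
by rewrite /= addr0 normrX normrN1 expr1n.
Qed.

Lemma sumlaw_near (I : eqType) (lw : I -> law) (c : I -> V) (m : nat) (r : seq I) :
  (forall i q x, i \in r -> q \in lw i -> x \in q.2 -> x \in cube (c i) m) ->
  forall q x, q \in sumlaw (map lw r) -> x \in q.2 -> x \in cube (\sum_(i <- r) c i) (size r * m).
Proof.
elim: r => [_|i r IH hs] q x.
  rewrite inE => /eqP -> /=; rewrite inE => /eqP ->; rewrite big_nil in_cube subrr.
  by apply/forallP => j; rewrite mxE normr0.
move=> /allpairsP[[u v] /= [ul vl ->]] /= /sumsetP[y [z [yu zv ->]]].
have hy := hs i _ _ (mem_head _ _) ul yu.
have hz := IH (fun i' q' x' ir => hs i' q' x' (mem_behead (s := i :: r) ir)) _ _ vl zv.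
move: hy hz; rewrite !in_cube big_cons => /forallP hy /forallP hz.
apply/forallP => j; rewrite opprD addrACA mxE mulSn PoszD.
by apply: le_trans (ler_normD _ _) _; rewrite lerD.
Qed.

Lemma divz_small (m n : nat) (s : int) : `|s| <= n%:Z * m.+1%:Z -> `|divz s m.+1| <= n%:Z.
Proof.
have := divz_eq s m.+1.
have := ltz_pmod s (isT : (0 : int) < m.+1); have := modz_ge0 s (isT : m.+1%:Z != 0).
move: (modz s _) (divz s _) => a q; nia.
Qed.

(** The coordinates are divided by [m.+1]; there are at most [(2 E + 1) ^ d] possible
    quotients, and [capacity_pieces] applies. *)
Lemma capacity_block (s : R) (E : nat) : 0 <= s -> exists2 C : R, 0 < C &
  forall (A : {fset V}) (m : nat), 0 \in A -> (forall a j, a \in A -> `|a 0 j| <= E%:Z * m.+1%:Z) ->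
  exists A' : {fset V}, [/\ {subset A' <= A}, A' != fset0,
    forall a b j, a \in A' -> b \in A' -> `|(a - b) 0 j| <= m%:Z &
    capacity s A <= C * capacity s A'].
Proof.
move=> s0; pose I : finType := option (cube (0 : V) E).
exists (2 * #|I|%:R ^+ 2).
  by rewrite mulr_gt0// exprn_gt0// ltr0n; apply/card_gt0P; exists None.
move=> A m A0 hA; pose block (a : V) : V := \row_j divz (a 0 j) m.+1.
pose phi a : I := insub (block a).
have AN : A != fset0 by apply/fset0Pn; exists 0.
have [i [iN hi]] := capacity_pieces phi s0 AN.
exists [fset x in A | phi x == i]%fset; split => //.
  by move=> a; rewrite !inE => /andP[].
have blk a : a \in A -> block a \in cube (0 : V) E.
  move=> aA; rewrite in_cube; apply/forallP => j; rewrite subr0 mxE.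
  by apply: divz_small; exact: hA.
move=> a b j; rewrite !inE /= => /andP[aA /eqP pa] /andP[bA /eqP pb].
rewrite -ltzD1 [m%:Z + _]addrC -intS.
rewrite !mxE; apply: divz_same_near => //.
have : phi a = phi b by rewrite pa.
rewrite /phi (insubT (mem (cube (0 : V) E)) (blk a aA)) (insubT (mem (cube (0 : V) E)) (blk b bA)).
by move=> [] /rowP /(_ j); rewrite !mxE.
Qed.
End LowerGeometry.

(** Windows of side a small multiple of [|x|] around the centres [c_i] are far enough
    from the origin for the hypothesis to apply to all their subsets. The window
    of the first summand is larger, so that it contains every difference of
    a point of the chosen block of [x + A] and a sum of points of the other
    windows. *)
Lemma lower_bound (R : realType) (d k : nat) (hk : (1 <= k)%N) (alpha beta : 'I_k -> R)
    (halpha : forall i, 0 < alpha i < d%:R)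
    (hbeta : forall i, 0 < beta i < d%:R)
    (hgamma : 0 < \sum_(i < k) alpha i - (k%:R - 1) * d%:R)
    (c C : R) (c0 : 0 < c) (C0 : 0 < C) :
  exists2 c' : R, 0 < c' &
  forall (disp : measure_display) (T : measurableType disp)
    (P : probability T R) (X : 'I_k -> T -> set 'rV[int]_d),
    (forall i, random_subset (X i)) ->
    mutually_independent P X ->
    capacity_hitting P X alpha beta c C ->
    forall (A : {fset 'rV[int]_d}) (x : 'rV[int]_d),
      0 \in A -> x != 0 -> 2 * diam R A <= enorm R x ->
      ((c' * enorm R x `^ ((k%:R - 1) * d%:R - \sum_(i < k) beta i) *
              capacity (\sum_(i < k) alpha i - (k%:R - 1) * d%:R) A)%:E
       <= P (hits (fun w => (\big[@minkowski_sum _/[set 0]]_(i < k) X i w)%R) (translate x [set` A])))%E.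
Proof.
set gam := \sum_(i < k) alpha i - (k%:R - 1) * d%:R.
set e := (k%:R - 1) * d%:R - \sum_(i < k) beta i.
case Er : (enum 'I_k) => [|i0 r].
  by have := size_enum_ord k; rewrite Er /= => kz; rewrite -kz in hk.
have uen : uniq (i0 :: r) by rewrite -Er enum_uniq.
have szr : (size r).+1 = k by have := size_enum_ord k; rewrite Er.
have gE : alpha i0 + \sum_(i <- r) (alpha i - d%:R) = gam by rewrite gamma_perm// Er.
have bE : - beta i0 + \sum_(i <- r) (d%:R - beta i) = e.
  have := @gamma_perm R d k beta i0 r; rewrite Er perm_refl => /(_ isT) h.
  rewrite /e -[RHS]opprB -h opprD -sumrN; congr (_ + _).
  by apply: eq_bigr => i _; rewrite opprB.
have [|c1 c10 hc1] := @Ex_sumlaw_capacity_ge R d _ alpha r halpha _ (halpha i0); first by rewrite gE.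
(* The windows have side at most about [2 k |x| / E]; the factor 10 leaves room for
   twice their diameter, and d compares coordinates with the Euclidean norm. *)
pose E := (10 * k * d).+1.
have E0 : 0 < E%:R :> R by rewrite ltr0n.
have [C2 C20 hC2] := @capacity_block R d gam E (ltW hgamma).
pose kap i := c * 5 `^ (- beta i).
have kap0 i : 0 < kap i by rewrite mulr_gt0// powR_gt0.
pose Kr := \prod_(i <- r) (kap i * E%:R^-1 ^+ d).
have Kr0 : 0 < Kr by apply: prodr_gt0 => i _; rewrite mulr_gt0// exprn_gt0// invr_gt0.
exists (kap i0 * (c1 * Kr) * C2^-1); first by rewrite !mulr_gt0// invr_gt0.
move=> disp T P X mX iX hX A x A0 x0 hx.
set N := enorm R x in hx *.
have N0 : 0 < N by apply: lt_le_trans (enorm_ge1 x0).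
(* If [|x| < E] then m = 0, and all windows and blocks are points. *)
pose m := Num.truncn (N / E%:R).
have [mN Nm] : m%:R * E%:R <= N /\ N < m.+1%:R * E%:R.
  have := @truncn_itv R (N / E%:R); rewrite divr_ge0 ?(ltW N0) ?(ltW E0)// => /(_ isT).
  by rewrite -/m ler_pdivlMr// ltr_pdivrMr// => /andP.
have aN a : a \in A -> enorm R a <= N / 2.
  move=> aA; have := @le_diam R _ _ _ _ aA A0; rewrite subr0 => h.
  rewrite ler_pdivlMr//; move: h hx; clear; lra.
have [A' [A'A /fset0Pn[a0 a0A'] A'm capA']] : exists A' : {fset 'rV[int]_d}, [/\ {subset A' <= A}, A' != fset0,
    forall a b j, a \in A' -> b \in A' -> `|(a - b) 0 j| <= m%:Z &
    capacity gam A <= C2 * capacity gam A'].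
  apply: hC2 => // a j aA; rewrite -(ler_int R) intr_norm rmorphM/=.
  apply: le_trans (enorm_coord a j) _; apply: le_trans (aN a aA) _.
  rewrite -!pmulrn mulrC; move: Nm N0; clear; lra.
pose x' := x + a0.
have [x'lo x'hi] : N / 2 <= enorm R x' /\ enorm R x' <= 2 * N.
  have h0 := aN a0 (A'A _ a0A'); split; last first.
    have := @ler_enormD R _ x a0; rewrite -/x' -/N; move: h0 N0; clear; lra.
  have := @ler_enormD R _ x' (- a0); rewrite /x' addrK enormN -/x' -/N; move: h0; clear; lra.
pose cc (i : 'I_k) := centre_coef k i *: x'.
have cclo i : N / 2 <= enorm R (cc i).
  rewrite enormZ; have /andP[h _] := centre_coef_norm k i.
  apply: le_trans x'lo _; rewrite -[leLHS]mul1r ler_wpM2r ?enorm_ge0//.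
  by rewrite -(ler_int R) in h.
have cchi i : enorm R (cc i) <= 2 * (2 * N).
  rewrite enormZ; have /andP[_ h] := centre_coef_norm k i.
  by apply: ler_pM => //; rewrite ?enorm_ge0 ?ler0z// -(ler_int R) in h *.
have sumcc : cc i0 + \sum_(i <- r) cc i = x'.
  have -> : cc i0 + \sum_(i <- r) cc i = \sum_(i <- i0 :: r) cc i by rewrite big_cons.
  by rewrite -Er big_enum -scaler_suml sum_centre_coef// scale1r.
pose Z i := cube (cc i) (if i == i0 then k * m else m)%N.
have ZkM i : {subset Z i <= cube (cc i) (k * m)}.
  move=> b; rewrite /Z !in_cube => /forallP h; apply/forallP => j.
  apply: le_trans (h j) _; case: ifP => _ //.
  by rewrite lez_nat leq_pmull.
pose rho : R := d%:R * (k%:R * m%:R).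
have rho0 : 0 <= rho by rewrite !mulr_ge0.
have rhoN : 10 * rho <= N.
  have -> : 10 * rho = m%:R * (10 * k * d)%N%:R by rewrite /rho !natrM; ring.
  by apply: le_trans mN; rewrite ler_wpM2l// ler_nat.
have Zc i b : b \in Z i -> enorm R (b - cc i) <= rho.
  move=> /ZkM; rewrite in_cube => /forallP h; apply: enorm_le_coord => j.
  by have := h j; rewrite -(ler_int R) intr_norm PoszM rmorphM.
have Zlo i b : b \in Z i -> N / 2 - rho <= enorm R b.
  move=> /Zc h; have := @ler_enormB R _ (cc i) b 0; rewrite !subr0 enormB.
  move: (cclo i) h; clear; move: (enorm R _) (enorm R _) (enorm R _) => u v w; lra.
have Zhi i b : b \in Z i -> enorm R b <= 4 * N + rho.
  move=> /Zc h; have := @ler_enormB R _ b (cc i) 0; rewrite !subr0.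
  move: (cchi i) h; clear; move: (enorm R _) (enorm R _) (enorm R _) => u v w; lra.
pose lw := window_law P X Z.
have lw0 i : nonneg_law (lw i) by exact: window_law_nonneg.
pose K i := kap i * (N `^ (- beta i)).
have K0 i : 0 <= K i by rewrite mulr_ge0 ?powR_ge0 ?(ltW (kap0 i)).
have hitK i (B : {fset 'rV[int]_d}) : {subset B <= Z i} -> K i * capacity (alpha i) B <= hit (lw i) B.
  move=> BZ; have [->|/fset0Pn[b bB]] := eqVneq B fset0.
    by rewrite capacity_fset0 mulr0 hit_ge0.
  have b0 : b != 0.
    apply/eqP => b0; have := Zlo i b (BZ _ bB); rewrite b0 enorm0.
    move: rhoN N0; clear; lra.
  have hr u v : u \in B -> v \in B -> enorm R (u - v) <= 2 * rho.
    move=> /BZ/Zc hu /BZ/Zc hv; have := @ler_enormB R _ u (cc i) v.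
    rewrite [enorm R (cc i - v)]enormB; move: hu hv; clear.
    move: (enorm R _) (enorm R _) (enorm R _) => u' v' w; lra.
  have h2 : 2 * (2 * rho) <= enorm R b.
    apply: le_trans (Zlo i b (BZ _ bB)); move: rhoN; clear; lra.
  have /andP[be0 _] := hbeta i; have /andP[al0 _] := halpha i.
  have := hit_bounds halpha hX i bB b0 hr h2.
  rewrite -(hit_window_law mX iX BZ) !lee_fin => /andP[h _].
  apply: le_trans h; rewrite ler_wpM2r ?capacity_ge0 ?(ltW al0)//.
  rewrite /K /kap -mulrA ler_wpM2l ?(ltW c0)// -powRM ?(ltW N0)//.
  apply: ler_powRN; rewrite ?(ltW be0)//.
    by apply: lt_le_trans (enorm_ge1 b0).
  apply: le_trans (Zhi i b (BZ _ bB)) _.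
  move: rhoN rho0; clear; lra.
pose B0 := [fset (x + a)%R | a in A']%fset.
have capB0 : capacity gam B0 = capacity gam A'.
  apply: (@capacity_isom _ _ _ A' _ (fun z => - x + z)) => [z|z||u v].
  - by rewrite addKr.
  - by rewrite addNKr.
  - exact: ltW.
  - by rewrite opprD addrACA subrr add0r.
have diffZ q : q \in sumlaw (map lw r) -> {subset diffset B0 q.2 <= Z i0}.
  move=> qr u /diffsetP[_ [y [/imfsetP[a /= aA ->] yq ->]]].
  have := @sumlaw_near R d _ lw cc m r _ q y qr yq; rewrite in_cube => /(_ _)/forallP hy.
  rewrite in_cube eqxx; apply/forallP => j.
  have -> : x + a - y - cc i0 = (a - a0) - (y - \sum_(i <- r) cc i).
    have -> : x = cc i0 + \sum_(i <- r) cc i - a0 by rewrite sumcc /x' addrK.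
    by apply/rowP => j'; rewrite !mxE; ring.
  rewrite -[in leRHS]szr mulSn PoszD mxE; apply: le_trans (ler_normD _ _) _; apply: lerD.
    exact: A'm.
  rewrite mxE normrN; apply: hy => i q' z ir ql zq.
  have := window_law_sub ql zq; rewrite /Z.
  by case: eqP => // ii; move: uen; rewrite /= -ii ir.
have main : kap i0 * (c1 * Kr) * C2^-1 * N `^ e * capacity gam A <= hit (sumlaw (map lw (i0 :: r))) B0.
  rewrite map_cons hit_sumlaw_cons.
  apply: (@le_trans _ _ (K i0 * Ex (sumlaw (map lw r)) (fun S => capacity (alpha i0) (diffset B0 S)))); last first.
    by rewrite -ExZ; apply: ler_Ex => [|q ql]; [exact: sumlaw_nonneg|exact: hitK (diffZ q ql)].
  have subZ i q z : q \in lw i -> z \in q.2 -> z \in Z i by exact: window_law_sub.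
  have := hc1 lw K Z B0 K0 lw0 subZ hitK; rewrite gE capB0 => h.
  apply: le_trans (ler_wpM2l (K0 i0) h).
  have NE : \prod_(i <- r) (kap i * E%:R^-1 ^+ d * N `^ (d%:R - beta i)) = Kr * N `^ (\sum_(i <- r) (d%:R - beta i)).
    rewrite big_split/=; congr (_ * _); elim: (r) => [|i r' IH]; first by rewrite !big_nil powRr0.
    by rewrite !big_cons IH [RHS]powRD// (gt_eqF N0) implybT.
  have prodle : Kr * N `^ (\sum_(i <- r) (d%:R - beta i)) <= \prod_(i <- r) (K i * (#|` Z i|)%:R).
    rewrite -NE big_seq [leRHS]big_seq; apply: ler_prod => i ir; apply/andP; split.
      by rewrite mulr_ge0 ?powR_ge0// mulr_ge0 ?(ltW (kap0 i))// exprn_ge0// invr_ge0 ltW.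
    have cardZ : E%:R^-1 ^+ d * N ^+ d <= (#|` Z i|)%:R :> R.
      have -> : Z i = cube (cc i) m.
        by rewrite /Z ifF//; apply/eqP => ii; move: uen; rewrite /= -ii ir.
      rewrite card_cube natrX -exprMn lerXn2r ?nnegrE ?ler0n//.
        by rewrite mulr_ge0 ?invr_ge0 ?(ltW E0) ?(ltW N0).
      rewrite mulrC ler_pdivrMr//.
      by apply: le_trans (ltW Nm) _; rewrite ler_wpM2r ?(ltW E0)// ler_nat ltnS leq_addr.
    have -> : kap i * E%:R^-1 ^+ d * N `^ (d%:R - beta i) = K i * (E%:R^-1 ^+ d * N ^+ d).
      rewrite powRD ?(gt_eqF N0) ?implybT// powR_mulrn ?(ltW N0)// /K; ring.
    by apply: ler_wpM2l; [exact: K0|exact: cardZ].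
  apply: (@le_trans _ _ (K i0 * (c1 * (Kr * N `^ (\sum_(i <- r) (d%:R - beta i))) * capacity gam A'))); last first.
    by rewrite ler_wpM2l// ler_wpM2r ?capacity_ge0 ?(ltW hgamma)// ler_wpM2l ?(ltW c10).
  have -> : N `^ e = N `^ (- beta i0) * N `^ (\sum_(i <- r) (d%:R - beta i)).
    by rewrite -bE [LHS]powRD// (gt_eqF N0) implybT.
  have capA2 : C2^-1 * capacity gam A <= capacity gam A' by rewrite mulrC ler_pdivrMr// mulrC.
  have pos : 0 <= kap i0 * (c1 * Kr) * (N `^ (- beta i0) * N `^ (\sum_(i <- r) (d%:R - beta i))).
    apply: mulr_ge0; last by rewrite mulr_ge0 ?powR_ge0.
    exact: mulr_ge0 (ltW (kap0 i0)) (mulr_ge0 (ltW c10) (ltW Kr0)).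
  have := ler_wpM2l pos capA2; rewrite /K; congr (_ <= _); ring.
apply: (@le_trans _ _ (P [set w | meets (window_sum X Z (i0 :: r) w) B0])).
  by rewrite (window_sum_law mX iX Z (fun S => meets S B0) uen) lee_fin.
rewrite translate_fset; apply: le_measure; rewrite ?inE.
- exact: (measurable_window_sum mX Z _ (fun S => meets S B0)).
- rewrite /hits (hits_minkowski_windows R); apply: bigcup_measurable => M _.
  exact: (measurable_window_sum mX _ _ (fun S => meets S _)).
move=> w /= /meetsP[z /(mem_window_sum _ _ _ _ uen)[g [hg zE]] /imfsetP[a /= aA za]].
exists z; split; last by rewrite /= za; apply/imfsetP; exists a => //; exact: A'A.
apply/mem_minkowski_big; exists g; split; last by rewrite zE -Er big_enum.
by move=> i; case: (hg i _); rewrite -?Er ?mem_enum.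
Qed.

Theorem theorem3p2 (R : realType) (d k : nat) (hd : (1 <= d)%N) (hk : (1 <= k)%N)
    (alpha beta : 'I_k -> R)
    (halpha : forall i, 0 < alpha i < d%:R)
    (hbeta : forall i, 0 < beta i < d%:R)
    (hgamma : 0 < \sum_(i < k) alpha i - (k%:R - 1) * d%:R)
    (hbetasum : 0 < \sum_(i < k) beta i - (k%:R - 1) * d%:R)
    (c C : R) (hc : 0 < c) (hcC : c <= C) :
  exists c' C' : R, 0 < c' /\ c' <= C' /\
  forall (disp : measure_display) (T : measurableType disp)
    (P : probability T R) (X : 'I_k -> T -> set 'rV[int]_d),
    (forall i, random_subset (X i)) ->
    mutually_independent P X ->
    (forall (i : 'I_k) (B : {fset 'rV[int]_d}) (x : 'rV[int]_d),
       0 \in B -> x != 0 -> 2 * diam R B <= enorm R x ->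
       ((c * enorm R x `^ (- beta i) * capacity (alpha i) B)%:E
          <= P (hits (X i) (translate x [set` B]))
          <= (C * enorm R x `^ (- beta i) * capacity (alpha i) B)%:E)%E) ->
    forall (A : {fset 'rV[int]_d}) (x : 'rV[int]_d),
      0 \in A -> x != 0 ->
      2 * diam R A
        + \big[Num.max/0]_(i < k)
            (if alpha i <= beta i then
               diam R A `^ ((d%:R - alpha i) / (d%:R - beta i))
                 * ln (diam R A + 1) `^ (d%:R - beta i)^-1
             else 0)
        <= enorm R x ->
      let gamma := \sum_(i < k) alpha i - (k%:R - 1) * d%:R in
      let sumX := fun w => \big[@minkowski_sum _/[set 0]]_(i < k) X i w in
      let e := (k%:R - 1) * d%:R - \sum_(i < k) beta i in
      ((c' * enorm R x `^ e * capacity gamma A)%:E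
         <= P (hits sumX (translate x [set` A]))
         <= (C' * enorm R x `^ e * capacity gamma A)%:E)%E.

Proof.
have hC : 0 < C by apply: lt_le_trans hcC.
have [c1 c10 lower] := lower_bound hk halpha hbeta hgamma hc hC.
have [C1 C10 upper] := upper_bound hk halpha hbeta hgamma hbetasum hc hC.
exists c1, (c1 + C1); split => //; split; first by rewrite lerDl ltW.
move=> disp T P X mX iX hX A x A0 x0 hx; cbv zeta.
have N0 : 0 <= enorm R x by exact: enorm_ge0.
apply/andP; split.
  apply: lower => //; apply: le_trans hx.
  by rewrite lerDl; exact: bigmax_ge_id.
apply: le_trans (upper _ _ P X mX iX hX A x A0 x0 hx) _.
rewrite lee_fin ler_wpM2r ?capacity_ge0 ?(ltW hgamma)//.
by rewrite ler_wpM2r ?powR_ge0// lerDr ltW.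
Qed.
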